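(* Let $\psi:=\sum_{\boldsymbol\alpha\in\mathbb F_{n_1}^+\times\cdots\times\mathbb F_{n_k}^+}A_{(\boldsymbol\alpha)}\otimes\mathbf Z_{\boldsymbol\alpha}$, $A_{(\boldsymbol\alpha)}\in B(\mathcal K)$, be a formal power series and define $\gamma\in[0,\infty]$ by setting $$\frac1\gamma:=\limsup_{\mathbf p=(p_1,\dots,p_k)\in\mathbb Z_+^k}\left\|\sum_{\boldsymbol\alpha\in\Lambda_{\mathbf p}}\frac1{b_{1,\alpha_1}\cdots b_{k,\alpha_k}}A_{(\boldsymbol\alpha)}^*A_{(\boldsymbol\alpha)}\right\|^{\frac1{2(p_1+\cdots+p_k)}}.$$ Then the following statements hold. (i) For every Hilbert space $\mathcal H$, the series $$\sum_{\mathbf p\in\mathbb Z_+^k}\left\|\sum_{\boldsymbol\alpha\in\Lambda_{\mathbf p}}A_{(\boldsymbol\alpha)}\otimes\mathbf X_{\boldsymbol\alpha}\right\|,\qquad\mathbf X\in\gamma\mathbf D_{\mathbf q}(\mathcal H),$$ is convergent. Moreover, the convergence is uniform on $r\mathbf D_{\mathbf q}(\mathcal H)^-$ if $0\le r<\gamma$. (ii) If $\gamma\in[0,\infty)$ and $s>\gamma$, then there is a Hilbert space $\mathcal H$ and $\mathbf Y\in s\mathbf D_{\mathbf q}(\mathcal H)^-$ such that the series $\sum_{\mathbf p\in\mathbb Z_+^k}\sum_{\boldsymbol\alpha\in\Lambda_{\mathbf p}}A_{(\boldsymbol\alpha)}\otimes\mathbf Y_{\boldsymbol\alpha}$ is divergent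 in the operator norm topology.
   Context: Polydomains. Fix $k\in\mathbb N=\{1,2,\dots\}$ and $n_1,\dots,n_k\in\mathbb N$. Hilbert spaces are complex; $A>0$ means that the operator $A$ is positive and invertible. $\mathbb F_{n_i}^+$ is the unital free semigroup on generators $g^i_1,\dots,g^i_{n_i}$ with identity $g^i_0$, and $|\alpha|$ is the length of $\alpha$. For $X_i=(X_{i,1},\dots,X_{i,n_i})\in B(\mathcal H)^{n_i}$ put $X_{i,\alpha}:=X_{i,j_1}\cdots X_{i,j_p}$ if $\alpha=g^i_{j_1}\cdots g^i_{j_p}$, and $X_{i,g_0^i}:=I$. Fix $\mathbf q=(q_1,\dots,q_k)$, where each $q_i=\sum_{\alpha\in\mathbb F_{n_i}^+}a_{i,\alpha}Z_\alpha$ is a positive regular polynomial in $n_i$ noncommuting indeterminates: a finite sum with $a_{i,\alpha}\ge0$, $a_{i,g_0^i}=0$ and $a_{i,g_j^i}>0$ for $j=1,\dots,n_i$. Define $\Phi_{q_i,X_i}(Y):=\sum_\alpha a_{i,\alpha}X_{i,\alpha}YX_{i,\alpha}^*$ for $Y\in B(\mathcal H)$. $B(\mathcal H)^{n_1}\times_c\cdots\times_cB(\mathcal H)^{n_k}$ is the set of $\mathbf X=(X_1,\dots,X_k)\in B(\mathcal H)^{n_1}\times\cdots\times B(\mathcal H)^{n_k}$ such that, for $s\ne t$, every entry of $X_s$ commutes with every entry of $X_t$. For $\mathbf p\in\{0,1\}^k$ let $\mathbf\Delta^{\mathbf p}_{\mathbf q,\mathbf X}:=(\mathrm{id}-\Phi_{q_1,X_1})^{p_1}\circ\cdots\circ(\mathrm{id}-\Phi_{q_k,X_k})^{p_k}$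 and $\mathbf\Delta_{\mathbf q,\mathbf X}:=\mathbf\Delta^{(1,\dots,1)}_{\mathbf q,\mathbf X}$. Set $\mathbf D^-_{\mathbf q}(\mathcal H):=\{\mathbf X\in B(\mathcal H)^{n_1}\times_c\cdots\times_cB(\mathcal H)^{n_k}:\mathbf\Delta^{\mathbf p}_{\mathbf q,\mathbf X}(I)\ge0\text{ for all }\mathbf p\in\{0,1\}^k\}$ and $\mathbf D_{\mathbf q}(\mathcal H):=\{\mathbf X\in\mathbf D^-_{\mathbf q}(\mathcal H):\mathbf\Delta_{\mathbf q,\mathbf X}(I)>0\}$; $\mathbf D_{\mathbf q}(\mathcal H)^-$ is the operator norm closure of $\mathbf D_{\mathbf q}(\mathcal H)$. For $r\in[0,\infty)$, $rG:=\{r\mathbf X:\mathbf X\in G\}$; for $\gamma=\infty$, $\gamma\mathbf D_{\mathbf q}(\mathcal H)$ is $\bigcup_{\rho>0}\rho\mathbf D_{\mathbf q}(\mathcal H)=B(\mathcal H)^{n_1}\times_c\cdots\times_cB(\mathcal H)^{n_k}$. Coefficients and notation. $b_{i,g_0^i}:=1$ and, for $|\alpha|\ge1$, $b_{i,\alpha}:=\sum_{p=1}^{|\alpha|}\sum a_{i,\gamma_1}\cdots a_{i,\gamma_p}$, the inner sum over $\gamma_1,\dots,\gamma_p\in\mathbb F_{n_i}^+$ with $\gamma_1\cdots\gamma_p=\alpha$ and all $|\gamma_l|\ge1$. For $\boldsymbol\alpha=(\alpha_1,\dots,\alpha_k)$, $\mathbf X_{\boldsymbol\alpha}:=X_{1,\alpha_1}\cdots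 X_{k,\alpha_k}$; $\mathbf Z_{\boldsymbol\alpha}$ is defined likewise from indeterminates $Z_{i,j}$ ($Z_{s,j},Z_{t,l}$ commuting when $s\ne t$). $\Lambda_{\mathbf p}:=\{\boldsymbol\alpha:|\alpha_i|=p_i,\ i=1,\dots,k\}$ for $\mathbf p\in\mathbb Z_+^k$ ($\mathbb Z_+$ the nonnegative integers). The limsup is taken as $p_1+\cdots+p_k\to\infty$, with $1/0=\infty$, $1/\infty=0$; series indexed by $\mathbb Z_+^k$ are unordered sums. *)

(* Defs.v *)
From HB Require Import structures.
From mathcomp Require Import all_boot all_order all_algebra finmap complex.
From mathcomp Require Import all_classical all_reals all_analysis.
From mathcomp.analysis.showcase Require Import summability.

Set Implicit Arguments.
Unset Strict Implicit.
Unset Printing Implicit Defensive.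

Import Order.TTheory GRing.Theory Num.Theory.
Import numFieldNormedType.Exports.

Local Open Scope classical_set_scope.
Local Open Scope ring_scope.
Local Open Scope complex_scope.

HB.mixin Record isHilbert (R : realType) V
    & CompleteNormedModule R[i] V := {
  hdot : {dot V for Num.conj} ;
  sqr_norm_hdot : forall x : V, `|x| ^+ 2 = hdot x x
}.

#[short(type="hilbertType")]
HB.structure Definition Hilbert (R : realType) :=
  {V of isHilbert R V & CompleteNormedModule R[i] V}.

Notation "''[' x , y ]" := (hdot x y) : ring_scope.

Section BoundedOperators.
Variables (R : realType) (H G : hilbertType R).

Definition bounded_operator : {pred H -> G} :=
  fun f => `[< linear f /\ exists M : R, forall x, `|f x| <= M%:C * `|x| >].

Record bop := Bop { bop_fun :> H -> G ; _ : bop_fun \in bounded_operator }.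

HB.instance Definition _ := [isSub for bop_fun].
HB.instance Definition _ := [Choice of bop by <:].

Lemma bounded_operator_submod_closed : submod_closed bounded_operator.
Proof.
split.
  apply/asboolP; split; first by move=> a x y; rewrite /= scaler0 addr0.
  by exists 0 => x; rewrite normr0 mul0r.
move=> a f g /asboolP[lf [M fM]] /asboolP[lg [N gN]]; apply/asboolP; split.
  move=> b x y /=; rewrite !fctE lf lg !scalerDr !scalerA (mulrC a b).
  by rewrite -!addrA; congr (_ + _); rewrite addrCA.
exists (complex.Re `|a| * M + N) => x.
have aE : (complex.Re `|a|)%:C = `|a|.
  by apply/RRe_real; rewrite normr_real.
rewrite rmorphD rmorphM /= aE mulrDl; apply: (le_trans (ler_normD _ _)).
by apply: lerD => //=; rewrite normrZ -mulrA ler_wpM2l.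
Qed.
HB.instance Definition _ := GRing.isSubmodClosed.Build R[i] (H -> G)
  bounded_operator bounded_operator_submod_closed.
HB.instance Definition _ := [SubChoice_isSubLmodule of bop by <:].

Lemma bopP (T : bop) : linear T /\ exists M : R, forall x, `|T x| <= M%:C * `|x|.
Proof. exact: (asboolP _ (valP T)). Qed.

(* The library norm of a complex normed module takes its (real) values in R[i];
   opnorm is the operator norm as an element of R. *)
Definition opnorm (T : bop) : R :=
  sup [set complex.Re `|T x| | x in [set x : H | `|x| <= 1]].

Let ReN (V : normedModType R[i]) (x : V) : (complex.Re `|x|)%:C = `|x|.
Proof. by apply/RRe_real; rewrite normr_real. Qed.

Let ReC (a : R[i]) : (complex.Re `|a|)%:C = `|a|.
Proof. by apply/RRe_real; rewrite normr_real. Qed.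

Let CM (x y : R) : (x * y)%:C = x%:C * y%:C.
Proof. exact: rmorphM. Qed.

Lemma opnorm_has_sup (T : bop) :
  has_sup [set complex.Re `|T x| | x in [set x : H | `|x| <= 1]].
Proof.
have [_ [M TM]] := bopP T; split.
  by exists (complex.Re `|T 0|), 0 => //=; rewrite normr0 ler01.
exists `|M| => _ [x /= x1 <-]; rewrite -lecR ReN; apply: (le_trans (TM x)).
rewrite (@le_trans _ _ (`|M|%:C * `|x|))//.
  by rewrite ler_wpM2r// lecR ler_norm.
by rewrite ler_piMr// lecR.
Qed.

Lemma opnorm_ge0 (T : bop) : 0 <= opnorm T.
Proof.
apply: (@le_trans _ _ (complex.Re `|T 0|)); first by rewrite -lecR ReN normr_ge0.
apply: ub_le_sup; first by case: (opnorm_has_sup T).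
by exists 0 => //=; rewrite normr0 ler01.
Qed.

Lemma opnorm_bound (T : bop) x : `|T x| <= (opnorm T)%:C * `|x|.
Proof.
have [lT _] := bopP T.
have T0 : T 0 = 0 by have := lT (-1) 0 0; rewrite scaler0 addr0 scaleN1r addNr.
have TZ a y : T (a *: y) = a *: T y by have := lT a y 0; rewrite T0 !addr0.
have [->|x0] := eqVneq x 0; first by rewrite T0 !normr0 mulr0.
have nx : `|x| != 0 by rewrite normr_eq0.
rewrite -ler_pdivrMr ?normr_gt0//.
have -> : `|T x| / `|x| = `|T (`|x|^-1 *: x)|.
  by rewrite TZ normrZ normfV normr_id mulrC.
rewrite -ReN lecR; apply: ub_le_sup; first by case: (opnorm_has_sup T).
by exists (`|x|^-1 *: x) => //=; rewrite normrZ normfV normr_id mulVf.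
Qed.

Lemma opnorm_le (T : bop) (M : R) : 0 <= M ->
  (forall x, `|T x| <= M%:C * `|x|) -> opnorm T <= M.
Proof.
move=> M0 TM; apply: ge_sup; first by case: (opnorm_has_sup T).
move=> _ [x /= x1 <-]; rewrite -lecR ReN (le_trans (TM x))//.
by rewrite ler_piMr// lecR.
Qed.

Let norm_bop (T : bop) : R[i] := (opnorm T)%:C.

Let bop_normD S T : norm_bop (S + T) <= norm_bop S + norm_bop T.
Proof.
rewrite /norm_bop -rmorphD lecR; apply: opnorm_le => [|x].
  by rewrite addr_ge0// opnorm_ge0.
rewrite rmorphD mulrDl; apply: (le_trans (ler_normD _ _)).
by apply: lerD; exact: opnorm_bound.
Qed.

Let bop_normZ (a : R[i]) T : norm_bop (a *: T) = `|a| * norm_bop T.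
Proof.
have le b S : opnorm (b *: S) <= complex.Re `|b| * opnorm S.
  apply: opnorm_le => [|x].
    by rewrite mulr_ge0 ?opnorm_ge0// -lecR ReC normr_ge0.
  rewrite CM ReC normrZ -mulrA.
  by apply: ler_wpM2l => //; exact: opnorm_bound.
rewrite /norm_bop -[ `|a| ]ReC -CM; congr (_%:C).
apply/eqP; rewrite eq_le le andTb.
have [->|a0] := eqVneq a 0; first by rewrite normr0 mul0r opnorm_ge0.
have := le a^-1 (a *: T); rewrite scalerA mulVf// scale1r => h.
have ra : 0 < complex.Re `|a|.
  by rewrite -ltcR ReC normr_gt0.
have -> : opnorm (a *: T) =
    complex.Re `|a| * (complex.Re `|a^-1| * opnorm (a *: T)).
  rewrite mulrA; suff -> : complex.Re `|a| * complex.Re `|a^-1| = 1.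
    by rewrite mul1r.
  apply: (@complexI R); rewrite CM ReC.
  by rewrite ReC normfV mulfV ?normr_eq0.
by rewrite ler_pM2l.
Qed.

Let bop_norm0_eq0 T : norm_bop T = 0 -> T = 0.
Proof.
move=> /(@complexI R) T0; apply: val_inj; apply/funext => x /=.
by apply/eqP; rewrite -normr_le0 (le_trans (opnorm_bound T x))// T0 mul0r.
Qed.

HB.instance Definition _ :=
  Lmodule_isNormed.Build R[i] bop bop_normD bop_normZ bop_norm0_eq0.

End BoundedOperators.

Arguments bounded_operator {R} H G.
Arguments bop {R} H G.

Section BoundedEndomorphisms.
Variables (R : realType) (H : hilbertType R).

Lemma bounded_operator_id : @idfun H \in bounded_operator H H.
Proof.
apply/asboolP; split; first by [].
by exists 1 => x; rewrite mul1r.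
Qed.

Lemma bounded_operator_comp (S T : bop H H) : S \o T \in bounded_operator H H.
Proof.
have [lS _] := bopP S; have [lT _] := bopP T; apply/asboolP; split.
  by move=> a x y /=; rewrite lT lS.
exists (opnorm S * opnorm T) => x /=.
rewrite rmorphM -mulrA; apply: (le_trans (opnorm_bound S (T x))).
by rewrite ler_wpM2l ?opnorm_bound// lecR opnorm_ge0.
Qed.

Definition bop_id : bop H H := Bop bounded_operator_id.
Definition bop_comp (S T : bop H H) : bop H H := Bop (bounded_operator_comp S T).

Let bop_eqP (S T : bop H H) : S =1 T -> S = T.
Proof. by move=> ST; apply: val_inj; apply/funext. Qed.

Let bop_compA : associative bop_comp. Proof. by move=> *; exact: bop_eqP. Qed.
Let bop_comp1l : left_id bop_id bop_comp. Proof. by move=> *; exact: bop_eqP. Qed.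
Let bop_comp1r : right_id bop_id bop_comp. Proof. by move=> *; exact: bop_eqP. Qed.
Let bop_compDl : left_distributive bop_comp +%R.
Proof. by move=> *; exact: bop_eqP. Qed.
Let bop_compDr : right_distributive bop_comp +%R.
Proof.
move=> S T U; apply: bop_eqP => x /=; have [lS _] := bopP S.
by have := lS 1 (T x) (U x); rewrite !scale1r.
Qed.

HB.instance Definition _ := GRing.Zmodule_isPzRing.Build (bop H H)
  bop_compA bop_comp1l bop_comp1r bop_compDl bop_compDr.

(* The value 1 (the identity) is only a default: the Hilbert adjoint always
   exists and is unique. *)
Definition adjoint (T : bop H H) : bop H H :=
  xget 1 [set S : bop H H | forall x y : H, '[T x, y] = '[x, S y]].

(* In R[i], 0 <= z means that z is real and nonnegative. *)
Definition positive_op (T : bop H H) : Prop := forall x : H, 0 <= '[T x, x].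

Definition invertible_op (T : bop H H) : Prop :=
  exists S : bop H H, S * T = 1 /\ T * S = 1.

Definition strictly_positive_op (T : bop H H) : Prop :=
  positive_op T /\ invertible_op T.

End BoundedEndomorphisms.

Section TensorProduct.
Variables (R : realType) (K H T : hilbertType R).

(* T together with (x, y) |-> x (x) y is a Hilbert space tensor product of K
   and H; this determines T up to a unique unitary compatible with the
   elementary tensors. *)
Definition is_hilbert_tensor (tau : {bilinear K -> H -> T}) : Prop :=
  (forall (x x' : K) (y y' : H),
     '[tau x y, tau x' y'] = '[x, x'] * '[y, y']) /\
  closure [set t : T | exists (m : nat) (x : 'I_m -> K) (y : 'I_m -> H),
                         t = \sum_(i < m) tau (x i) (y i)] = setT.

(* When tau is a Hilbert space tensor product, A (x) X exists and is unique;
   0 is only a default. *)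
Definition tensor_op (tau : {bilinear K -> H -> T})
    (A : bop K K) (X : bop H H) : bop T T :=
  xget 0 [set Z : bop T T | forall (x : K) (y : H), Z (tau x y) = tau (A x) (X y)].

End TensorProduct.

Section Polydomains.
Variable R : realType.

Definition positive_regular (n : nat) (q : {fsfun seq 'I_n -> R with 0}) : Prop :=
  [/\ forall alpha, 0 <= q alpha, q [::] = 0 & forall j, 0 < q [:: j]].

(* The pairs (p, g) are the factorizations of alpha into p nonempty words. *)
Definition bcoef (n : nat) (q : {fsfun seq 'I_n -> R with 0})
    (alpha : seq 'I_n) : R :=
  if alpha is [::] then 1 else
  \sum_(1 <= p < (size alpha).+1)
    \sum_(g \in [set g : p.-tuple (seq 'I_n) |
                   flatten g = alpha /\ forall l, (1 <= size (tnth g l))%N])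
      \prod_(l < p) q (tnth g l).

Definition word_op (H : hilbertType R) (n : nat) (X : 'I_n -> bop H H)
    (alpha : seq 'I_n) : bop H H := \prod_(j <- alpha) X j.

Definition Phi (H : hilbertType R) (n : nat) (q : {fsfun seq 'I_n -> R with 0})
    (X : 'I_n -> bop H H) (Y : bop H H) : bop H H :=
  \sum_(alpha <- finsupp q)
    (q alpha)%:C *: (word_op X alpha * Y * adjoint (word_op X alpha)).

Variables (k : nat) (n : 'I_k -> nat).

Definition optuple (H : hilbertType R) : Type :=
  forall i : 'I_k, 'I_(n i) -> bop H H.

HB.instance Definition _ H := gen_eqMixin (optuple H).
HB.instance Definition _ H := gen_choiceMixin (optuple H).

Definition multiword : Type := forall i : 'I_k, seq 'I_(n i).

Definition multiword_op (H : hilbertType R) (X : optuple H)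
    (alpha : multiword) : bop H H := \prod_(i < k) word_op (X i) (alpha i).

Definition commuting (H : hilbertType R) : set (optuple H) :=
  [set X | forall s t : 'I_k, s != t ->
     forall (j : 'I_(n s)) (l : 'I_(n t)), X s j * X t l = X t l * X s j].

Definition multidegree : Type := {ffun 'I_k -> nat}.
HB.instance Definition _ := Choice.on multidegree.

Definition total_degree (p : multidegree) : nat := (\sum_(i < k) p i)%N.

(* The sum over Lambda_p, i.e. over the multiwords with |alpha_i| = p_i. *)
Definition sum_Lambda (V : nmodType) (p : multidegree) (F : multiword -> V) : V :=
  \sum_(alpha : {dffun forall i : 'I_k, (p i).-tuple 'I_(n i)})
    F (fun i => tval (alpha i)).

Definition degree_infty : set_system multidegree :=
  filter_from setT (fun N : nat => [set p | (N <= total_degree p)%N]).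

Variable q : forall i : 'I_k, {fsfun seq 'I_(n i) -> R with 0}.

Definition Delta (H : hilbertType R) (X : optuple H) (p : 'I_k -> bool) :
    bop H H -> bop H H :=
  \big[comp/idfun]_(i < k) iter (p i) (fun Y => Y - Phi (q i) (X i) Y).

Definition polydomain_minus (H : hilbertType R) : set (optuple H) :=
  [set X | commuting X /\
     forall p : 'I_k -> bool, positive_op (Delta X p 1)].

Definition polydomain (H : hilbertType R) : set (optuple H) :=
  [set X | polydomain_minus X /\ strictly_positive_op (Delta X (fun=> true) 1)].

Definition op_closure (H : hilbertType R) (G : set (optuple H)) :
    set (optuple H) :=
  [set X | forall e : R, 0 < e ->
     exists2 Y, G Y & forall i j, opnorm (X i j - Y i j) < e].

Definition dilate (H : hilbertType R) (r : R) (G : set (optuple H)) :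
    set (optuple H) :=
  (fun (X : optuple H) i j => r%:C *: X i j) @` G.

(* The case -oo is junk: radii are nonnegative. *)
Definition edilate (H : hilbertType R) (g : \bar R) (G : set (optuple H)) :
    set (optuple H) :=
  match g with
  | r%:E => dilate r G
  | +oo%E => \bigcup_(rho in [set rho : R | 0 < rho]) dilate rho G
  | -oo%E => set0
  end.

Variable K : hilbertType R.
Variable A : multiword -> bop K K.

(* limf_esup of the library along degree_infty, unfolded because limf_esup
   requires its index type to be a filteredType. *)
Definition limsup_degree (f : multidegree -> \bar R) : \bar R :=
  ereal_inf [set ereal_sup (f @` V) | V in degree_infty].

Definition inv_conv_radius : \bar R :=
  limsup_degree (fun p : multidegree =>
    (opnorm (sum_Lambda p (fun alpha =>
       ((\prod_(i < k) bcoef (q i) (alpha i))^-1)%:C *: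
         (adjoint (A alpha) * A alpha)))
     `^ ((2 * total_degree p)%N%:R^-1))%:E).

Definition conv_radius : \bar R := (inv_conv_radius^-1)%E.

Definition homogeneous_part (H T : hilbertType R)
    (tau : {bilinear K -> H -> T}) (X : optuple H) (p : multidegree) : bop T T :=
  sum_Lambda p (fun alpha => tensor_op tau (A alpha) (multiword_op X alpha)).

End Polydomains.

Arguments polydomain_minus {R k n} q H.
Arguments polydomain {R k n} q H.

(* Main.v *)
Require Import Defs.
From HB Require Import structures.
From mathcomp Require Import all_boot all_order all_algebra finmap complex.
From mathcomp Require Import all_classical all_reals all_analysis.
From mathcomp.analysis.showcase Require Import summability.
From mathcomp Require Import ring lra zify.

Set Implicit Arguments.
Unset Strict Implicit.
Unset Printing Implicit Defensive.

Import Order.TTheory GRing.Theory Num.Theory.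
Import numFieldNormedType.Exports.

Local Open Scope classical_set_scope.
Local Open Scope ring_scope.
Local Open Scope complex_scope.

(** Write c_p for the norm of the sum over Lambda_p of
    b_alpha^-1 A_alpha^adj A_alpha, where b_alpha is the product of the
    b_{i,alpha_i}; then 1/gamma is the limsup of c_p^(1/(2|p|)).

    Convergence. Only the inequalities Phi_{q_i,X_i}(I) <= I matter
    ([row_contraction]). The coefficients b solve a renewal equation
    ([bcoef_rec]): b_alpha is the sum over d >= 1 of a_{prefix of length d} times
    b_{remaining word}. Hence the sum of b_alpha X_alpha X_alpha^adj over the
    words of length p is the sum over d of the degree d part of Phi applied to
    the same sum for p - d, and by induction it is at most Phi(I) <= I
    ([sum_words_bcoef_le]). Treating the variables one after the other bounds the
    sum over Lambda_p ([sum_Lambda_bcoef_le]). Viewing the homogeneous part as a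
    row of operators X_alpha times a column of operators A_alpha then gives
    ||sum_{Lambda_p} A_alpha (x) (rX)_alpha|| <= r^|p| sqrt(c_p)
    ([opnorm_homogeneous_part_le]), and the right-hand side is summable for
    r < gamma by comparison with a multiple geometric series
    ([majorant_bounded]). This majorant is independent of X, whence uniformity;
    the inequalities Phi(I) <= I survive norm limits
    ([row_contraction_closed]). On gamma D itself one gains a little room: for X
    in D the defect Delta_X(I) is bounded below by some c > 0 and is dominated by
    each I - Phi_{q_i,X_i}(I), so X = r X' for some r < 1 and some X' with
    Phi_{q_i,X'_i}(I) <= I ([polydomain_shrink]).

    Divergence. The universal model is the tuple W of weighted left creation
    operators on l2 of the multiwords, with weights such that W_alpha sends the
    vacuum e to b_alpha^(-1/2) e_alpha. Therefore
    ||sum_{Lambda_p} A_alpha (x) (sW)_alpha (x (x) e)||^2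
    = s^(2|p|) sum_{Lambda_p} b_alpha^-1 ||A_alpha x||^2
    ([rnorm_homogeneous_shift]), so the p-th homogeneous part has norm at least
    s^|p| sqrt(c_p). If the series converged these norms would be at most 1 for
    all but finitely many p, forcing 1/gamma <= 1/s, against s > gamma. For
    r < 1 the operators Delta^p_{rW}(I) are diagonal with entries at least
    (1 - r^2)^k, so rW lies in D and W in its closure
    ([weighted_shift_closure]).

    The Hilbert space facts behind this are Riesz representation, which provides
    the adjoints, the boundedness of A (x) X, obtained by extension from sums of
    elementary tensors, and the spaces l2(I; V), which provide W and the tensor
    product of K with l2(I). *)

#[local] Existing Instance totally_filter.

(** * Real-valued norms and inner products *)

Section RealNorm.
Variables (R : realType) (V : normedModType R[i]).
Implicit Types (x y z : V).

Definition rnorm x : R := complex.Re `|x|.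

Lemma rnormE x : (rnorm x)%:C = `|x|.
Proof. by apply/RRe_real; rewrite normr_real. Qed.

Lemma rnorm_ge0 x : 0 <= rnorm x.
Proof. by rewrite -lecR rnormE normr_ge0. Qed.

Lemma rnorm0 : rnorm 0 = 0.
Proof. by apply: (@complexI R); rewrite rnormE normr0. Qed.

Lemma rnorm_eq0 x : (rnorm x == 0) = (x == 0).
Proof. by rewrite -(inj_eq (@complexI R)) rnormE normr_eq0. Qed.

Lemma ler_rnormD x y : rnorm (x + y) <= rnorm x + rnorm y.
Proof. by rewrite -lecR rmorphD/= !rnormE ler_normD. Qed.

Lemma rnormN x : rnorm (- x) = rnorm x.
Proof. by rewrite /rnorm normrN. Qed.

Lemma rdistC x y : rnorm (x - y) = rnorm (y - x).
Proof. by rewrite /rnorm distrC. Qed.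

Lemma ler_rdistD z x y : rnorm (x - y) <= rnorm (x - z) + rnorm (z - y).
Proof. by rewrite -[in leLHS](subrK z x) -addrA ler_rnormD. Qed.

Lemma rnormZ (a : R) x : rnorm (a%:C *: x) = `|a| * rnorm x.
Proof.
by apply: (@complexI R); rewrite rnormE normrZ rmorphM/= rnormE normc_def/= expr0n/= addr0 sqrtr_sqr.
Qed.

Lemma rnormZc (a : R[i]) x : rnorm (a *: x) = complex.Re `|a| * rnorm x.
Proof.
by apply: (@complexI R); rewrite rnormE normrZ rmorphM/= !rnormE.
Qed.

Lemma rnorm_le x (M : R) : (rnorm x <= M) = (`|x| <= M%:C).
Proof. by rewrite -lecR rnormE. Qed.

Lemma ler_rnormB x y : rnorm x - rnorm y <= rnorm (x - y).
Proof. by rewrite lerBlDr -[in leLHS](subrK y x) ler_rnormD. Qed.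
End RealNorm.

Section ComplexDot.
Variables (R : realType) (V : lmodType R[i]) (D : V -> V -> R).
Hypothesis DC : forall x y, D x y = D y x.
Hypothesis DD : forall x y z, D (x + y) z = D x z + D y z.
Hypothesis DZ : forall (a : R) x y, D (a%:C *: x) y = a * D x y.
Hypothesis DI : forall x y, D ('i%C *: x) ('i%C *: y) = D x y.
Hypothesis Dge0 : forall x, 0 <= D x x.

(** The complex inner product whose real part is D; sesquilinearity dictates its
    imaginary part. *)
Definition complex_dot x y : R[i] := (D x y) +i* (D x ('i%C *: y)).

Let i2 (z : V) : 'i%C *: ('i%C *: z) = - z.
Proof. by rewrite scalerA -expr2 sqr_i scaleN1r. Qed.
Let DN x y : D (- x) y = - D x y.
Proof. by have := DZ (-1) x y; rewrite rmorphN1 scaleN1r mulN1r. Qed.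
Let Di x y : D ('i%C *: x) y = - D x ('i%C *: y).
Proof. by rewrite -DI i2 DN. Qed.

Lemma real_dot_Zc (a : R[i]) x y :
  D (a *: x) y = complex.Re a * D x y - complex.Im a * D x ('i%C *: y).
Proof.
have -> : a *: x = (complex.Re a)%:C *: x + (complex.Im a)%:C *: ('i%C *: x).
  by rewrite scalerA -scalerDl; congr (_ *: _); case: a => u v; simpc.
by rewrite DD !DZ Di mulrN.
Qed.

Lemma complex_dot_linear y : linear_for *%R (complex_dot ^~ y).
Proof.
move=> a x z; rewrite /complex_dot !DD !real_dot_Zc.
have e : D x ('i%C *: ('i%C *: y)) = - D x y.
  by rewrite i2 DC DN DC.
rewrite e; case: a => u v /=; simpc; congr (_ +i* _); ring.
Qed.

Lemma complex_dotC x y : complex_dot x y = (complex_dot y x)^*%C.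
Proof. by rewrite /complex_dot /= DC; congr (_ +i* _); rewrite [in RHS]DC Di opprK. Qed.

Lemma complex_dot_conj_linear x : linear_for (Num.conj \; *%R) (complex_dot x).
Proof.
move=> a y z; rewrite (complex_dotC x) (complex_dotC x y) (complex_dotC x z).
by rewrite complex_dot_linear rmorphD rmorphM.
Qed.

Lemma complex_dotxx x : complex_dot x x = (D x x)%:C.
Proof.
rewrite /complex_dot; suff -> : D x ('i%C *: x) = 0 by [].
have : D x ('i%C *: x) = - D x ('i%C *: x) by rewrite -[in RHS]Di DC.
by move=> /eqP; rewrite -addr_eq0 -mulr2n mulrn_eq0/= => /eqP.
Qed.

(** The quadratic t |-> D (x + t y) (x + t y) is nonnegative. D need not be
    definite, so this also serves (x, y) |-> <T x, y> for a positive T. *)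
Lemma real_dot_CS_sqr x y : D x y ^+ 2 <= D x x * D y y.
Proof.
have DDr u v w : D u (v + w) = D u v + D u w by rewrite DC DD !(DC u).
have DZr u a w : D u (a%:C *: w) = a * D u w by rewrite DC DZ DC.
have key (t : R) : 0 <= D x x + 2 * t * D x y + t ^+ 2 * D y y.
  have := Dge0 (x + t%:C *: y); rewrite !(DD, DDr) !(DZ, DZr) (DC y x).
  suff -> : forall a b c : R, a + t * b + (t * b + t * (t * c)) =
    a + 2 * t * b + t ^+ 2 * c by [].
  by move=> *; ring.
have [y0|y0] := eqVneq (D y y) 0.
  rewrite y0 in key *; rewrite mulr0.
  have [->|b0] := eqVneq (D x y) 0; first by rewrite expr0n.
  (* the quadratic is affine in t here, and would be -1 at this t *)
  have := key (- (D x x + 1) / (2 * D x y)).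
  have -> : 2 * (- (D x x + 1) / (2 * D x y)) * D x y = - (D x x + 1) by field.
  by rewrite mulr0 addr0; lra.
have yp : 0 < D y y by rewrite lt_neqAle eq_sym y0 Dge0.
have := key (- D x y / D y y).
move: (D x x) (D x y) (D y y) y0 yp => a b c c0 cp.
have -> : a + 2 * (- b / c) * b + (- b / c) ^+ 2 * c = a - b ^+ 2 / c by field.
by rewrite subr_ge0 ler_pdivrMr.
Qed.

Lemma real_dot_CS x y : D x y <= Num.sqrt (D x x) * Num.sqrt (D y y).
Proof.
rewrite -sqrtrM//; have /ler_wsqrtr := real_dot_CS_sqr x y.
by apply: le_trans; rewrite sqrtr_sqr ler_norm.
Qed.

Lemma real_dot_triangle x y :
  Num.sqrt (D (x + y) (x + y)) <= Num.sqrt (D x x) + Num.sqrt (D y y).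
Proof.
rewrite -(@ler_pXn2r _ 2%N)// ?nnegrE ?addr_ge0 ?sqrtr_ge0// sqr_sqrtr//.
rewrite sqrrD !sqr_sqrtr//.
rewrite DD !(DC _ (x + y)) !DD (DC y x).
have := real_dot_CS x y; move: (Num.sqrt _ * _) => s; lra.
Qed.

Lemma real_dot_norm (a : R[i]) x :
  D (a *: x) (a *: x) = (complex.Re `|a|) ^+ 2 * D x x.
Proof.
apply: (@complexI R); rewrite -complex_dotxx (scalable_linear (complex_dot_linear _)).
rewrite (scalable_linear (complex_dot_conj_linear _)) /= complex_dotxx mulrA -normCK.
by rewrite [RHS]rmorphM/= [X in _ = X * _]rmorphXn/=.
Qed.
End ComplexDot.

Section RealDot.
Variables (R : realType) (H : hilbertType R).
Implicit Types (x y z : H).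

(** The real part of the inner product determines it ([hdot_rdot]) and keeps all
    inequalities in R. *)
Definition rdot x y : R := complex.Re '[x, y].

Lemma hdotC x y : '[x, y] = ('[y, x])^*%C.
Proof. by rewrite hermC expr0 mul1r. Qed.

Lemma rdotC x y : rdot x y = rdot y x.
Proof. by rewrite /rdot hdotC; case: ('[y, x]). Qed.

Lemma rdotDl x y z : rdot (x + y) z = rdot x z + rdot y z.
Proof. by rewrite /rdot linearDl raddfD. Qed.
Lemma rdotDr x y z : rdot x (y + z) = rdot x y + rdot x z.
Proof. by rewrite rdotC rdotDl !(rdotC x). Qed.
Lemma rdotZl (a : R) x y : rdot (a%:C *: x) y = a * rdot x y.
Proof.
rewrite /rdot linearZl_LR/=; case: ('[x, y]) => u v /=.
by rewrite mul0r subr0.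
Qed.
Lemma rdotZr (a : R) x y : rdot x (a%:C *: y) = a * rdot x y.
Proof. by rewrite rdotC rdotZl rdotC. Qed.
Lemma rdotNl x y : rdot (- x) y = - rdot x y.
Proof. by rewrite /rdot linearNl raddfN. Qed.
Lemma rdotNr x y : rdot x (- y) = - rdot x y.
Proof. by rewrite rdotC rdotNl rdotC. Qed.
Lemma rdotBl x y z : rdot (x - y) z = rdot x z - rdot y z.
Proof. by rewrite rdotDl rdotNl. Qed.
Lemma rdotBr x y z : rdot x (y - z) = rdot x y - rdot x z.
Proof. by rewrite rdotDr rdotNr. Qed.
Lemma rdot0l x : rdot 0 x = 0.
Proof. by rewrite /rdot linear0l. Qed.
Lemma rdot0r x : rdot x 0 = 0.
Proof. by rewrite rdotC rdot0l. Qed.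
Lemma rdot_suml (I : Type) (r : seq I) (P : pred I) (F : I -> H) y :
  rdot (\sum_(i <- r | P i) F i) y = \sum_(i <- r | P i) rdot (F i) y.
Proof. by elim/big_rec2: _ => [|i a b _ <-]; rewrite ?rdot0l ?rdotDl. Qed.
Lemma rdot_sumr (I : Type) (r : seq I) (P : pred I) (F : I -> H) y :
  rdot y (\sum_(i <- r | P i) F i) = \sum_(i <- r | P i) rdot y (F i).
Proof. by elim/big_rec2: _ => [|i a b _ <-]; rewrite ?rdot0r ?rdotDr. Qed.

Lemma hdot_rdot x y : '[x, y] = (rdot x y)%:C + 'i%C * (rdot x ('i%C *: y))%:C.
Proof.
rewrite /rdot linearZr_LR/=; case: ('[x, y]) => u v; by simpc.
Qed.

Lemma rdot_iI x y : rdot ('i%C *: x) ('i%C *: y) = rdot x y.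
Proof.
rewrite /rdot linearZr_LR/= linearZl_LR/= mulrA; case: ('[x, y]) => u v; simpc.
done.
Qed.

Lemma rdot_i x y : rdot ('i%C *: x) y = - rdot x ('i%C *: y).
Proof.
by rewrite -[RHS]rdotNl -[in LHS]rdot_iI scalerA -expr2 sqr_i scaleN1r.
Qed.

Lemma rdotxx x : rdot x x = rnorm x ^+ 2.
Proof.
rewrite /rdot -sqr_norm_hdot; apply: (@complexI R).
by rewrite rmorphXn/= rnormE -rnormE -rmorphXn/= .
Qed.

Lemma hdotxx x : '[x, x] = (rnorm x ^+ 2)%:C.
Proof. by rewrite -sqr_norm_hdot rmorphXn/= rnormE. Qed.

Lemma sqr_rnormD x y : rnorm (x + y) ^+ 2 = rnorm x ^+ 2 + 2 * rdot x y + rnorm y ^+ 2.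
Proof. rewrite -!rdotxx rdotDl !rdotDr (rdotC y x); ring. Qed.

Lemma sqr_rnormB x y : rnorm (x - y) ^+ 2 = rnorm x ^+ 2 - 2 * rdot x y + rnorm y ^+ 2.
Proof. by rewrite sqr_rnormD rdotNr rnormN mulrN. Qed.

Lemma rdot_le x y : rdot x y <= rnorm x * rnorm y.
Proof.
have := real_dot_CS rdotC rdotDl rdotZl (fun x => _ : 0 <= rdot x x) x y.
by rewrite !rdotxx !sqrtr_sqr !ger0_norm ?rnorm_ge0//; apply=> z; rewrite rdotxx sqr_ge0.
Qed.

Lemma rdot_norm_le x y : `|rdot x y| <= rnorm x * rnorm y.
Proof.
rewrite ler_norml rdot_le andbT lerNl -rdotNl.
by apply: (le_trans (rdot_le _ _)); rewrite rnormN.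
Qed.

Lemma rdot_inj x y : (forall z, rdot z x = rdot z y) -> x = y.
Proof.
move=> h; apply/eqP; rewrite -subr_eq0 -rnorm_eq0 -sqrf_eq0 -rdotxx.
by rewrite rdotBr h subrr.
Qed.

Lemma parallelogram x y :
  rnorm (x - y) ^+ 2 = 2 * rnorm x ^+ 2 + 2 * rnorm y ^+ 2 - rnorm (x + y) ^+ 2.
Proof. rewrite sqr_rnormB sqr_rnormD; ring. Qed.

End RealDot.

Lemma ler_rnorm_dist (R : realType) (V : normedModType R[i]) (x y : V) :
  `|rnorm x - rnorm y| <= rnorm (x - y).
Proof. by rewrite ler_norml ler_rnormB andbT lerNl opprB rdistC ler_rnormB. Qed.

Lemma rnorm_ball (R : realType) (V : normedModType R[i]) (x y : V) (e : R) :
  ball x e%:C y = (rnorm (x - y) < e) :> Prop.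
Proof. by rewrite -ball_normE/= -rnormE ltcR. Qed.

Section Nested.
Variables (R : realType) (V : completeNormedModType R[i]).

Lemma complex_pos (e : R[i]) : 0 < e -> exists2 e' : R, 0 < e' & e = e'%:C.
Proof.
case: e => a b; rewrite ltcE => /andP[/= /eqP b0 a0]; rewrite b0 in a0 *.
by exists a.
Qed.

(** Completeness in the form used to produce limits: if near-solutions at
    precision e form sets P e that shrink to diameter 0, they have a limit. *)
Lemma complete_nested (P : R -> set V) :
  (forall e, 0 < e -> P e !=set0) ->
  (forall e f, 0 < e -> e <= f -> P e `<=` P f) ->
  (forall d, 0 < d -> exists2 e, 0 < e & forall x y, P e x -> P e y -> rnorm (x - y) < d) ->
  exists v : V, forall d e, 0 < d -> 0 < e -> exists2 x, P e x & rnorm (v - x) < d.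
Proof.
move=> P0 Pmono Pdiam.
pose F := filter_from [set e : R | 0 < e] P.
have FF : ProperFilter F.
  apply: filter_from_proper; last by move=> e /P0.
  apply: filter_from_filter; first by exists 1 => /=.
  move=> e f /= e0 f0; exists (Num.min e f); first by rewrite lt_min e0.
  by move=> x Px; split; apply: Pmono Px; rewrite ?lt_min ?e0 ?f0 ?ge_min ?lexx ?orbT.
have : cauchy F.
  apply: cauchy_exP => _ /complex_pos[d d0 ->].
  have [e e0 he] := Pdiam d d0.
  have [x Px] := P0 e e0; exists x; exists e => //= y Py.
  by rewrite /= rnorm_ball; apply: he.
move=> /cauchy_cvgP /cvg_ex[v Fv]; exists v => d e d0 e0.
have Fb : F (ball v d%:C) by apply: Fv; apply: nbhsx_ballx; rewrite ltcR.
have Fe : F (P e) by exists e.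
have [x [bx Px]] := filter_ex (filterI Fb Fe).
by exists x => //; rewrite -rnorm_ball.
Qed.
End Nested.

(** * Bounded operators and their adjoints *)

Section BopTheory.
Variables (R : realType) (H G : hilbertType R).
Implicit Types (S T : bop H G) (x y : H).

Lemma bop_lin T (a : R[i]) x y : T (a *: x + y) = a *: T x + T y.
Proof. by have [h _] := bopP T; rewrite h. Qed.
Lemma bop0 T : T 0 = 0.
Proof. by have := bop_lin T (-1) 0 0; rewrite scaler0 addr0 scaleN1r addNr. Qed.
Lemma bopD T x y : T (x + y) = T x + T y.
Proof. by have := bop_lin T 1 x y; rewrite !scale1r. Qed.
Lemma bopZ T a x : T (a *: x) = a *: T x.
Proof. by have := bop_lin T a x 0; rewrite bop0 !addr0. Qed.
Lemma bopN T x : T (- x) = - T x.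
Proof. by rewrite -scaleN1r bopZ scaleN1r. Qed.
Lemma bopB T x y : T (x - y) = T x - T y.
Proof. by rewrite bopD bopN. Qed.
Lemma bop_sum T (I : Type) (r : seq I) (P : pred I) (F : I -> H) :
  T (\sum_(i <- r | P i) F i) = \sum_(i <- r | P i) T (F i).
Proof. by elim/big_rec2: _ => [|i a b _ <-]; rewrite ?bop0 ?bopD. Qed.

Lemma bop_ext S T : S =1 T -> S = T.
Proof. by move=> ST; apply: val_inj; apply/funext. Qed.

Lemma bop_addE S T x : (S + T) x = S x + T x. Proof. by []. Qed.
Lemma bop_scaleE (a : R[i]) T x : (a *: T) x = a *: T x. Proof. by []. Qed.
Lemma bop_subE S T x : (S - T) x = S x - T x. Proof. by []. Qed.
Lemma bop_zeroE x : (0 : bop H G) x = 0. Proof. by []. Qed.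
Lemma bop_sumE (I : Type) (r : seq I) (P : pred I) (F : I -> bop H G) x :
  (\sum_(i <- r | P i) F i) x = \sum_(i <- r | P i) F i x.
Proof. by elim/big_rec2: _ => [|i a b _ <-]; rewrite ?bop_zeroE ?bop_addE. Qed.

Lemma rnorm_bop T x : rnorm (T x) <= opnorm T * rnorm x.
Proof. by rewrite rnorm_le rmorphM/= rnormE opnorm_bound. Qed.

Lemma opnorm_ler T (M : R) : 0 <= M ->
  (forall x, rnorm (T x) <= M * rnorm x) -> opnorm T <= M.
Proof.
by move=> M0 h; apply: opnorm_le => // x; rewrite -(rnormE x) -rmorphM/= -rnorm_le.
Qed.

Lemma bounded_operatorI (f : H -> G) (M : R) : linear f ->
  (forall x, rnorm (f x) <= M * rnorm x) -> f \in bounded_operator H G.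
Proof.
move=> lf fM; apply/asboolP; split => //; exists M => x.
by rewrite -(rnormE x) -rmorphM/= -rnorm_le.
Qed.

Lemma opnorm_rnorm T : opnorm T = rnorm T.
Proof. by apply: (@complexI R); rewrite rnormE. Qed.

End BopTheory.

Section Riesz.
Variables (R : realType) (H : hilbertType R).

(** Minimise J x = |x|^2 - 2 phi x. By the parallelogram law the near-minimisers
    cluster, and the first variation of J vanishes at their limit. *)
Lemma riesz (phi : H -> R) (M : R) :
  (forall x y, phi (x + y) = phi x + phi y) ->
  (forall (a : R) x, phi (a%:C *: x) = a * phi x) ->
  (forall x, phi x <= M * rnorm x) ->
  exists v, forall x, phi x = rdot x v.
Proof.
move=> phiD phiZ phiM.
pose J x := rnorm x ^+ 2 - 2 * phi x.
have J_ge x : - M ^+ 2 <= J x.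
  rewrite /J; have := phiM x; move: (phi x) (rnorm x) => a b ab.
  have : 0 <= (b - M) ^+ 2 by exact: sqr_ge0.
  by rewrite sqrrB => ?; nra.
pose P e := [set x | forall y, J x <= J y + e].
have JD x t h : J (x + t%:C *: h) = J x + t ^+ 2 * rnorm h ^+ 2 - 2 * t * (phi h - rdot x h).
  rewrite /J sqr_rnormD rdotZr rnormZ exprMn real_normK ?num_real// phiD phiZ; ring.
have [||d d0|v hv] := @complete_nested R H P.
- move=> e e0.
  have hJ : has_inf (range J).
    by split; [exists (J 0), 0|exists (- M ^+ 2) => _ [x _ <-]].
  have [_ [x _ <-] hx] := inf_adherent e0 hJ.
  exists x => y; apply: (le_trans (ltW hx)); rewrite lerD2r.
  by apply: ge_inf; [case: hJ|exists y].
- by move=> e f e0 ef x Px y; apply: le_trans (Px y) _; rewrite lerD2l.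
- exists (d ^+ 2 / 8); first by rewrite divr_gt0 ?exprn_gt0.
  move=> x y Px Py.
  have hx := Px (2^-1%:C *: (x + y)); have hy := Py (2^-1%:C *: (x + y)).
  have JE : J (2^-1%:C *: (x + y)) = (J x + J y) / 2 - rnorm (x - y) ^+ 2 / 4.
    rewrite parallelogram /J rnormZ ger0_norm ?invr_ge0// phiZ phiD exprMn.
    by field.
  rewrite -(@ltr_pXn2r _ 2%N)// ?nnegrE ?rnorm_ge0 ?ltW//.
  have d2 : 0 < d ^+ 2 by rewrite exprn_gt0.
  move: hx hy d2; rewrite JE.
  move: (J x) (J y) (rnorm _ ^+ 2) (d ^+ 2) => a b c u; lra.
exists v => h; apply/eqP; rewrite -subr_eq0 -normr_le0.
have [->|h0] := eqVneq h 0.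
  have -> : phi 0 = 0 by have := phiZ 0 0; rewrite scaler0 mul0r.
  by rewrite rdot0l subrr normr0.
have ph : 0 < rnorm h by rewrite lt_neqAle rnorm_ge0 eq_sym rnorm_eq0 h0.
apply/ler_addgt0Pr => e e0; rewrite add0r.
pose d := e / (2 * rnorm h).
have d0 : 0 < d by rewrite divr_gt0// mulr_gt0.
have [x Px xv] := hv d (d ^+ 2) d0 (exprn_gt0 2 d0).
have c2 : `|phi h - rdot x h| <= d * rnorm h.
  rewrite -(@ler_pXn2r _ 2%N)// ?nnegrE ?(mulr_ge0 (ltW d0) (rnorm_ge0 _))//.
  rewrite real_normK ?num_real// exprMn.
  have := Px (x + ((phi h - rdot x h) / rnorm h ^+ 2)%:C *: h).
  rewrite JD.
  move: (phi h - rdot x h) (d ^+ 2) => c u.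
  have : 0 < rnorm h ^+ 2 by rewrite exprn_gt0.
  move: (rnorm h ^+ 2) => w w0.
  have -> : J x + (c / w) ^+ 2 * w - 2 * (c / w) * c + u = J x + u - c ^+ 2 / w.
    by field; rewrite gt_eqF.
  by rewrite -addrA lerDl subr_ge0 ler_pdivrMr// mulrC.
have -> : phi h - rdot h v = (phi h - rdot x h) + rdot (x - v) h.
  by rewrite rdotBl (rdotC v); ring.
apply: (le_trans (ler_normD _ _)).
have -> : e = d * rnorm h + d * rnorm h by rewrite /d; field; rewrite gt_eqF.
apply: lerD => //; apply: (le_trans (rdot_norm_le _ _)).
by apply: ler_wpM2r; rewrite ?rnorm_ge0// rdistC ltW.
Qed.

Lemma rdotZcr (a : R[i]) (x y : H) : rdot x (a *: y) = rdot (a^*%C *: x) y.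
Proof. by rewrite /rdot linearZr_LR linearZl_LR. Qed.

(** |S y|^2 = <T (S y), y>. *)
Lemma adjoint_bound (T : bop H H) (S : H -> H) :
  (forall x y, rdot (T x) y = rdot x (S y)) ->
  forall y, rnorm (S y) <= opnorm T * rnorm y.
Proof.
move=> TS y; have [->|S0] := eqVneq (S y) 0.
  by rewrite rnorm0 mulr_ge0 ?rnorm_ge0 ?opnorm_ge0.
have pS : 0 < rnorm (S y) by rewrite lt_neqAle rnorm_ge0 eq_sym rnorm_eq0 S0.
rewrite -(ler_pM2r pS) -expr2 -rdotxx -TS (le_trans (rdot_le _ _))//.
by rewrite mulrAC ler_wpM2r ?rnorm_ge0// rnorm_bop.
Qed.

Lemma adjoint_exists (T : bop H H) :
  exists S : bop H H, forall x y, rdot (T x) y = rdot x (S y).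
Proof.
have /choice[S hS] : forall y, exists v, forall x, rdot (T x) y = rdot x v.
  move=> y; apply: (@riesz _ (opnorm T * rnorm y)).
  - by move=> x z; rewrite bopD rdotDl.
  - by move=> a x; rewrite bopZ rdotZl.
  - move=> x; apply: (le_trans (rdot_le _ _)).
    by rewrite mulrAC ler_wpM2r ?rnorm_ge0// rnorm_bop.
suff bS : S \in bounded_operator H H by exists (Bop bS) => x y; exact: hS.
apply: (@bounded_operatorI _ _ _ S (opnorm T)) => [a x y|]; last exact: adjoint_bound.
apply: rdot_inj => z; rewrite rdotDr rdotZcr -!hS.
by rewrite bopZ -rdotZcr -rdotDr.
Qed.

Lemma hdot_adj (S T : bop H H) : (forall x y, rdot (T x) y = rdot x (S y)) ->
  forall x y : H, '[T x, y] = '[x, S y].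
Proof.
move=> h x y; rewrite (hdot_rdot (T x)) (hdot_rdot x) h.
by rewrite -[rdot (T x) _]opprK -rdot_i -bopZ h rdot_i opprK.
Qed.

Lemma rdot_adjoint (T : bop H H) x y : rdot (T x) y = rdot x (adjoint T y).
Proof.
have [S /hdot_adj hS] := adjoint_exists T.
rewrite /rdot; congr complex.Re.
have h : exists S, [set S : bop H H | forall x y : H, '[T x, y] = '[x, S y]] S by exists S.
by have := xgetPex 1 h; apply.
Qed.

Lemma rnorm_adjoint (T : bop H H) v : rnorm (adjoint T v) <= opnorm T * rnorm v.
Proof. by apply: adjoint_bound => x y; exact: rdot_adjoint. Qed.

Lemma adjoint_unique (S T : bop H H) :
  (forall x y, rdot (T x) y = rdot x (S y)) -> adjoint T = S.
Proof.
move=> h; apply: bop_ext => y; apply: rdot_inj => x.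
by rewrite -rdot_adjoint h.
Qed.

Lemma bop_mulE (S T : bop H H) x : (S * T) x = S (T x). Proof. by []. Qed.
Lemma bop_oneE (x : H) : (1 : bop H H) x = x. Proof. by []. Qed.

Lemma adjointM (S T : bop H H) : adjoint (S * T) = adjoint T * adjoint S.
Proof.
by apply: adjoint_unique => x y; rewrite !bop_mulE rdot_adjoint rdot_adjoint.
Qed.

Lemma adjoint1 : adjoint (1 : bop H H) = 1.
Proof. by apply: adjoint_unique. Qed.

Lemma adjointB (S T : bop H H) : adjoint (S - T) = adjoint S - adjoint T.
Proof.
apply: adjoint_unique => x y.
by rewrite bop_subE rdotBl bop_subE rdotBr !rdot_adjoint.
Qed.

Lemma adjointZ (a : R) (T : bop H H) : adjoint (a%:C *: T) = a%:C *: adjoint T.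
Proof.
apply: adjoint_unique => x y.
by rewrite !bop_scaleE rdotZl rdotZr rdot_adjoint.
Qed.
End Riesz.

(** * Orthonormal families and extension from a dense subspace *)

Section Orthonormal.
Variables (R : realType) (H : hilbertType R).

Definition orthonormal_family (I : eqType) (e : I -> H) :=
  forall i j, '[e i, e j] = (i == j)%:R.

Lemma pythagoras (I : finType) (v : I -> H) :
  (forall i j, i != j -> rdot (v i) (v j) = 0) ->
  rnorm (\sum_i v i) ^+ 2 = \sum_i rnorm (v i) ^+ 2.
Proof.
move=> ov; rewrite -rdotxx rdot_suml; apply: eq_bigr => i _.
rewrite rdot_sumr (bigD1 i)//= rdotxx big1 ?addr0// => j ji.
by rewrite ov// eq_sym.
Qed.

(** Indexing by nat lets the induction append a vector to e by changing it beyond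
    p only. *)
Lemma gram_schmidt_nat (m : nat) (y : nat -> H) :
  exists p (e : nat -> H) (c : nat -> nat -> R[i]),
    (forall i j, (i < p)%N -> (j < p)%N -> '[e i, e j] = (i == j)%:R) /\
    forall i, (i < m)%N -> y i = \sum_(j < p) c i j *: e j.
Proof.
elim: m => [|m [p [e [c [oe ye]]]]].
  by exists 0%N, (fun=> 0), (fun _ _ => 0); split => // i; rewrite ltn0.
pose r := y m - \sum_(j < p) '[y m, e j] *: e j.
have re j : (j < p)%N -> '[r, e j] = 0.
  move=> jp; rewrite linearBl/= linear_sumlz.
  rewrite (bigD1 (Ordinal jp))//= big1 ?addr0.
    by rewrite linearZl_LR/= oe// eqxx mulr1 subrr.
  move=> i ij; rewrite linearZl_LR/= oe//.
  have /negPf -> : (val i != j)%N by [].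
  by rewrite mulr0.
have [r0|r0] := eqVneq r 0.
  exists p, e, (fun i j => if (i < m)%N then c i j else '[y m, e j]); split => // i.
  rewrite ltnS leq_eqVlt => /orP[/eqP->|im]; last by rewrite im; exact: ye.
  rewrite ltnn; apply/eqP; rewrite -subr_eq0; exact/eqP.
have nr0 : rnorm r != 0 by rewrite rnorm_eq0.
pose f := ((rnorm r)^-1)%:C *: r.
have ff : '[f, f] = 1.
  by rewrite hdotxx rnormZ normfV ger0_norm ?rnorm_ge0// mulVf// expr1n.
have fe j : (j < p)%N -> '[f, e j] = 0.
  by move=> jp; rewrite linearZl_LR/= re// mulr0.
have ef j : (j < p)%N -> '[e j, f] = 0.
  by move=> jp; rewrite hdotC fe// conjc0.
exists p.+1, (fun j => if (j < p)%N then e j else f),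
  (fun i j => if (i < m)%N then if (j < p)%N then c i j else 0
              else if (j < p)%N then '[y m, e j] else (rnorm r)%:C).
split=> [i j|i].
  rewrite !ltnS; case: (ltnP i p) => ip; case: (ltnP j p) => jp.
  - by move=> _ _; exact: oe.
  - by move=> _ _; rewrite ef// (ltn_eqF (leq_trans ip jp)).
  - by move=> _ _; rewrite fe// (gtn_eqF (leq_trans jp ip)).
  - by move=> ip' jp'; rewrite ff (@anti_leq i p) ?ip ?ip'// (@anti_leq j p) ?jp ?jp'// eqxx.
rewrite ltnS leq_eqVlt => /orP[/eqP->|im]; rewrite big_ord_recr/= !ltnn.
  under eq_bigr do rewrite ltn_ord.
  rewrite scalerA -rmorphM/= mulfV// scale1r /r addrC subrK//.
rewrite im scale0r addr0 ye//; apply: eq_bigr => j _.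
by rewrite ltn_ord.
Qed.

Lemma gram_schmidt (I : finType) (y : I -> H) :
  exists p (e : 'I_p -> H) (c : I -> 'I_p -> R[i]),
    orthonormal_family e /\ forall i, y i = \sum_j c i j *: e j.
Proof.
have [i0|I0] := pselect (exists i : I, True); last first.
  exists 0%N, (fun=> 0), (fun _ _ => 0); split=> [[]//|i].
  by case: I0; exists i.
case: i0 => i0 _.
have [p [e [c [oe ye]]]] := gram_schmidt_nat #|I| (fun k => y (nth i0 (enum I) k)).
exists p, (fun j => e j), (fun i j => c (enum_rank i) j); split => [i j|i].
  by rewrite oe.
by rewrite -ye// nth_enum_rank.
Qed.

Lemma rnorm_orthonormal_sum (I : finType) (e : I -> H) (c : I -> R[i]) :
  orthonormal_family e ->
  rnorm (\sum_i c i *: e i) ^+ 2 = \sum_i (complex.Re `|c i|) ^+ 2.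
Proof.
move=> oe; rewrite pythagoras => [|i j ij].
  apply: eq_bigr => i _; rewrite rnormZc.
  suff -> : rnorm (e i) = 1 by rewrite mulr1.
  apply/eqP; rewrite -sqrp_eq1 ?rnorm_ge0//.
  by rewrite -rdotxx /rdot oe eqxx.
by rewrite /rdot linearZl_LR linearZr_LR/= oe (negPf ij) !mulr0.
Qed.

End Orthonormal.

Section Extension.
Variables (R : realType) (T T' : hilbertType R).

(** A densely defined bounded operator given by its graph G. Describing it by a
    relation spares a proof that it is well defined on the various expressions
    of one vector: the bound implies it. *)
Lemma bounded_extension (G : T -> T' -> Prop) (M : R) : 0 <= M ->
  (forall a t t' z z', G t z -> G t' z' -> G (a *: t + t') (a *: z + z')) ->
  (forall t z, G t z -> rnorm z <= M * rnorm t) ->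
  (forall t e, 0 < e -> exists t' z, G t' z /\ rnorm (t - t') < e) ->
  exists Z : bop T T', forall t z, G t z -> Z t = z.
Proof.
move=> M0 Glin GM Gdense.
have GB t t' z z' : G t z -> G t' z' -> G (t - t') (z - z').
  by move=> h h'; have := Glin (-1) _ _ _ _ h' h; rewrite !scaleN1r !(addrC (- _)).
have M1 : 0 < M + 1 by rewrite ltr_wpDl.
pose Q t v := forall d, 0 < d ->
  exists t' z, [/\ G t' z, rnorm (t - t') < d & rnorm (v - z) < d].
have GQ t z : G t z -> Q t z.
  by move=> h d d0; exists t, z; split => //; rewrite subrr rnorm0.
have Qex t : exists v, Q t v.
  pose P e := [set z | exists2 t', G t' z & rnorm (t - t') < e].
  have [||d d0|v hv] := @complete_nested R T' P.
  - by move=> e /(Gdense t)[t' [z [h tt']]]; exists z, t'.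
  - by move=> e f _ ef z [t' h tt']; exists t' => //; exact: lt_le_trans ef.
  - exists (d / (2 * (M + 1))); first by rewrite divr_gt0// mulr_gt0.
    move=> x y [t1 h1 t1t] [t2 h2 t2t].
    apply: (le_lt_trans (GM _ _ (GB _ _ _ _ h1 h2))).
    apply: (@le_lt_trans _ _ ((M + 1) * rnorm (t1 - t2))).
      by rewrite ler_wpM2r ?rnorm_ge0// lerDl.
    rewrite mulrC -ltr_pdivlMr//; apply: (le_lt_trans (ler_rdistD t _ _)).
    rewrite (rdistC t1).
    have -> : d / (M + 1) = d / (2 * (M + 1)) + d / (2 * (M + 1)).
      by field; rewrite gt_eqF.
    exact: ltrD.
  exists v => d d0; have [z [t' h tt'] vz] := hv d d d0 d0.
  by exists t', z; split.
have Qlin a t t' z z' : Q t z -> Q t' z' -> Q (a *: t + t') (a *: z + z').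
  move=> h h' d d0.
  set n := complex.Re `|a|.
  have n0 : 0 <= n by exact: (@rnorm_ge0 _ (R[i]^o) a).
  have n1 : 0 < n + 1 by rewrite ltr_wpDl.
  have e0 : 0 < d / (n + 1) by rewrite divr_gt0.
  have [u [v [g uv1 uv2]]] := h _ e0.
  have [u' [v' [g' uv1' uv2']]] := h' _ e0.
  have key (W : hilbertType R) (x x' y y' : W) : rnorm (x - x') < d / (n + 1) ->
      rnorm (y - y') < d / (n + 1) -> rnorm (a *: x + y - (a *: x' + y')) < d.
    move=> hx hy; rewrite opprD addrACA -scalerBr.
    apply: (le_lt_trans (ler_rnormD _ _)); rewrite rnormZc -/n.
    have -> : d = n * (d / (n + 1)) + d / (n + 1) by field; rewrite gt_eqF.
    by rewrite ler_ltD// ler_wpM2l// ltW.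
  exists (a *: u + u'), (a *: v + v'); split; first exact: Glin.
    exact: key.
  exact: key.
have QM t z : Q t z -> rnorm z <= M * rnorm t.
  move=> h; apply/ler_addgt0Pr => e e0.
  have d0 : 0 < e / (M + 1) by rewrite divr_gt0.
  have [u [v [g h1 h2]]] := h _ d0.
  have := GM _ _ g.
  have k1 : rnorm z <= rnorm (z - v) + rnorm v by rewrite -[in leLHS](subrK v z) ler_rnormD.
  have k2 : rnorm u <= rnorm (t - u) + rnorm t.
    by rewrite rdistC -[in leLHS](subrK t u) ler_rnormD.
  move=> k3; apply: (le_trans k1).
  apply: (@le_trans _ _ (e / (M + 1) + M * (e / (M + 1) + rnorm t))).
    apply: lerD; first exact: ltW.
    apply: le_trans k3 _; rewrite ler_wpM2l//.
    by apply: le_trans k2 _; rewrite lerD2r ltW.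
  rewrite le_eqVlt; apply/orP; left; apply/eqP; by field; rewrite gt_eqF.
have Quniq t z z' : Q t z -> Q t z' -> z = z'.
  move=> h h'; apply/eqP; rewrite -subr_eq0 -rnorm_eq0 eq_le rnorm_ge0 andbT.
  have := QM _ _ (Qlin (-1) _ _ _ _ h' h).
  by rewrite !scaleN1r !(addrC (- _)) subrr rnorm0 mulr0.
have [Z hZ] := choice Qex.
have bZ : Z \in bounded_operator T T'.
  apply: (@bounded_operatorI _ _ _ Z M) => [a x y|x]; last exact: QM.
  by apply: Quniq (hZ _) _; exact: Qlin.
by exists (Bop bZ) => t z /GQ; exact: Quniq.
Qed.

End Extension.

(** * Hilbert space tensor products *)

Section HilbertTensor.
Variables (R : realType) (K H T : hilbertType R) (tau : {bilinear K -> H -> T}).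
Hypothesis tauP : is_hilbert_tensor tau.

Let hdot_tau x x' y y' : '[tau x y, tau x' y'] = '[x, x'] * '[y, y'].
Proof. by case: tauP. Qed.

Lemma rnorm_tau x y : rnorm (tau x y) = rnorm x * rnorm y.
Proof.
apply/eqP; rewrite -(@eqrXn2 _ 2%N)// ?mulr_ge0 ?rnorm_ge0// exprMn; apply/eqP.
apply: (@complexI R).
by rewrite -hdotxx hdot_tau !hdotxx [RHS]rmorphM.
Qed.

Definition tensor_sum (s : seq (K * H)) : T := \sum_(p <- s) tau p.1 p.2.
Definition tensor_map (A : bop K K) (X : bop H H) (s : seq (K * H)) :=
  [seq (A p.1, X p.2) | p <- s].

Lemma tensor_sum_dense t e : 0 < e -> exists s, rnorm (t - tensor_sum s) < e.
Proof.
move=> e0; have [_ cl] := tauP.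
have : closure [set t : T | exists (m : nat) (x : 'I_m -> K) (y : 'I_m -> H),
                         t = \sum_(i < m) tau (x i) (y i)] t by rewrite cl.
move=> /(_ (ball t e%:C)) []; first by apply: nbhsx_ballx; rewrite ltcR.
move=> _ [[m [x [y ->]]]]; rewrite /= rnorm_ball => h.
exists [seq (x i, y i) | i <- index_enum 'I_m].
by rewrite /tensor_sum big_map.
Qed.

Lemma rnorm_tau_orthonormalr (I : finType) (x : I -> K) (e : I -> H) : orthonormal_family e ->
  rnorm (\sum_i tau (x i) (e i)) ^+ 2 = \sum_i rnorm (x i) ^+ 2.
Proof.
move=> oe; rewrite pythagoras => [|i j ij].
  apply: eq_bigr => i _; rewrite rnorm_tau exprMn -[rnorm (e i) ^+ 2]rdotxx.
  by rewrite /rdot oe eqxx mulr1.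
by rewrite /rdot hdot_tau oe (negPf ij) mulr0.
Qed.

Lemma rnorm_tau_orthonormall (I : finType) (e : I -> K) (x : I -> H) : orthonormal_family e ->
  rnorm (\sum_i tau (e i) (x i)) ^+ 2 = \sum_i rnorm (x i) ^+ 2.
Proof.
move=> oe; rewrite pythagoras => [|i j ij].
  apply: eq_bigr => i _; rewrite rnorm_tau exprMn -[rnorm (e i) ^+ 2]rdotxx.
  by rewrite /rdot oe eqxx mul1r.
by rewrite /rdot hdot_tau oe (negPf ij) mul0r.
Qed.

Lemma tau_sumr (I : Type) (r : seq I) (P : pred I) x (F : I -> H) :
  tau x (\sum_(i <- r | P i) F i) = \sum_(i <- r | P i) tau x (F i).
Proof. by rewrite linear_sumr. Qed.

Lemma tau_suml (I : Type) (r : seq I) (P : pred I) (F : I -> K) y :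
  tau (\sum_(i <- r | P i) F i) y = \sum_(i <- r | P i) tau (F i) y.
Proof. by rewrite linear_sumlz. Qed.

Lemma tauZ x a y : tau x (a *: y) = tau (a *: x) y.
Proof. by rewrite linearZr_LR linearZl_LR. Qed.

Section Bound.
Variables (I : finType) (A : I -> bop K K) (X : I -> bop H H) (w : I -> R).
Variables (C D : R).
Hypotheses (w0 : forall i, 0 < w i) (D0 : 0 <= D).
Hypothesis hA : forall x, \sum_i (w i)^-1 * rnorm (A i x) ^+ 2 <= C * rnorm x ^+ 2.
Hypothesis hX : forall y : I -> H,
  rnorm (\sum_i X i (y i)) ^+ 2 <= D * \sum_i (w i)^-1 * rnorm (y i) ^+ 2.

(** A_i (x) X_i is (1 (x) X_i)(A_i (x) 1), so the sum is a row times a column.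
    Orthonormalising the second legs of the tensor makes its norm and that of
    the column explicit; orthonormalising afterwards the first legs A_i u_j makes
    the row act on H alone. *)
Lemma row_column_bound (s : seq (K * H)) :
  rnorm (\sum_i tensor_sum (tensor_map (A i) (X i) s)) ^+ 2 <=
  D * C * rnorm (tensor_sum s) ^+ 2.
Proof.
have [p [e [c [oe ye]]]] := gram_schmidt (fun j : 'I_(size s) => (tnth (in_tuple s) j).2).
pose u (j : 'I_p) : K := \sum_(k : 'I_(size s)) c k j *: (tnth (in_tuple s) k).1.
have sE (B : bop K K) (Y : bop H H) :
    tensor_sum (tensor_map B Y s) = \sum_j tau (B (u j)) (Y (e j)).
  rewrite /tensor_sum big_map big_tnth.
  under eq_bigr => k _ do rewrite ye bop_sum tau_sumr.
  rewrite exchange_big; apply: eq_bigr => j _ /=.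
  rewrite bop_sum tau_suml; apply: eq_bigr => k _.
  by rewrite !bopZ tauZ.
have sE1 : tensor_sum s = \sum_j tau (u j) (e j).
  have <- : tensor_map 1 1 s = s by rewrite -[RHS]map_id; apply: eq_map => -[].
  exact: sE.
rewrite sE1 rnorm_tau_orthonormalr//.
under eq_bigr do rewrite sE.
have [r [f [d [onf df]]]] := gram_schmidt (fun ij : I * 'I_p => A ij.1 (u ij.2)).
pose y (l : 'I_r) (i : I) : H := \sum_j d (i, j) l *: e j.
have -> : \sum_i \sum_j tau (A i (u j)) (X i (e j)) =
          \sum_l tau (f l) (\sum_i X i (y l i)).
  under eq_bigr => i _ do under eq_bigr => j _ do
    rewrite (df (i, j)) tau_suml.
  under eq_bigr => i _ do rewrite exchange_big/=.
  rewrite exchange_big; apply: eq_bigr => l _ /=.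
  rewrite tau_sumr; apply: eq_bigr => i _.
  rewrite bop_sum tau_sumr; apply: eq_bigr => j _.
  by rewrite bopZ tauZ.
rewrite rnorm_tau_orthonormall//.
apply: (@le_trans _ _ (\sum_l D * \sum_i (w i)^-1 * rnorm (y l i) ^+ 2)).
  by apply: ler_sum => l _; exact: hX.
rewrite -mulr_sumr -mulrA ler_wpM2l// exchange_big/= mulr_sumr.
apply: (@le_trans _ _ (\sum_i (w i)^-1 * \sum_j rnorm (A i (u j)) ^+ 2)).
  apply: ler_sum => i _; rewrite -mulr_sumr ler_wpM2l ?invr_ge0 ?(ltW (w0 _))//.
  rewrite le_eqVlt; apply/orP; left; apply/eqP.
  under eq_bigr => l _ do rewrite rnorm_orthonormal_sum//.
  rewrite exchange_big; apply: eq_bigr => j _ /=.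
  by rewrite -(rnorm_orthonormal_sum _ onf) -(df (i, j)).
under eq_bigr do rewrite mulr_sumr.
rewrite exchange_big; apply: ler_sum => j _; exact: hA.
Qed.
End Bound.

(** The case of a single term of [row_column_bound] bounds the operator
    on sums of elementary tensors, which are dense. *)
Lemma tensor_op_exists (A : bop K K) (X : bop H H) :
  exists Z : bop T T, forall s, Z (tensor_sum s) = tensor_sum (tensor_map A X s).
Proof.
pose G t z := exists2 s, t = tensor_sum s & z = tensor_sum (tensor_map A X s).
have [|a _ _ _ _ [s -> ->] [s' -> ->]|_ _ [s -> ->]|t e e0|Z hZ] :=
    @bounded_extension R T T G (opnorm A * opnorm X).
- by rewrite mulr_ge0 ?opnorm_ge0.
- exists ([seq (a *: p.1, p.2) | p <- s] ++ s').
    rewrite /tensor_sum big_cat big_map scaler_sumr; congr (_ + _).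
    by apply: eq_bigr => p _; rewrite linearZl_LR.
  rewrite /tensor_sum /tensor_map map_cat big_cat -map_comp !big_map scaler_sumr; congr (_ + _).
  by apply: eq_bigr => p _ /=; rewrite bopZ linearZl_LR.
- rewrite -(@ler_pXn2r _ 2%N)// ?nnegrE ?mulr_ge0 ?opnorm_ge0 ?rnorm_ge0//.
  have := @row_column_bound unit (fun=> A) (fun=> X) (fun=> 1) (opnorm A ^+ 2) (opnorm X ^+ 2)
    (fun=> ltr01) (sqr_ge0 _) _ _ s.
  have big_unit (U : nmodType) (F : unit -> U) : \sum_i F i = F tt.
    by rewrite (bigD1 tt)//= big1 ?addr0// => -[].
  rewrite !exprMn (mulrC (opnorm A ^+ 2)) big_unit; apply.
    move=> x; rewrite big_unit invr1 mul1r -exprMn ler_pXn2r ?nnegrE ?mulr_ge0 ?opnorm_ge0 ?rnorm_ge0//.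
    exact: rnorm_bop.
  move=> y; rewrite !big_unit invr1 mul1r -exprMn ler_pXn2r ?nnegrE ?mulr_ge0 ?opnorm_ge0 ?rnorm_ge0//.
  exact: rnorm_bop.
- have [s hs] := tensor_sum_dense t e0.
  by exists (tensor_sum s), (tensor_sum (tensor_map A X s)); split => //; exists s.
by exists Z => s; apply: hZ; exists s.
Qed.

Lemma tensor_opE (A : bop K K) (X : bop H H) x y :
  tensor_op tau A X (tau x y) = tau (A x) (X y).
Proof.
have [Z hZ] := tensor_op_exists A X.
have h : exists Z, [set Z : bop T T | forall (x : K) (y : H), Z (tau x y) = tau (A x) (X y)] Z.
  by exists Z => u v; have := hZ [:: (u, v)]; rewrite /tensor_sum !big_seq1.
exact: (xgetPex 0 h).
Qed.

Lemma tensor_op_tensor_sum (A : bop K K) (X : bop H H) s :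
  tensor_op tau A X (tensor_sum s) = tensor_sum (tensor_map A X s).
Proof.
by rewrite /tensor_sum bop_sum big_map; apply: eq_bigr => p _; rewrite tensor_opE.
Qed.

Lemma opnorm_dense (Z : bop T T) M : 0 <= M ->
  (forall s, rnorm (Z (tensor_sum s)) <= M * rnorm (tensor_sum s)) -> opnorm Z <= M.
Proof.
move=> M0 h; apply: opnorm_ler => // t; apply/ler_addgt0Pr => e e0.
have Z0 := opnorm_ge0 Z.
have n1 : 0 < M + opnorm Z + 1 by rewrite ltr_wpDl// addr_ge0.
have [s hs] := tensor_sum_dense t (divr_gt0 e0 n1).
have k1 : rnorm (Z t) <= rnorm (Z (t - tensor_sum s)) + rnorm (Z (tensor_sum s)).
  by rewrite bopB -[in leLHS](subrK (Z (tensor_sum s)) (Z t)) ler_rnormD.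
have k2 : rnorm (tensor_sum s) <= rnorm (t - tensor_sum s) + rnorm t.
  by rewrite rdistC -[in leLHS](subrK t (tensor_sum s)) ler_rnormD.
have k3 := rnorm_bop Z (t - tensor_sum s).
apply: (le_trans k1); apply: (@le_trans _ _ (opnorm Z * rnorm (t - tensor_sum s) +
   M * (rnorm (t - tensor_sum s) + rnorm t))).
  by apply: lerD => //; apply: (le_trans (h s)); rewrite ler_wpM2l.
have -> : opnorm Z * rnorm (t - tensor_sum s) + M * (rnorm (t - tensor_sum s) + rnorm t) =
  M * rnorm t + (M + opnorm Z) * rnorm (t - tensor_sum s) by ring.
rewrite lerD2l; apply: (@le_trans _ _ ((M + opnorm Z + 1) * rnorm (t - tensor_sum s))).
  by rewrite ler_wpM2r ?rnorm_ge0// lerDl.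
by rewrite mulrC -ler_pdivlMr// ltW.
Qed.

Lemma opnorm_sum_tensor_op_le (I : finType) (A : I -> bop K K) (X : I -> bop H H)
    (w : I -> R) (C D : R) :
  (forall i, 0 < w i) -> 0 <= C -> 0 <= D ->
  (forall x, \sum_i (w i)^-1 * rnorm (A i x) ^+ 2 <= C * rnorm x ^+ 2) ->
  (forall y : I -> H,
    rnorm (\sum_i X i (y i)) ^+ 2 <= D * \sum_i (w i)^-1 * rnorm (y i) ^+ 2) ->
  opnorm (\sum_i tensor_op tau (A i) (X i)) <= Num.sqrt (D * C).
Proof.
move=> w0 C0 D0 hA hX; apply: opnorm_dense => [|s]; first exact: sqrtr_ge0.
rewrite -(@ler_pXn2r _ 2%N)// ?nnegrE ?mulr_ge0 ?sqrtr_ge0 ?rnorm_ge0//.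
rewrite exprMn sqr_sqrtr ?mulr_ge0// bop_sumE.
under eq_bigr do rewrite tensor_op_tensor_sum.
exact: row_column_bound w0 D0 hA hX s.
Qed.
End HilbertTensor.

(** * The coefficients b as a renewal sequence *)

Section Bcoef.
Variables (R : realType) (n : nat) (q : {fsfun seq 'I_n -> R with 0}).
Implicit Types (alpha beta : seq 'I_n).

(** The factorizations of alpha into p nonempty words, summed by recursion on the
    length d of the first factor. *)
Fixpoint fact_weight (p : nat) alpha : R :=
  if p is p'.+1 then
    \sum_(1 <= d < (size alpha).+1) q (take d alpha) * fact_weight p' (drop d alpha)
  else (alpha == [::])%:R.

Fixpoint factorizations (p : nat) alpha : seq (p.-tuple (seq 'I_n)) :=
  match p return seq (p.-tuple (seq 'I_n)) with
  | 0 => if alpha == [::] then [:: [tuple]] else [::]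
  | p'.+1 => [seq cons_tuple (take d alpha) g
               | d <- iota 1 (size alpha), g <- factorizations p' (drop d alpha)]
  end.

Lemma mem_factorizations p alpha (g : p.-tuple (seq 'I_n)) :
  (g \in factorizations p alpha) =
  (flatten g == alpha) && all (fun w => (0 < size w)%N) g.
Proof.
elim: p alpha g => [|p IHp] alpha g /=.
  rewrite tuple0/= andbT eq_sym; case: ifP => _; last by rewrite in_nil.
  by rewrite inE; apply/eqP; exact: tuple0.
apply/allpairsPdep/andP => [[d [h [/=]]]|].
  rewrite mem_iota IHp => /andP[d1 dn] /andP[/eqP hf hs] -> /=.
  rewrite hf cat_take_drop eqxx; split => //; rewrite hs andbT size_take.
  by case: ifP => // _; exact: leq_trans d1 _.
case: (tupleP g) => w h /= [/eqP <- /andP[w0 hs]].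
exists (size w), h; rewrite mem_iota w0 size_cat add1n ltnS leq_addr IHp.
rewrite drop_size_cat// eqxx take_size_cat//; split.
Qed.

Lemma uniq_factorizations p alpha : uniq (factorizations p alpha).
Proof.
elim: p alpha => [|p IHp] alpha /=; first by case: ifP.
apply: allpairs_uniq_dep => //; first exact: iota_uniq.
move=> [d g] [d' g'] /=.
move=> /allpairsPdep[d1 [g1 [/=]]]; rewrite mem_iota => /andP[d10 d1n] _ [-> ->].
move=> /allpairsPdep[d2 [g2 [/=]]]; rewrite mem_iota => /andP[d20 d2n] _ [-> ->].
move=> [e1 e2].
have dd : d1 = d2.
  have := congr1 size e1; rewrite !size_takel//; by rewrite -ltnS -add1n.
by rewrite dd; congr (existT _ _ _); apply: val_inj.
Qed.

Lemma fact_weightE p alpha :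
  \sum_(g \in [set g : p.-tuple (seq 'I_n) |
                   flatten g = alpha /\ forall l, (1 <= size (tnth g l))%N])
      \prod_(l < p) q (tnth g l) = fact_weight p alpha.
Proof.
transitivity (\sum_(g <- factorizations p alpha) \prod_(l < p) q (tnth g l)).
  rewrite [RHS]fsbig_seq ?uniq_factorizations//; apply: eq_fsbigl.
  apply/seteqP; split => g /=.
    move=> [h1 h2]; rewrite mem_factorizations h1 eqxx; apply/all_tnthP => l.
    exact: h2.
  by rewrite mem_factorizations => /andP[/eqP -> /all_tnthP].
elim: p alpha => [|p IHp] alpha /=.
  case: ifP => _; last by rewrite big_nil.
  by rewrite big_seq1 big_ord0.
rewrite big_allpairs_dep /= -[in RHS]/(index_iota 1 (size alpha).+1) /index_iota subn1.
apply: eq_bigr => d _; rewrite -IHp mulr_sumr; apply: eq_bigr => g _.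
rewrite big_ord_recl tnth0; congr (_ * _); apply: eq_bigr => i _.
by rewrite tnthS.
Qed.

Lemma fact_weight_big p alpha : (size alpha < p)%N -> fact_weight p alpha = 0.
Proof.
elim: p alpha => // p IHp alpha ap /=.
rewrite big_nat big1// => d /andP[d1 dn]; rewrite IHp ?mulr0// size_drop.
by lia.
Qed.

(** A word has no factorization into more nonempty factors than letters, so the
    sum may run up to any N > |alpha|; starting it at p = 0 accounts for the
    value 1 at the empty word. *)
Lemma bcoefE N alpha : (size alpha < N)%N ->
  bcoef q alpha = \sum_(p < N) fact_weight p alpha.
Proof.
move=> aN; rewrite -(big_mkord xpredT (fact_weight^~ alpha)).
rewrite (@big_cat_nat _ _ _ (size alpha).+1)//= [X in _ + X]big_nat.
rewrite [X in _ + X]big1 ?addr0; last first.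
  by move=> p /andP[h _]; exact: fact_weight_big.
rewrite big_ltn// /bcoef.
case: alpha aN => [|j alpha] aN; first by rewrite big_geq// addr0.
rewrite [X in X + _]/= add0r; apply: eq_bigr => p _; exact: fact_weightE.
Qed.

(** The renewal equation: split off the first factor of a factorization. *)
Lemma bcoef_rec alpha : alpha != [::] ->
  bcoef q alpha = \sum_(1 <= d < (size alpha).+1) q (take d alpha) * bcoef q (drop d alpha).
Proof.
move=> a0; rewrite (bcoefE (leqnn _)) big_ord_recl /= (negPf a0) add0r.
rewrite exchange_big/= !big_nat; apply: eq_bigr => d /andP[d1 dn].
rewrite -mulr_sumr -bcoefE// size_drop; lia.
Qed.

Lemma bcoef_nil : bcoef q [::] = 1. Proof. by []. Qed.

Hypothesis hq : positive_regular q.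

Let q_ge0 alpha : 0 <= q alpha. Proof. by case: hq. Qed.

Lemma bcoef_ge0 alpha : 0 <= bcoef q alpha.
Proof.
rewrite (bcoefE (leqnn _)); apply: sumr_ge0 => p _.
move: (nat_of_ord p) => {p} m; elim: m alpha => [|m IHm] alpha /=; first exact: ler0n.
by apply: sumr_ge0 => d _; rewrite mulr_ge0.
Qed.

(** The term d = 1 of the renewal equation. *)
Lemma bcoef_cons j alpha : q [:: j] * bcoef q alpha <= bcoef q (j :: alpha).
Proof.
rewrite [leRHS]bcoef_rec// big_ltn//= take0 drop0 lerDl.
by apply: sumr_ge0 => d _; rewrite mulr_ge0 ?bcoef_ge0.
Qed.

Lemma bcoef_gt0 alpha : 0 < bcoef q alpha.
Proof.
elim: alpha => [|j alpha IH]; first exact: ltr01.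
apply: lt_le_trans (bcoef_cons _ _); rewrite mulr_gt0//.
by case: hq.
Qed.
End Bcoef.

(** * Operators indexed by words and sums over words *)

Section WordOps.
Variables (R : realType) (H : hilbertType R).
Implicit Types (S T : bop H H).

Lemma bop_scalerAl (a : R[i]) S T : (a *: S) * T = a *: (S * T).
Proof. exact: bop_ext. Qed.
Lemma bop_scalerAr (a : R[i]) S T : S * (a *: T) = a *: (S * T).
Proof. by apply: bop_ext => x; rewrite !bop_mulE !bop_scaleE bop_mulE bopZ. Qed.

Variables (n : nat) (X : 'I_n -> bop H H).

Lemma word_op_nil : word_op X [::] = 1.
Proof. by rewrite /word_op big_nil. Qed.
Lemma word_op_cons j al : word_op X (j :: al) = X j * word_op X al.
Proof. by rewrite /word_op big_cons. Qed.
Lemma word_op_cat al be : word_op X (al ++ be) = word_op X al * word_op X be.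
Proof. by rewrite /word_op big_cat. Qed.
End WordOps.

Lemma word_op_dilate (R : realType) (H : hilbertType R) n (X : 'I_n -> bop H H) (r : R) al :
  word_op (fun j => r%:C *: X j) al = (r ^+ size al)%:C *: word_op X al.
Proof.
elim: al => [|j al IH]; first by rewrite !word_op_nil expr0 rmorph1 scale1r.
rewrite !word_op_cons IH bop_scalerAl bop_scalerAr scalerA /= exprS.
by congr (_ *: _); rewrite rmorphM.
Qed.

Section WordSums.
Variables (V : nmodType) (n : nat).

(** Recursion on the first letter makes cutting all words at a given position
    ([sum_words_cat]) a direct induction. *)
Fixpoint sum_words (p : nat) (F : seq 'I_n -> V) : V :=
  if p is p'.+1 then \sum_(j < n) sum_words p' (fun w => F (j :: w)) else F [::].

Lemma sum_wordsE p (F : seq 'I_n -> V) : \sum_(t : p.-tuple 'I_n) F t = sum_words p F.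
Proof.
elim: p F => [|p IHp] F /=.
  by rewrite (big_pred1 [tuple])// => t /=; apply/esym/eqP; exact: tuple0.
under [RHS]eq_bigr do rewrite -IHp.
rewrite pair_big/= (reindex (fun jt : 'I_n * p.-tuple 'I_n => cons_tuple jt.1 jt.2))//=.
exists (fun t : p.+1.-tuple 'I_n => (thead t, behead_tuple t)) => [[j t] _|t _].
  by congr pair; apply: val_inj.
by rewrite [RHS]tuple_eta; apply: val_inj.
Qed.

Lemma eq_sum_words p (F G : seq 'I_n -> V) :
  (forall w, size w = p -> F w = G w) -> sum_words p F = sum_words p G.
Proof.
by move=> FG; rewrite -!sum_wordsE; apply: eq_bigr => t _; rewrite FG ?size_tuple.
Qed.

Lemma sum_words_cat d e (F : seq 'I_n -> V) :
  sum_words (d + e) F = sum_words d (fun u => sum_words e (fun v => F (u ++ v))).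
Proof. by elim: d F => // d IHd F /=; apply: eq_bigr => j _; rewrite IHd. Qed.

Lemma sum_words_sum p (I : Type) (r : seq I) (P : pred I) (F : I -> seq 'I_n -> V) :
  sum_words p (fun w => \sum_(i <- r | P i) F i w) =
  \sum_(i <- r | P i) sum_words p (F i).
Proof.
by rewrite -sum_wordsE exchange_big/=; apply: eq_bigr => i _; rewrite sum_wordsE.
Qed.
End WordSums.

Lemma sum_words_mulr (R : realType) n (p : nat) (a : R) (F : seq 'I_n -> R) :
  sum_words p (fun w => a * F w) = a * sum_words p F.
Proof. by rewrite -!sum_wordsE mulr_sumr. Qed.

Lemma sum_words_finsupp (R : realType) n (S : {fset seq 'I_n}) (p : nat) (F : seq 'I_n -> R) :
  (forall w, w \notin S -> F w = 0) ->
  sum_words p F = \sum_(w <- S | size w == p) F w.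
Proof.
move=> FS; rewrite -sum_wordsE.
have -> : \sum_(t : p.-tuple 'I_n) F t = \sum_(w <- [seq tval t | t <- index_enum (p.-tuple 'I_n)]) F w.
  by rewrite big_map.
rewrite (bigID (mem S))/= [X in _ + X]big1 ?addr0; last by move=> w /FS.
rewrite -big_filter -[RHS]big_filter; apply: perm_big; apply: uniq_perm.
- rewrite filter_uniq// map_inj_uniq; last exact: val_inj.
  exact: index_enum_uniq.
- by rewrite filter_uniq// fset_uniq.
move=> w; rewrite !mem_filter andbC; congr (_ && _).
apply/mapP/eqP => [[t _ ->]|wp]; first by rewrite size_tuple.
by exists (tcast wp (in_tuple w)); rewrite ?mem_index_enum ?val_tcast.
Qed.

Lemma sum_words_le_finsupp (R : realType) n (S : {fset seq 'I_n}) (p : nat)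
    (F : seq 'I_n -> R) :
  (forall w, 0 <= F w) -> (forall w, w \notin S -> F w = 0) ->
  \sum_(1 <= d < p.+1) sum_words d F <= \sum_(w <- S) F w.
Proof.
move=> F0 FS; under eq_bigr do rewrite (sum_words_finsupp _ FS).
rewrite (exchange_big_dep xpredT)//=; apply: ler_sum => w _.
have [/andP[h1 h2]|h] := boolP ((1 <= size w)%N && (size w <= p)%N).
  rewrite (@big_cat_nat _ _ _ (size w))//=; last by rewrite ltnW.
  rewrite big_nat_cond big1 ?add0r; last first.
    by move=> d /andP[/andP[_ hd] /eqP hd']; rewrite hd' ltnn in hd.
  rewrite big_nat_cond big_ltn_cond//= ?eqxx ?leqnn ?ltnS ?h2//=.
  rewrite big_nat_cond big1 ?addr0// => d.
  by move=> /andP[/andP[hd _] /andP[_ /eqP hd']]; rewrite hd' ltnn in hd.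
rewrite big_nat_cond big1// => d /andP[/andP[d1 d2] /eqP hd].
by move: h; rewrite hd d1 -ltnS d2.
Qed.

(** * Row contractions and the norm of a homogeneous part *)

Section OneVariable.
Variables (R : realType) (H : hilbertType R) (n : nat).
Variables (q : {fsfun seq 'I_n -> R with 0}) (X : 'I_n -> bop H H).
Hypothesis hq : positive_regular q.

(** The quadratic form h |-> <Phi_{q,X}(I) h, h> ([rdot_Phi1]). *)
Definition phi_form (h : H) : R :=
  \sum_(al <- finsupp q) q al * rnorm (adjoint (word_op X al) h) ^+ 2.

Lemma rdot_Phi1 h : rdot (Phi q X 1 h) h = phi_form h.
Proof.
rewrite /Phi bop_sumE rdot_suml; apply: eq_bigr => al _.
by rewrite bop_scaleE rdotZl mulr1 bop_mulE rdot_adjoint rdotxx.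
Qed.

Let q_ge0 alpha : 0 <= q alpha. Proof. by case: hq. Qed.

(** Phi_{q,X}(I) <= I. *)
Definition row_contraction := forall h, phi_form h <= rnorm h ^+ 2.

(** Expand b by the renewal equation and cut each word at d. For a fixed prefix
    the induction hypothesis applies to the vector X_prefix^adj h, and what
    remains is a part of phi_form. *)
Lemma sum_words_bcoef_le (p : nat) (h : H) : row_contraction ->
  sum_words p (fun al => bcoef q al * rnorm (adjoint (word_op X al) h) ^+ 2) <= rnorm h ^+ 2.
Proof.
move=> hX; have [m] := ubnP p; elim: m p h => // m IHm [|p] h.
  by move=> _ /=; rewrite mul1r word_op_nil adjoint1.
rewrite ltnS => pm; apply: le_trans (hX h).
apply: le_trans (sum_words_le_finsupp p.+1 _ _); last first.
- by move=> w; rewrite memNfinsupp => /eqP ->; rewrite mul0r.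
- by move=> w; rewrite mulr_ge0 ?sqr_ge0.
rewrite (eq_sum_words (G := fun al => \sum_(1 <= d < p.+2) q (take d al) * bcoef q (drop d al) *
    rnorm (adjoint (word_op X al) h) ^+ 2)); last first.
  move=> w wp; rewrite bcoef_rec; last by rewrite -size_eq0 wp.
  by rewrite mulr_suml wp.
rewrite sum_words_sum big_nat [leRHS]big_nat; apply: ler_sum => d /andP[d1 dp].
rewrite -[in leLHS](@subnKC d p.+1)// sum_words_cat -!sum_wordsE.
apply: ler_sum => t _.
rewrite (eq_sum_words (G := fun v => q t * (bcoef q v *
  rnorm (adjoint (word_op X v) (adjoint (word_op X t) h)) ^+ 2))); last first.
  move=> v _; rewrite take_size_cat ?size_tuple// drop_size_cat ?size_tuple//.
  by rewrite word_op_cat adjointM mulrA.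
rewrite sum_words_mulr ler_wpM2l// IHm//; lia.
Qed.
End OneVariable.

Section Multi.
Variables (R : realType) (H : hilbertType R) (k : nat) (n : 'I_k -> nat).
Variables (q : forall i : 'I_k, {fsfun seq 'I_(n i) -> R with 0}).
Hypothesis hq : forall i, positive_regular (q i).
Variables (X : optuple n H).
Arguments X : clear implicits.

Definition bcoef_multi (al : multiword n) : R := \prod_(i < k) bcoef (q i) (al i).

Lemma bcoef_multi_gt0 al : 0 < bcoef_multi al.
Proof. by apply: prodr_gt0 => i _; exact: bcoef_gt0. Qed.

Section Fibre.
Variable (p : multidegree k).
Local Notation E := {dffun forall i : 'I_k, (p i).-tuple 'I_(n i)}.

(** Induction over the variables in L, the words of the others being frozen at
    those of f0: summing over the word of one further variable i is the
    one-variable inequality for X_i. *)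
Lemma sum_Lambda_bcoef_le_aux (L : seq 'I_k) (f0 : E) (h : H) : uniq L ->
  (forall i, row_contraction (q i) (X i)) ->
  \sum_(f : E | [forall i, (i \in L) || (f i == f0 i)])
     (\prod_(i <- L) bcoef (q i) (f i)) *
     rnorm (adjoint (\prod_(i <- L) word_op (X i) (f i)) h) ^+ 2 <= rnorm h ^+ 2.
Proof.
move=> uL hX; elim: L uL h => [|i L IH] /= => [_|/andP[iL uL]] h.
  rewrite (big_pred1 f0) => [|f /=]; first by rewrite !big_nil adjoint1 mul1r.
  apply/forallP/eqP => [h1|-> //]; apply/ffunP => i; apply/eqP; exact: h1.
rewrite (partition_big (fun f : E => f i) xpredT)//=.
apply: (le_trans _ (sum_words_bcoef_le (hq i) (p i) h (hX i))).
rewrite -sum_wordsE; apply: ler_sum => t _.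
(* replacing the i-th word identifies the fibre over t with the families
   frozen at f0 in position i as well *)
pose up (s : (p i).-tuple 'I_(n i)) (f : E) : E := [ffun j => @dfwith _ (fun l => (p l).-tuple 'I_(n l)) f i s j].
have up_out s f j : i != j -> up s f j = f j.
  by move=> ij; rewrite ffunE; exact: (@dfwith_out _ (fun l => (p l).-tuple 'I_(n l)) f i s j ij).
have up_in s f : up s f i = s.
  by rewrite ffunE; exact: (@dfwith_in _ (fun l => (p l).-tuple 'I_(n l)) f i s).
rewrite (reindex_onto (up t) (up (f0 i))) /=; last first.
  move=> f /andP[_ /eqP fi]; apply/ffunP => j.
  have [<-|ij] := eqVneq i j; first by rewrite up_in fi.
  by rewrite !up_out.
apply: (@le_trans _ _ (bcoef (q i) t * \sum_(f : E | [forall j, (j \in L) || (f j == f0 j)])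
     (\prod_(i <- L) bcoef (q i) (f i)) *
     rnorm (adjoint (\prod_(i <- L) word_op (X i) (f i)) (adjoint (word_op (X i) t) h)) ^+ 2)); last first.
  by rewrite ler_wpM2l ?IH// ltW// bcoef_gt0.
rewrite mulr_sumr le_eqVlt; apply/orP; left; apply/eqP.
apply: eq_big => [f|f _].
  rewrite up_in eqxx andbT; apply/andP/forallP => [[/forallP h1 /eqP h2] j|h1].
    have [<-|ij] := eqVneq i j; first by rewrite -h2 up_in eqxx orbT.
    by have := h1 j; rewrite inE eq_sym (negPf ij)/= up_out.
  have fi : f i = f0 i by have := h1 i; rewrite (negPf iL)/= => /eqP.
  split.
    apply/forallP => j; have [<-|ij] := eqVneq i j; first by rewrite inE eqxx.
    by rewrite inE eq_sym (negPf ij)/= up_out.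
  apply/eqP/ffunP => j; have [<-|ij] := eqVneq i j; first by rewrite up_in.
  by rewrite !up_out.
rewrite !big_cons !up_in adjointM bop_mulE [RHS]mulrA.
have eL (j : 'I_k) : j \in L -> up t f j = f j.
  by move=> jL; rewrite up_out//; apply: contraNneq iL => ->.
have -> : \prod_(j <- L) word_op (X j) (up t f j) = \prod_(j <- L) word_op (X j) (f j).
  by rewrite !big_seq; apply: eq_bigr => j jL; rewrite eL.
by congr (_ * _ * _); rewrite !big_seq; apply: eq_bigr => j jL; rewrite eL.
Qed.

Lemma sum_Lambda_bcoef_le (h : H) :
  (forall i, row_contraction (q i) (X i)) ->
  sum_Lambda p (fun al : multiword n =>
     bcoef_multi al * rnorm (adjoint (multiword_op X al) h) ^+ 2) <= rnorm h ^+ 2.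
Proof.
move=> hX; rewrite /sum_Lambda.
have [f0 _|E0] := pickP (@predT E); last first.
  by rewrite big_pred0 ?sqr_ge0// => f; exact: E0 f.
apply: le_trans (sum_Lambda_bcoef_le_aux f0 h (index_enum_uniq 'I_k) hX).
rewrite le_eqVlt; apply/orP; left; apply/eqP; apply: eq_bigl => f.
by apply/esym/forallP => i; rewrite mem_index_enum.
Qed.

(** The dual form of [sum_Lambda_bcoef_le]: pair the sum with itself. *)
Lemma row_bound (y : E -> H) :
  (forall i, row_contraction (q i) (X i)) ->
  rnorm (\sum_(f : E) multiword_op X (fun i => tval (f i)) (y f)) ^+ 2 <=
  \sum_(f : E) (bcoef_multi (fun i => tval (f i)))^-1 * rnorm (y f) ^+ 2.
Proof.
move=> hX; set h := \sum_f _; set S := (leRHS).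
(* h occurs on both sides, hence the absorption *)
have half_le (a b : R) : a <= (b + a) / 2 -> a <= b.
  by rewrite ler_pdivlMr// mulr_natr mulr2n lerD2r.
apply: half_le.
apply: le_trans (_ : (S + sum_Lambda p (fun al : multiword n =>
     bcoef_multi al * rnorm (adjoint (multiword_op X al) h) ^+ 2)) / 2 <= _); last first.
  by rewrite ler_pM2r// lerD2l sum_Lambda_bcoef_le.
rewrite -[in leLHS]rdotxx [in X in rdot X _]/h rdot_suml /S /sum_Lambda -big_split mulr_suml/=.
apply: ler_sum => f _; rewrite rdot_adjoint; apply: (le_trans (rdot_le _ _)).
have b0 := bcoef_multi_gt0 (fun i => tval (f i)).
move: (bcoef_multi _) b0 (rnorm (y f)) (rnorm (bop_fun (adjoint _) h)) => b b0 u v.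
have : 0 <= (u - b * v) ^+ 2 / b by rewrite divr_ge0 ?sqr_ge0 ?ltW.
have -> : (u - b * v) ^+ 2 / b = b^-1 * u ^+ 2 + b * v ^+ 2 - 2 * (u * v).
  by field; rewrite gt_eqF.
by rewrite ler_pdivlMr// subr_ge0 (mulrC 2).
Qed.
End Fibre.

Lemma multiword_op_dilate (r : R) (p : multidegree k)
    (f : {dffun forall i : 'I_k, (p i).-tuple 'I_(n i)}) :
  multiword_op (fun i j => r%:C *: X i j) (fun i => tval (f i)) =
  (r ^+ total_degree p)%:C *: multiword_op X (fun i => tval (f i)).
Proof.
rewrite /multiword_op /total_degree.
elim: (index_enum _) => [|i s IH]; first by rewrite !big_nil expr0 rmorph1 scale1r.
rewrite !big_cons IH word_op_dilate bop_scalerAl bop_scalerAr scalerA size_tuple.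
by rewrite exprD; congr (_ *: _); rewrite rmorphM.
Qed.

Variables (K T : hilbertType R) (tau : {bilinear K -> H -> T}).
Hypothesis tauP : is_hilbert_tensor tau.
Variable A : multiword n -> bop K K.

Definition column_norm (p : multidegree k) : R :=
  opnorm (sum_Lambda p (fun alpha =>
       ((\prod_(i < k) bcoef (q i) (alpha i))^-1)%:C *:
         (adjoint (A alpha) * A alpha))).

Lemma rdot_column p x y : rdot (sum_Lambda p (fun alpha =>
       ((bcoef_multi alpha)^-1)%:C *: (adjoint (A alpha) * A alpha)) x) y =
  sum_Lambda p (fun alpha => (bcoef_multi alpha)^-1 * rdot (A alpha x) (A alpha y)).
Proof.
rewrite /sum_Lambda bop_sumE rdot_suml; apply: eq_bigr => f _.
by rewrite bop_scaleE rdotZl bop_mulE rdotC -rdot_adjoint rdotC.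
Qed.

(** Row times column: the row (X_alpha / b^(1/2)) is controlled by [row_bound], the
    column (A_alpha) by the definition of column_norm, and dilation by r scales
    every word of Lambda_p by r^|p|. *)
Lemma opnorm_homogeneous_part_le (r : R) (p : multidegree k) : 0 <= r ->
  (forall i, row_contraction (q i) (X i)) ->
  opnorm (homogeneous_part A tau (fun i j => r%:C *: X i j) p) <=
  r ^+ total_degree p * Num.sqrt (column_norm p).
Proof.
move=> r0 hX; rewrite -[r ^+ _]ger0_norm ?exprn_ge0// -sqrtr_sqr -sqrtrM ?sqr_ge0//.
apply: (opnorm_sum_tensor_op_le tauP (w := fun f : {dffun forall i : 'I_k, (p i).-tuple 'I_(n i)} =>
   bcoef_multi (fun i => tval (f i)))).
- by move=> f; exact: bcoef_multi_gt0.
- exact: opnorm_ge0.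
- exact: sqr_ge0.
- move=> x; have := rdot_column p x x; rewrite /sum_Lambda => h.
  under eq_bigr do rewrite -rdotxx.
  rewrite -h; apply: (le_trans (rdot_le _ _)).
  by rewrite expr2 mulrA ler_wpM2r ?rnorm_ge0// rnorm_bop.
- move=> y; under eq_bigr do rewrite multiword_op_dilate bop_scaleE.
  rewrite -scaler_sumr rnormZ exprMn real_normK ?num_real// ler_wpM2l ?sqr_ge0//.
  exact: row_bound.
Qed.
End Multi.

(** * Unordered sums and the majorant series *)

Section Summation.
Variables (R : realType) (I : choiceType).
Implicit Types (u m : I -> R) (F G : {fset I}).

Lemma partial_sumE (V : zmodType) (u : I -> V) F : partial_sum u F = \sum_(i <- F) u i.
Proof. by rewrite /partial_sum big_seq_fsetE. Qed.

Lemma ler_partial_sum u F G : (forall i, 0 <= u i) -> (F `<=` G)%fset ->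
  partial_sum u F <= partial_sum u G.
Proof.
move=> u0 FG; rewrite !partial_sumE.
rewrite (big_fsetID _ (mem F) G)/=.
have -> : [fset x in G | x \in F]%fset = F.
  apply/fsetP => x; rewrite !inE /= andbC; case: (boolP (x \in F)) => //= xF.
  by rewrite (fsubsetP FG).
by rewrite lerDl; apply: sumr_ge0.
Qed.

(** The tails of u are bounded by those of m because m - u is nonnegative. *)
Lemma partial_sum_sub_le u m F G : (forall i, 0 <= u i <= m i) -> (F `<=` G)%fset ->
  partial_sum u G - partial_sum u F <= partial_sum m G - partial_sum m F.
Proof.
move=> um FG; rewrite lerBlDr addrAC lerBrDr -lerBrDl.
have : partial_sum (fun i => m i - u i) F <= partial_sum (fun i => m i - u i) G.
  by apply: ler_partial_sum => // i; rewrite subr_ge0; case/andP: (um i).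
rewrite !partial_sumE !sumrB; lra.
Qed.

Lemma nonneg_bounded_cvg u (M : R) : (forall i, 0 <= u i) ->
  (forall F, partial_sum u F <= M) ->
  partial_sum u @ totally --> (sup (range (partial_sum u)) : R).
Proof.
move=> u0 uM.
have hS : has_sup (range (partial_sum u)).
  by split; [exists (partial_sum u fset0%fset), fset0%fset|exists M => _ [F _ <-]].
apply/cvgrPdist_lt => e e0; have [_ [F _ <-] hF] := sup_adherent e0 hS.
exists F => //= G FG; rewrite ger0_norm ?subr_ge0.
  rewrite ltrBlDr addrC -ltrBlDr; apply: (lt_le_trans hF).
  exact: ler_partial_sum.
by apply: ub_le_sup; [case: hS|exists G].
Qed.

Lemma sum_sup u (M : R) : (forall i, 0 <= u i) ->
  (forall F, partial_sum u F <= M) -> sum u = sup (range (partial_sum u)).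
Proof. by move=> u0 uM; apply: cvg_lim => //; apply: nonneg_bounded_cvg uM. Qed.

Lemma partial_sum_le_sup u (M : R) F : (forall i, 0 <= u i) ->
  (forall F, partial_sum u F <= M) -> partial_sum u F <= sup (range (partial_sum u)).
Proof.
move=> u0 uM; apply: ub_le_sup; last by exists F.
by exists M => _ [G _ <-].
Qed.

(** Weierstrass test for unordered sums. *)
Lemma dominated_uniform (T : choiceType) (S : set T) (f : I -> T -> R) m (M : R) :
  (forall i, 0 <= m i) -> (forall F, partial_sum m F <= M) ->
  (forall i x, 0 <= f i x) -> (forall i x, S x -> f i x <= m i) ->
  {uniform S, (fun F x => partial_sum (fun i => f i x) F) @ totally -->
     (fun x => sum (fun i => f i x))}.
Proof.
move=> m0 mM f0 fm; rewrite /cvg_to => P /uniform_nbhs[E [/= entE EP]].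
have [e /= e0 eE] : exists2 e : R, 0 < e & forall a b : R, `|a - b| < e -> E (a, b).
  have [e e0 he] := entE; exists e => // a b ab; apply: he => /=; exact: ab.
have hS : has_sup (range (partial_sum m)).
  by split; [exists (partial_sum m fset0%fset), fset0%fset|exists M => _ [F _ <-]].
have [_ [F _ <-] hF] := sup_adherent e0 hS.
exists F => //= G FG; apply: EP => /= x Sx; apply: eE.
have um i : 0 <= f i x <= m i by rewrite f0 fm.
have uM F' : partial_sum (fun i => f i x) F' <= M.
  apply: le_trans (mM F'); rewrite !partial_sumE; apply: ler_sum => i _.
  by case/andP: (um i).
rewrite (sum_sup _ uM)// ger0_norm ?subr_ge0; last exact: partial_sum_le_sup uM.
rewrite ltrBlDr.
apply: (@le_lt_trans _ _ (sup (range (partial_sum m)) - partial_sum m G +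
   partial_sum (fun i => f i x) G)); last first.
  rewrite ltrD2r ltrBlDr addrC -ltrBlDr (lt_le_trans hF)//.
  exact: ler_partial_sum.
apply: ge_sup; first by exists (partial_sum (fun i => f i x) fset0%fset), fset0%fset.
move=> _ [G' _ <-]; rewrite -lerBlDr.
apply: (@le_trans _ _ (partial_sum (fun i => f i x) (G `|` G')%fset - partial_sum (fun i => f i x) G)).
  by rewrite lerD2r; apply: ler_partial_sum => //; rewrite fsubsetUr.
apply: (le_trans (partial_sum_sub_le um (fsubsetUl _ _))).
by rewrite lerD2r; apply: partial_sum_le_sup mM.
Qed.

Lemma partial_sum_dominated_cvg u m (M : R) : (forall F, partial_sum m F <= M) ->
  (forall i, 0 <= u i <= m i) -> cvg (partial_sum u @ totally).
Proof.
move=> mM um; apply: cvgP; apply: (@nonneg_bounded_cvg u M) => [i|F].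
  by case/andP: (um i).
apply: le_trans (mM F); rewrite !partial_sumE; apply: ler_sum => i _.
by case/andP: (um i).
Qed.
End Summation.

Section Geometric.
Variables (R : realType) (k : nat).
Local Notation MD := (multidegree k).

(** Degrees bounded by N are the finite functions into 'I_N.+1. *)
Lemma box_sum (u : MD -> R) (F : {fset MD}) (P : pred MD) (N : nat) :
  (forall p, 0 <= u p) -> (forall p, p \in F -> P p -> forall i, (p i < N.+1)%N) ->
  \sum_(p <- F | P p) u p <= \sum_(g : {ffun 'I_k -> 'I_N.+1}) u [ffun i => val (g i)].
Proof.
move=> u0 FN.
(* back and forth between degrees and finite functions, inverse on the box *)
pose lft (p : MD) : {ffun 'I_k -> 'I_N.+1} := [ffun i => inord (p i)].
pose unl (g : {ffun 'I_k -> 'I_N.+1}) : MD := [ffun i => val (g i)].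
have lK p : p \in F -> P p -> unl (lft p) = p.
  by move=> pF Pp; apply/ffunP => i; rewrite !ffunE /= inordK// FN.
have -> : \sum_(p <- F | P p) u p = \sum_(g <- [seq lft p | p <- F & P p]) u (unl g).
  rewrite big_map big_filter big_seq_cond [RHS]big_seq_cond.
  by apply: eq_bigr => p /andP[pF Pp]; rewrite lK.
rewrite big_uniq/=; last first.
  rewrite map_inj_in_uniq ?filter_uniq ?fset_uniq// => p p'.
  rewrite !mem_filter => /andP[Pp pF] /andP[Pp' pF'] /(congr1 unl).
  by rewrite !lK.
rewrite [leRHS](bigID (mem [seq lft p | p <- F & P p]))/= lerDl.
by apply: sumr_ge0 => g _; exact: u0.
Qed.

Lemma geometric_bound (rho : R) (N : nat) : 0 <= rho < 1 ->
  \sum_(j < N) rho ^+ j <= (1 - rho)^-1.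
Proof.
move=> /andP[r0 r1]; have d0 : 0 < 1 - rho by rewrite subr_gt0.
rewrite -(ler_pM2l d0) mulfV ?gt_eqF// -opprB mulNr -subrX1 opprB.
by rewrite lerBlDr lerDl exprn_ge0.
Qed.

(** The sum over a box of degrees is a product of k geometric sums. *)
Lemma geometric_multi_bound (rho : R) (F : {fset MD}) : 0 <= rho < 1 ->
  \sum_(p <- F) rho ^+ total_degree p <= ((1 - rho)^-1) ^+ k.
Proof.
move=> r01; have r0 : 0 <= rho by case/andP: r01.
pose N := \max_(p <- F) total_degree p.
apply: (le_trans (@box_sum (fun p => rho ^+ total_degree p) F xpredT N _ _)).
- by move=> p; rewrite exprn_ge0.
- move=> p pF _ i; rewrite ltnS (@leq_trans (total_degree p))//.
    by rewrite /total_degree (bigD1 i)//= leq_addr.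
  by rewrite /N; apply: leq_bigmax_seq.
under eq_bigr => g _.
  rewrite /total_degree -prodrXr.
  under eq_bigr do rewrite ffunE.
  over.
rewrite -(bigA_distr_bigA (fun (i : 'I_k) (j : 'I_N.+1) => rho ^+ j))/=.
rewrite -[k in leRHS]card_ord -prodr_const; apply: ler_prod => i _.
by rewrite geometric_bound// andbT sumr_ge0// => j _; rewrite exprn_ge0.
Qed.
End Geometric.

Section Majorant.
Variables (R : realType) (k : nat) (n : 'I_k -> nat).
Variables (q : forall i : 'I_k, {fsfun seq 'I_(n i) -> R with 0}).
Variables (K : hilbertType R) (A : multiword n -> bop K K).
Local Notation MD := (multidegree k).

Definition majorant (r : R) (p : MD) : R :=
  r ^+ total_degree p * Num.sqrt (column_norm q A p).

Lemma column_norm_ge0 p : 0 <= column_norm q A p. Proof. exact: opnorm_ge0. Qed.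

Lemma majorant_ge0 r p : 0 <= r -> 0 <= majorant r p.
Proof. by move=> r0; rewrite mulr_ge0 ?exprn_ge0 ?sqrtr_ge0. Qed.

Lemma total_degree_eq0 (p : MD) : total_degree p = 0%N -> p = [ffun=> 0%N].
Proof.
move=> /eqP; rewrite /total_degree sum_nat_eq0 => /forallP h.
by apply/ffunP => i; rewrite ffunE; apply/eqP; have := h i.
Qed.

(** Only the degree 0 survives, because 0^0 = 1; this covers the radius r = 0 also
    when gamma = 0. *)
Lemma majorant0_bounded : exists M, forall F, partial_sum (majorant 0) F <= M.
Proof.
exists (Num.sqrt (column_norm q A [ffun=> 0%N])) => F; rewrite partial_sumE.
have m0 p : majorant 0 p = if p == [ffun=> 0%N] then Num.sqrt (column_norm q A [ffun=> 0%N]) else 0.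
  rewrite /majorant; case: eqP => [->|p0].
    rewrite [total_degree _]big1 ?expr0 ?mul1r// => i _; by rewrite ffunE.
  rewrite expr0n; case: eqP => [/total_degree_eq0//|_]; by rewrite mul0r.
under eq_bigr do rewrite m0.
have [pF|pF] := boolP ([ffun=> 0%N] \in F).
  rewrite (big_fsetD1 _ pF)/= eqxx big_seq big1 ?addr0// => i.
  by rewrite !inE => /andP[/negPf ->].
rewrite big_seq big1 ?sqrtr_ge0// => i iF; case: eqP => // e.
by rewrite e (negPf pF) in iF.
Qed.

Lemma sqrt_column_norm_le (lam : R) p : (0 < total_degree p)%N -> 0 <= lam ->
  column_norm q A p `^ ((2 * total_degree p)%N%:R^-1) <= lam ->
  Num.sqrt (column_norm q A p) <= lam ^+ total_degree p.
Proof.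
move=> p0 lam0 h.
have m0 : ((2 * total_degree p)%N%:R : R) != 0 by rewrite pnatr_eq0; lia.
rewrite -[leRHS]ger0_norm ?exprn_ge0// -sqrtr_sqr ler_wsqrtr// -exprM mulnC.
rewrite -[leLHS](@powRr1 _ _ (column_norm_ge0 p)) -(mulVf m0) powRrM powR_mulrn ?powR_ge0//.
by rewrite lerXn2r// nnegrE ?powR_ge0.
Qed.

(** The root test. Take lam between 1/gamma and 1/r: in large degrees the terms are
    at most (r lam)^|p|, and the remaining degrees lie in a finite box. *)
Lemma majorant_bounded (r : R) : 0 <= r ->
  (r == 0) || (r%:E < conv_radius q A)%E ->
  exists M, forall F, partial_sum (majorant r) F <= M.
Proof.
move=> r0; have [->|rn0] := eqVneq r 0; first by move=> _; exact: majorant0_bounded.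
move=> /= rg; have {rn0}r0' : 0 < r by rewrite lt_neqAle eq_sym rn0.
have inv_lt : (inv_conv_radius q A < (r^-1)%:E)%E.
  move: rg; rewrite /conv_radius; case: (inv_conv_radius q A) => [x||]//=.
  - rewrite inver; case: eqP => [->|/eqP x0]; first by rewrite lte_fin invr_gt0.
    rewrite !lte_fin => h; have xi : 0 < x by rewrite -invr_gt0 (lt_trans r0').
    by rewrite -[x]invrK ltf_pV2// posrE invr_gt0.
  - by rewrite invey lte_fin ltNge r0.
have [_ [V [N _ NV] <-] supV] := ereal_inf_lt inv_lt.
have [lam [lam0 lamr hlam]] : exists lam : R, [/\ 0 <= lam, lam < r^-1 &
    forall p : MD, (N <= total_degree p)%N ->
      column_norm q A p `^ ((2 * total_degree p)%N%:R^-1) <= lam].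
  set s := ereal_sup _ in supV.
  have sub p : (N <= total_degree p)%N ->
      ((column_norm q A p `^ ((2 * total_degree p)%N%:R^-1))%:E <= s)%E.
    by move=> Np; apply: ereal_sup_ubound; exists p => //; exact: NV.
  case: s supV sub => [x||]//=.
  - rewrite lte_fin => xr sub; exists (Num.max 0 x); split.
    + by rewrite le_max lexx.
    + by rewrite gt_max invr_gt0 r0'.
    + by move=> p /sub; rewrite lee_fin le_max => ->; rewrite orbT.
  - move=> _ sub; exists 0; split => //; first by rewrite invr_gt0.
    by move=> p /sub; rewrite leeNy_eq.
have rho01 : 0 <= r * lam < 1.
  by rewrite mulr_ge0//= -ltr_pdivlMl// mulr1.
pose B := \sum_(g : {ffun 'I_k -> 'I_N.+1}) majorant r [ffun i => val (g i)].
exists (B + ((1 - r * lam)^-1) ^+ k) => F; rewrite partial_sumE.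
rewrite (bigID (fun p : MD => (total_degree p < N.+1)%N))/=; apply: lerD.
  apply: box_sum => [p|p _ pN i]; first exact: majorant_ge0.
  by rewrite (leq_ltn_trans _ pN)// /total_degree (bigD1 i)//= leq_addr.
apply: le_trans (geometric_multi_bound F rho01).
apply: (@le_trans _ _ (\sum_(p <- F | ~~ (total_degree p < N.+1)%N) (r * lam) ^+ total_degree p)).
  apply: ler_sum => p; rewrite -leqNgt => Np.
  rewrite exprMn ler_wpM2l ?exprn_ge0// sqrt_column_norm_le//; first exact: leq_ltn_trans Np.
  by apply: hlam; exact: ltnW.
rewrite [leRHS](bigID (fun p : MD => (total_degree p < N.+1)%N))/= lerDr.
by apply: sumr_ge0 => p _; rewrite exprn_ge0//; case/andP: rho01.
Qed.
End Majorant.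

(** * Positivity and the defect operators of a polydomain *)

Section Positivity.
Variables (R : realType) (H : hilbertType R).
Implicit Types (S T : bop H H).

Lemma positive_op_rdot T : positive_op T -> forall h, 0 <= rdot (T h) h.
Proof. by move=> Tp h; have := Tp h; rewrite lecE => /andP[]. Qed.

(** Positivity on a complex space includes self-adjointness: the form is real, and
    evaluating it at x + i y polarises this. *)
Lemma positive_opP T : positive_op T <->
  (forall h, 0 <= rdot (T h) h) /\ (forall x y, rdot (T x) y = rdot x (T y)).
Proof.
split=> [Tp|[Tp Ts] h]; last first.
  rewrite hdot_rdot.
  have e : rdot (T h) ('i%C *: h) = 0.
    apply/eqP; have : rdot (T h) ('i%C *: h) = - rdot (T h) ('i%C *: h).
      by rewrite -[in RHS]rdot_i -bopZ Ts rdotC.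
    by move=> /eqP; rewrite -addr_eq0 -mulr2n mulrn_eq0.
  by rewrite e mulr0 addr0 lecR.
split; first exact: positive_op_rdot.
have im0 h : rdot (T h) ('i%C *: h) = 0.
  have := Tp h; rewrite hdot_rdot lecE => /andP[/eqP + _].
  by simpc.
move=> x y.
have := im0 (x + 'i%C *: y).
have i2 (z : H) : 'i%C *: ('i%C *: z) = - z by rewrite scalerA -expr2 sqr_i scaleN1r.
rewrite bopD scalerDr !(rdotDl, rdotDr) !im0 bopZ i2 rdotNr rdot_iI (rdotC _ x).
by lra.
Qed.

(** With S the inverse, |h| <= |S| |T h|, while |T h|^2 <= |T| <T h, h> by
    Cauchy-Schwarz for the form of T. *)
Lemma strictly_positive_lower_bound T : strictly_positive_op T ->
  exists2 c : R, 0 < c & forall h, c * rnorm h ^+ 2 <= rdot (T h) h.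
Proof.
move=> [Tp [S [ST _]]].
have T0 := positive_op_rdot Tp.
have [_ Ts] := (positive_opP T).1 Tp.
have CS x y : rdot (T x) y ^+ 2 <= rdot (T x) x * rdot (T y) y.
  apply: (@real_dot_CS_sqr R H (fun x y => rdot (T x) y)) => //.
  - by move=> u v; rewrite Ts rdotC.
  - by move=> u v z; rewrite bopD rdotDl.
  - by move=> a u v; rewrite bopZ rdotZl.
pose M := (opnorm T + 1) * (opnorm S + 1) ^+ 2.
have T1 : 0 < opnorm T + 1 by rewrite ltr_wpDl ?opnorm_ge0.
have S1 : 0 < opnorm S + 1 by rewrite ltr_wpDl ?opnorm_ge0.
have M0 : 0 < M by rewrite mulr_gt0// exprn_gt0.
exists M^-1; first by rewrite invr_gt0.
move=> h; rewrite mulrC ler_pdivrMr//.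
have h1 : rnorm h <= (opnorm S + 1) * rnorm (T h).
  have e : S (T h) = h by rewrite -bop_mulE ST.
  rewrite -[in leLHS]e; apply: (le_trans (rnorm_bop _ _)).
  by rewrite ler_wpM2r ?rnorm_ge0// lerDl.
have h2 : rnorm (T h) ^+ 2 <= (opnorm T + 1) * rdot (T h) h.
  have [->|Th0] := eqVneq (T h) 0.
    by rewrite rnorm0 expr0n/= rdot0l mulr0.
  have nT : 0 < rnorm (T h) ^+ 2.
    by rewrite exprn_gt0// lt_neqAle rnorm_ge0 eq_sym rnorm_eq0 Th0.
  rewrite -(ler_pM2r nT) -expr2 -rdotxx; apply: (le_trans (CS _ _)).
  rewrite [leRHS]mulrAC [leRHS]mulrC; apply: ler_wpM2l => //.
  apply: (le_trans (rdot_le _ _)); rewrite rdotxx expr2 mulrA ler_wpM2r ?rnorm_ge0//.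
  by apply: (le_trans (rnorm_bop _ _)); rewrite ler_wpM2r ?rnorm_ge0// lerDl.
apply: (@le_trans _ _ ((opnorm S + 1) ^+ 2 * rnorm (T h) ^+ 2)).
  by rewrite -exprMn lerXn2r// nnegrE ?rnorm_ge0// mulr_ge0 ?rnorm_ge0// ltW.
have -> : rdot (T h) h * M = (opnorm S + 1) ^+ 2 * ((opnorm T + 1) * rdot (T h) h).
  by rewrite /M; ring.
by rewrite ler_wpM2l// exprn_ge0// ltW.
Qed.
End Positivity.

Section PhiMaps.
Variables (R : realType) (H : hilbertType R).

Section One.
Variables (n : nat) (q : {fsfun seq 'I_n -> R with 0}) (X : 'I_n -> bop H H).

Lemma PhiB S T : Phi q X (S - T) = Phi q X S - Phi q X T.
Proof.
rewrite /Phi -sumrB; apply: eq_bigr => al _.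
by rewrite mulrBr mulrBl scalerBr.
Qed.

Lemma rdot_Phi S x y : rdot (Phi q X S x) y =
  \sum_(al <- finsupp q) q al * rdot (S (adjoint (word_op X al) x)) (adjoint (word_op X al) y).
Proof.
rewrite /Phi bop_sumE rdot_suml; apply: eq_bigr => al _.
by rewrite bop_scaleE rdotZl !bop_mulE rdot_adjoint.
Qed.
End One.

(** Words in different variables commute, hence so do their adjoints. *)
Lemma Phi_comm n m (q : {fsfun seq 'I_n -> R with 0}) (r : {fsfun seq 'I_m -> R with 0})
    (X : 'I_n -> bop H H) (Y : 'I_m -> bop H H) S :
  (forall i j, X i * Y j = Y j * X i) ->
  Phi q X (Phi r Y S) = Phi r Y (Phi q X S).
Proof.
move=> XY.
have cw j al : word_op X al * Y j = Y j * word_op X al.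
  elim: al => [|i al IH]; first by rewrite word_op_nil mulr1 mul1r.
  by rewrite !word_op_cons -mulrA IH !mulrA XY.
have cww al be : word_op X al * word_op Y be = word_op Y be * word_op X al.
  elim: be => [|i be IH]; first by rewrite word_op_nil mulr1 mul1r.
  by rewrite !word_op_cons mulrA cw -mulrA IH !mulrA.
rewrite /Phi; under eq_bigr do rewrite mulr_sumr mulr_suml scaler_sumr.
rewrite exchange_big/=; apply: eq_bigr => be _.
rewrite mulr_sumr mulr_suml scaler_sumr; apply: eq_bigr => al _.
rewrite !(bop_scalerAl, bop_scalerAr) !scalerA (mulrC (q al)%:C); congr (_ *: _).
rewrite !mulrA cww -!mulrA; congr (_ * (_ * (_ * _))).
by rewrite -!adjointM cww.
Qed.

Variables (k : nat) (n : 'I_k -> nat).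
Variables (q : forall i : 'I_k, {fsfun seq 'I_(n i) -> R with 0}).
Hypothesis hq : forall i, positive_regular (q i).

Section Fixed.
Variables (X : optuple n H).
Arguments X : clear implicits.
Hypothesis cX : commuting X.

Local Notation G i := (fun Y => Y - Phi (q i) (X i) Y).
(** Delta along an arbitrary list of variables, to allow induction on the list. *)
Definition Delta_seq (L : seq 'I_k) (p : 'I_k -> bool) : bop H H -> bop H H :=
  \big[comp/idfun]_(i <- L) iter (p i) (G i).

Lemma id_sub_Phi_comm i j Y : G i (G j Y) = G j (G i Y).
Proof.
have [<-//|ij] := eqVneq i j.
rewrite !PhiB (@Phi_comm _ _ (q i) (q j)); last by move=> a b; exact: cX.
rewrite !opprB !addrA -!addrA; congr (_ + _).
by rewrite addrCA [RHS]addrCA; congr (_ + _); rewrite addrC.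
Qed.

Lemma eq_Delta_seq L (p p' : 'I_k -> bool) : {in L, p =1 p'} -> Delta_seq L p = Delta_seq L p'.
Proof.
by move=> pp; rewrite /Delta_seq !big_seq; apply: eq_bigr => i /pp ->.
Qed.

(** The factors commute, so any one of them may be applied last. *)
Lemma Delta_seq_pull L (p : 'I_k -> bool) i Y : uniq L -> i \in L -> p i ->
  Delta_seq L p Y = G i (Delta_seq L (fun j => p j && (j != i)) Y).
Proof.
elim: L => // j L IH /= /andP[jL uL]; rewrite inE => /orP[/eqP ->|iL] pi.
  have e : Delta_seq L p = Delta_seq L (fun l => p l && (l != j)).
    apply: eq_Delta_seq => l lL; case: eqVneq => [lj|]; last by rewrite andbT.
    by rewrite -lj lL in jL.
  by rewrite /Delta_seq !big_cons/= -!/(Delta_seq _ _) eqxx andbF /= -e pi.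
have ji : j != i by apply: contraNneq jL => ->.
rewrite /Delta_seq !big_cons/= -!/(Delta_seq _ _) IH// ji andbT.
by case: (p j) => //=; rewrite id_sub_Phi_comm.
Qed.

Lemma Delta_seq_id L (p : 'I_k -> bool) Y : {in L, forall i, ~~ p i} -> Delta_seq L p Y = Y.
Proof.
elim: L => [|j L IH] Lp; first by rewrite /Delta_seq big_nil.
rewrite /Delta_seq big_cons/= (negPf (Lp j _)) ?mem_head//=; apply: IH => i iL.
by rewrite Lp// inE iL orbT.
Qed.

Lemma DeltaE p Y : Delta q X p Y = Delta_seq (index_enum 'I_k) p Y.
Proof. by []. Qed.

Lemma Delta_pull (p : 'I_k -> bool) i Y : p i ->
  Delta q X p Y = G i (Delta q X (fun j => p j && (j != i)) Y).
Proof.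
by move=> pi; rewrite !DeltaE; apply: Delta_seq_pull; rewrite ?index_enum_uniq ?mem_index_enum.
Qed.

Lemma Delta_single i : Delta q X (pred1 i) 1 = 1 - Phi (q i) (X i) 1.
Proof.
rewrite (@Delta_pull _ i) /= ?eqxx// DeltaE Delta_seq_id// => j _.
by rewrite /=; case: (j == i).
Qed.

Lemma polydomain_minus_row i : polydomain_minus q H X -> row_contraction (q i) (X i).
Proof.
move=> [_ Xp] h; have := positive_op_rdot (Xp (pred1 i)) h.
by rewrite Delta_single bop_subE rdotBl subr_ge0 rdot_Phi1 rdotxx.
Qed.

(** Dropping the factor id - Phi_j increases the operator: the difference is Phi_j
    of a defect operator, and those are positive. *)
Lemma Delta_le i (s : seq 'I_k) h : polydomain_minus q H X ->
  rdot (Delta q X (fun=> true) 1 h) h <=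
  rdot (Delta q X (fun j => (j \notin s) || (j == i)) 1 h) h.
Proof.
move=> [_ Xp]; elim: s => [|j s IH]; first by under [in leRHS]eq_fun do rewrite in_nil.
apply: le_trans IH _.
have [js|js] := boolP ((j \in s) || (j == i)).
  rewrite le_eqVlt; apply/orP; left; apply/eqP; congr (rdot (bop_fun (Delta q X _ 1) h) h).
  apply/funext => l; rewrite inE negb_or; have [->|lj] := eqVneq l j; last by [].
  by move: js; case: (j == i); rewrite ?orbT// orbF => ->.
move: js; rewrite negb_or => /andP[js ji].
rewrite (@Delta_pull _ j); last by rewrite js.
rewrite bop_subE rdotBl lerBlDr.
have -> : (fun l => ((l \notin s) || (l == i)) && (l != j)) =
          (fun l => (l \notin j :: s) || (l == i)).
  apply/funext => l; rewrite inE negb_or; have [->|lj] := eqVneq l j.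
    by rewrite andbF (negPf ji).
  by rewrite andbT.
rewrite lerDl rdot_Phi; apply: sumr_ge0 => al _; apply: mulr_ge0.
  by case: (hq i) => h0 _ _; case: (hq j) => h1 _ _; apply: h1.
exact: positive_op_rdot.
Qed.

(** Dropping all variables but i from Delta_X(I) >= c leaves I - Phi_i(I) >= c. *)
Lemma polydomain_strict_row : polydomain q H X ->
  exists2 c : R, 0 < c & forall i h, phi_form (q i) (X i) h <= (1 - c) * rnorm h ^+ 2.
Proof.
move=> [Xm /strictly_positive_lower_bound[c c0 hc]]; exists c => // i h.
have := le_trans (hc h) (Delta_le i (index_enum 'I_k) h Xm).
have -> : (fun j => (j \notin index_enum 'I_k) || (j == i)) = pred1 i.
  by apply/funext => j; rewrite mem_index_enum.
rewrite Delta_single bop_subE rdotBl rdot_Phi1 rdotxx mulrBl mul1r; lra.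
Qed.
End Fixed.
End PhiMaps.

(** * Convergence inside the polydomain *)

Lemma cvg_sum_seq (R : realType) (T : Type) (F : set_system T) {FF : Filter F}
    (I : Type) (r : seq I) (f : I -> T -> R) (a : I -> R) :
  (forall i, f i x @[x --> F] --> a i) ->
  (\sum_(i <- r) f i x) @[x --> F] --> \sum_(i <- r) a i.
Proof.
move=> fa; elim: r => [|i r IH].
  by rewrite big_nil; under eq_fun do rewrite big_nil; exact: cvg_cst.
by rewrite big_cons; under eq_fun do rewrite big_cons; exact: cvgD.
Qed.

Section RowContraction.
Variables (R : realType) (H : hilbertType R).

Variables (n : nat) (q : {fsfun seq 'I_n -> R with 0}).
Hypothesis hq : positive_regular q.

(** The vector is allowed to vary with m so that the induction can peel one letter
    at a time. *)
Lemma cvg_adjoint_word (X : 'I_n -> bop H H) (Y : nat -> 'I_n -> bop H H) (al : seq 'I_n)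
    (v : H) (w : nat -> H) :
  (forall j m, opnorm (X j - Y m j) <= m.+1%:R^-1) ->
  (fun m => rnorm (w m - v)) @ \oo --> (0 : R) ->
  (fun m => rnorm (adjoint (word_op (Y m) al) (w m) - adjoint (word_op X al) v)) @ \oo --> (0 : R).
Proof.
move=> XY; elim: al v w => [|j al IH] v w wv.
  by rewrite word_op_nil adjoint1; under eq_fun do rewrite word_op_nil adjoint1.
rewrite word_op_cons adjointM bop_mulE.
under eq_fun do rewrite word_op_cons adjointM bop_mulE.
apply: IH.
apply: (@squeeze_cvgr _ _ _ _ (fun=> 0)
  (fun m => (opnorm (X j) + 1) * rnorm (w m - v) + harmonic m * rnorm v)).
- near=> m; rewrite rnorm_ge0 /=.
  have -> : adjoint (Y m j) (w m) - adjoint (X j) v =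
    adjoint (Y m j) (w m - v) - adjoint (X j - Y m j) v.
    by rewrite adjointB bop_subE bopB; rewrite opprB addrA subrK.
  apply: (le_trans (ler_rnormD _ _)); rewrite rnormN; apply: lerD.
    apply: (le_trans (rnorm_adjoint _ _)); rewrite ler_wpM2r ?rnorm_ge0//.
    rewrite !opnorm_rnorm -lerBlDl; apply: (le_trans (ler_rnormB _ _)).
    rewrite rdistC -opnorm_rnorm (le_trans (XY _ _))// invf_le1//.
    by rewrite ler1n.
  apply: (le_trans (rnorm_adjoint _ _)); by rewrite ler_wpM2r ?rnorm_ge0// XY.
- exact: cvg_cst.
- rewrite [X in _ --> X](_ : 0 = (opnorm (X j) + 1) * 0 + 0 * rnorm v :> R); last by rewrite mulr0 mul0r addr0.
  apply: cvgD; first exact: cvgMr.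
  by apply: cvgMl; exact: cvg_harmonic.
Unshelve. all: by end_near. Qed.

Lemma row_contraction_closed (X : 'I_n -> bop H H) :
  (forall e : R, 0 < e -> exists2 Y, row_contraction q Y & forall j, opnorm (X j - Y j) < e) ->
  row_contraction q X.
Proof.
move=> XY h.
have /choice[Y hY] : forall m : nat, exists Y, row_contraction q Y /\
    forall j, opnorm (X j - Y j) <= m.+1%:R^-1.
  move=> m; have [|Y Y1 Y2] := XY (m.+1%:R^-1); first by rewrite invr_gt0.
  by exists Y; split => // j; exact: ltW.
have cw al : (fun m => rnorm (adjoint (word_op (Y m) al) h)) @ \oo -->
      rnorm (adjoint (word_op X al) h).
  have := @cvg_adjoint_word X Y al h (fun=> h) (fun j m => (hY m).2 j).
  rewrite subrr rnorm0 => /(_ (cvg_cst _)) /cvgrPdist_lt c.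
  apply/cvgrPdist_lt => e e0; have := c e e0.
  apply: filterS => m; rewrite sub0r normrN ger0_norm ?rnorm_ge0//; apply: le_lt_trans.
  by rewrite rdistC ler_rnorm_dist.
have cphi : (fun m => phi_form q (Y m) h) @ \oo --> phi_form q X h.
  apply: cvg_sum_seq => al; apply: cvgMr.
  by rewrite expr2; under eq_fun do rewrite expr2; exact: cvgM.
rewrite -(cvg_lim _ cphi)//; apply: limr_le; first by apply: cvgP cphi.
by near=> m; exact: (hY m).1.
Unshelve. all: by end_near. Qed.

Lemma phi_form_dilate (X : 'I_n -> bop H H) (t : R) h :
  phi_form q (fun j => t%:C *: X j) h =
  \sum_(al <- finsupp q) q al * ((t ^+ size al) ^+ 2 * rnorm (adjoint (word_op X al) h) ^+ 2).
Proof.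
apply: eq_bigr => al _; congr (_ * _).
by rewrite word_op_dilate adjointZ bop_scaleE rnormZ exprMn real_normK ?num_real.
Qed.

(** Dividing X by r multiplies each term of the form by at most r^(-2d), d
    bounding the degree of q. *)
Lemma phi_form_shrink (X : 'I_n -> bop H H) (c r : R) (d : nat) :
  0 < r <= 1 -> 1 - c <= r ^+ (2 * d) -> (forall al, al \in finsupp q -> (size al <= d)%N) ->
  (forall h, phi_form q X h <= (1 - c) * rnorm h ^+ 2) ->
  row_contraction q (fun j => (r^-1)%:C *: X j).
Proof.
move=> /andP[r0 r1] cr hd hX h; rewrite phi_form_dilate.
apply: (@le_trans _ _ ((r^-1) ^+ (2 * d) * phi_form q X h)).
  rewrite /phi_form mulr_sumr big_seq [leRHS]big_seq; apply: ler_sum => al alq.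
  rewrite [leRHS]mulrCA; apply: ler_wpM2l; first by case: hq.
  rewrite ler_wpM2r ?sqr_ge0// -exprM mulnC ler_weXn2l//.
    by rewrite invf_ge1.
  by rewrite leq_mul2l/= hd.
rewrite exprVn ler_pdivrMl ?exprn_gt0//; apply: (le_trans (hX h)).
by rewrite ler_wpM2r ?sqr_ge0.
Qed.
End RowContraction.

Lemma bernoulli_ge (R : realType) (x : R) m : 0 <= x <= 1 -> 1 - m%:R * x <= (1 - x) ^+ m.
Proof.
move=> /andP[x0 x1]; elim: m => [|m IH]; first by rewrite mul0r subr0.
rewrite exprSr; apply: (le_trans _ (ler_wpM2r _ IH)); last by rewrite subr_ge0.
rewrite -natr1; have : 0 <= m%:R * x ^+ 2 by rewrite mulr_ge0 ?sqr_ge0.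
move: (m%:R : R) => a; nra.
Qed.

Section Convergence.
Variables (R : realType) (k : nat) (hk : (0 < k)%N) (n : 'I_k -> nat).
Variables (q : forall i : 'I_k, {fsfun seq 'I_(n i) -> R with 0}).
Hypothesis hq : forall i, positive_regular (q i).

(** The same r has to serve all variables: d bounds all degrees, and Bernoulli
    gives r^(2d) >= 1 - c. *)
Lemma polydomain_shrink (H : hilbertType R) (X : optuple n H) : polydomain q H X ->
  exists2 r : R, 0 < r < 1 &
    forall i, row_contraction (q i) (fun j => (r^-1)%:C *: X i j).
Proof.
move=> XD; have [[cX _] _] := XD.
have [c c0 hc] := polydomain_strict_row hq cX XD.
pose d := (\max_(i < k) \max_(al <- finsupp (q i)) size al)%N.
(* the minimum with 1/2 keeps 1 - x positive when c is large *)
pose x := Num.min c (2^-1 : R) / (2 * d)%N.+1%:R.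
have m0 : 0 < Num.min c (2^-1 : R) by rewrite lt_min c0 invr_gt0 ltr0n.
have x0 : 0 < x by rewrite divr_gt0.
have xm : x <= Num.min c 2^-1.
  by rewrite ler_pdivrMr// ler_peMr ?ler1n// ltW.
have x2 : x <= 2^-1 by rewrite (le_trans xm)// ge_min lexx orbT.
have x1 : x < 1 by rewrite (le_lt_trans x2)// invf_lt1 ?ltr1n.
exists (1 - x); first by rewrite subr_gt0 x1 ltrBlDr ltrDl.
move=> i; apply: (phi_form_shrink (c := c) (d := d) (hq i)).
- by rewrite subr_gt0 x1 lerBlDr lerDl ltW.
- apply: (le_trans _ (bernoulli_ge _ _)); last by rewrite !ltW.
  rewrite lerD2l lerN2 (@le_trans _ _ (Num.min c 2^-1))//; last by rewrite ge_min lexx.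
  rewrite /x mulrCA ler_piMr ?(ltW m0)// ler_pdivrMr// mul1r ler_nat; lia.
- move=> al alq; apply: leq_trans (leq_bigmax i).
  by apply: leq_bigmax_seq.
- exact: hc.
Qed.

Lemma closure_row_contraction (H : hilbertType R) (X : optuple n H) i :
  op_closure (polydomain q H) X -> row_contraction (q i) (X i).
Proof.
move=> Xc; apply: row_contraction_closed => // e e0.
have [Y [Ym _] XY] := Xc e e0; exists (Y i) => //.
by apply: polydomain_minus_row => //; case: Ym.
Qed.

Variables (K : hilbertType R) (A : multiword n -> bop K K).

Lemma degree_inftyP (V : set (multidegree k)) : degree_infty V -> V !=set0.
Proof.
move=> [N _ NV]; exists [ffun=> N]; apply: NV => /=.
rewrite /total_degree (bigD1 (Ordinal hk))//= ffunE; exact: leq_addr.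
Qed.

Lemma inv_conv_radius_ge0 : (0 <= inv_conv_radius q A)%E.
Proof.
apply: le_ereal_inf_tmp => _ [V /degree_inftyP[p Vp] <-].
apply: (@le_trans _ _ ((column_norm q A p `^ ((2 * total_degree p)%N%:R^-1))%:E)).
  by rewrite lee_fin powR_ge0.
by apply: ereal_sup_ubound; exists p.
Qed.

Lemma conv_radius_ge0 : (0 <= conv_radius q A)%E.
Proof.
have := inv_conv_radius_ge0; rewrite /conv_radius; case: (inv_conv_radius q A) => [x||]//.
  rewrite lee_fin inver => x0; case: eqP => // _.
  by rewrite lee_fin invr_ge0.
Qed.

(** Membership in the open dilate by gamma is turned into a strictly smaller radius
    (or the radius 0), at the price of weakening D to row contractions. *)
Lemma edilate_radius (H : hilbertType R) (X : optuple n H) :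
  edilate (conv_radius q A) (polydomain q H) X ->
  exists r : R, exists X' : optuple n H, [/\ 0 <= r,
    (r == 0) || (r%:E < conv_radius q A)%E, X = (fun i j => r%:C *: X' i j) &
    forall i, row_contraction (q i) (X' i)].
Proof.
have := conv_radius_ge0; case: (conv_radius q A) => [g||]//=.
  rewrite lee_fin le_eqVlt => /orP[/eqP <-|g0] [X' X'D <-].
    exists 0, X'; split => //; first by rewrite eqxx.
    by move=> i; have [[cX _] _] := X'D; case: X'D => + _; exact: polydomain_minus_row.
  have [r /andP[r0 r1] hr] := polydomain_shrink X'D.
  exists (g * r), (fun i j => (r^-1)%:C *: X' i j); split => //.
  - by rewrite mulr_ge0 ?ltW.
  - by rewrite lte_fin gtr_pMr// r1 orbT.
  - apply: functional_extensionality_dep => i; apply/funext => j.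
    by rewrite scalerA -rmorphM/= mulfK ?gt_eqF.
move=> _ [r /= r0 [X' X'D <-]].
exists r, X'; split; rewrite ?ltry ?orbT ?ltW//.
by move=> i; have [[cX _] _] := X'D; case: X'D => + _; exact: polydomain_minus_row.
Qed.

Variables (H T : hilbertType R) (tau : {bilinear K -> H -> T}).
Hypothesis tauP : is_hilbert_tensor tau.

Lemma convergence_on_polydomain (X : optuple n H) :
  edilate (conv_radius q A) (polydomain q H) X ->
  cvg (partial_sum (fun p => opnorm (homogeneous_part A tau X p)) @ totally).
Proof.
move=> /edilate_radius[r [X' [r0 rg -> hX']]].
have [M hM] := majorant_bounded r0 rg.
apply: (partial_sum_dominated_cvg hM) => p; rewrite opnorm_ge0/=.
exact: opnorm_homogeneous_part_le.
Qed.

Lemma uniform_convergence (r : R) : 0 <= r -> (r%:E < conv_radius q A)%E ->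
  {uniform dilate r (op_closure (polydomain q H)),
     (fun F (X : optuple n H) =>
        partial_sum (fun p => opnorm (homogeneous_part A tau X p)) F)
       @ totally -->
     (fun X : optuple n H =>
        sum (fun p => opnorm (homogeneous_part A tau X p)))}.
Proof.
move=> r0 rg; have [|M hM] := @majorant_bounded _ _ _ q _ A r r0; first by rewrite rg orbT.
apply: (dominated_uniform (m := majorant q A r) (M := M)) => //.
- by move=> p; exact: majorant_ge0.
- by move=> p X; exact: opnorm_ge0.
move=> p _ [X Xc <-]; apply: opnorm_homogeneous_part_le => // i; exact: closure_row_contraction.
Qed.
End Convergence.

(** * The spaces l2 over an arbitrary index set *)

Section L2.
Variables (R : realType) (I : choiceType) (V : hilbertType R).

Definition l2_pred : {pred I -> V} :=
  fun f => `[< exists M : R, forall F : {fset I}, \sum_(i <- F) rnorm (f i) ^+ 2 <= M >].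

Record l2 := L2 { l2_fun :> I -> V ; _ : l2_fun \in l2_pred }.
HB.instance Definition _ := [isSub for l2_fun].
HB.instance Definition _ := [Choice of l2 by <:].

Lemma l2_submod_closed : submod_closed l2_pred.
Proof.
split.
  by apply/asboolP; exists 0 => F; rewrite big1// => i _; rewrite rnorm0 expr0n.
move=> a f g /asboolP[M fM] /asboolP[N gN]; apply/asboolP.
exists (2 * ((complex.Re `|a|) ^+ 2 * M + N)) => F.
apply: (@le_trans _ _ (\sum_(i <- F)
   2 * ((complex.Re `|a|) ^+ 2 * rnorm (f i) ^+ 2 + rnorm (g i) ^+ 2))).
  apply: ler_sum => i _; rewrite fctE /=.
  have := ler_rnormD (a *: f i) (g i); rewrite rnormZc.
  rewrite -exprMn; move: (_ * _) (rnorm (g i)) (rnorm _) (rnorm_ge0 (a *: f i + g i)) => u v w w0 h.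
  have : w ^+ 2 <= (u + v) ^+ 2 by rewrite lerXn2r// nnegrE// (le_trans w0).
  have : 0 <= (u - v) ^+ 2 by exact: sqr_ge0.
  rewrite sqrrB sqrrD; lra.
rewrite -mulr_sumr big_split/= -mulr_sumr ler_pM2l// lerD//.
by rewrite ler_wpM2l ?sqr_ge0.
Qed.
HB.instance Definition _ := GRing.isSubmodClosed.Build R[i] (I -> V) l2_pred l2_submod_closed.
HB.instance Definition _ := [SubChoice_isSubLmodule of l2 by <:].

Implicit Types f g h : l2.

Lemma l2_addE f g i : (f + g) i = f i + g i. Proof. by []. Qed.
Lemma l2_scaleE (a : R[i]) f i : (a *: f) i = a *: f i. Proof. by []. Qed.
Lemma l2_subE f g i : (f - g) i = f i - g i. Proof. by []. Qed.
Lemma l2_zeroE i : (0 : l2) i = 0. Proof. by []. Qed.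
Lemma l2_ext f g : f =1 g -> f = g.
Proof. by move=> fg; apply: val_inj; apply/funext. Qed.

Definition l2_dotR f g : R := sum (fun i => rdot (f i) (g i)).

Lemma l2_sqr_cvg f : cvg (partial_sum (fun i => rnorm (f i) ^+ 2) @ totally).
Proof.
have /asboolP[M fM] := valP f; apply: cvgP; apply: (@nonneg_bounded_cvg _ _ _ M) => [i|F].
  exact: sqr_ge0.
by rewrite partial_sumE.
Qed.

(** By polarisation the partial sums are combinations of three convergent sums of
    squares. *)
Lemma l2_dotR_cvg f g :
  partial_sum (fun i => rdot (f i) (g i)) @ totally --> l2_dotR f g.
Proof.
suff : cvg (partial_sum (fun i => rdot (f i) (g i)) @ totally) by [].
have -> : partial_sum (fun i => rdot (f i) (g i)) =
  (fun F => 2^-1 * (partial_sum (fun i => rnorm ((f + g) i) ^+ 2) F -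
    partial_sum (fun i => rnorm (f i) ^+ 2) F - partial_sum (fun i => rnorm (g i) ^+ 2) F)).
  apply/funext => F; rewrite !partial_sumE -!sumrB mulr_sumr; apply: eq_bigr => i _.
  by rewrite l2_addE sqr_rnormD; field.
by apply: is_cvgMr; apply: is_cvgB; [apply: is_cvgB|]; exact: l2_sqr_cvg.
Qed.

Lemma l2_dotRE f g (l : R) :
  partial_sum (fun i => rdot (f i) (g i)) @ totally --> l -> l2_dotR f g = l.
Proof. by move=> fgl; apply: cvg_lim. Qed.

Lemma l2_dotRC f g : l2_dotR f g = l2_dotR g f.
Proof. by congr (sum _); apply/funext => i; rewrite rdotC. Qed.

Lemma l2_dotRD f g h : l2_dotR (f + g) h = l2_dotR f h + l2_dotR g h.
Proof.
apply: l2_dotRE.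
have -> : partial_sum (fun i => rdot ((f + g) i) (h i)) =
  (fun F => partial_sum (fun i => rdot (f i) (h i)) F + partial_sum (fun i => rdot (g i) (h i)) F).
  apply/funext => F; rewrite !partial_sumE -big_split; apply: eq_bigr => i _.
  by rewrite l2_addE rdotDl.
by apply: cvgD; exact: l2_dotR_cvg.
Qed.

Lemma l2_dotRZ (a : R) f g : l2_dotR (a%:C *: f) g = a * l2_dotR f g.
Proof.
apply: l2_dotRE.
have -> : partial_sum (fun i => rdot ((a%:C *: f) i) (g i)) =
  (fun F => a * partial_sum (fun i => rdot (f i) (g i)) F).
  apply/funext => F; rewrite !partial_sumE mulr_sumr; apply: eq_bigr => i _.
  by rewrite l2_scaleE rdotZl.
by apply: cvgMr; exact: l2_dotR_cvg.
Qed.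

Lemma l2_dotRI f g : l2_dotR ('i%C *: f) ('i%C *: g) = l2_dotR f g.
Proof. by congr (sum _); apply/funext => i; rewrite !l2_scaleE rdot_iI. Qed.

Lemma l2_dotRxx f : partial_sum (fun i => rnorm (f i) ^+ 2) @ totally --> l2_dotR f f.
Proof.
have -> : (fun i => rnorm (f i) ^+ 2) = (fun i => rdot (f i) (f i)).
  by apply/funext => i; rewrite rdotxx.
exact: l2_dotR_cvg.
Qed.

Lemma l2_partial_le f (F : {fset I}) : \sum_(i <- F) rnorm (f i) ^+ 2 <= l2_dotR f f.
Proof.
rewrite -partial_sumE; apply: (cvgr_to_ge (@l2_dotRxx f)).
by exists F => //= G FG; apply: ler_partial_sum => // i; exact: sqr_ge0.
Qed.

Lemma l2_dotR_le f (M : R) : (forall F : {fset I}, \sum_(i <- F) rnorm (f i) ^+ 2 <= M) ->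
  l2_dotR f f <= M.
Proof.
move=> fM; apply: (cvgr_to_le (@l2_dotRxx f)).
by exists fset0 => // G _; rewrite /= partial_sumE.
Qed.

Lemma l2_dotR_ge0 f : 0 <= l2_dotR f f.
Proof. by have := l2_partial_le f fset0; rewrite big_seq_fset0. Qed.

Lemma l2_dotR_eq0 f : l2_dotR f f = 0 -> f = 0.
Proof.
move=> f0; apply: l2_ext => i; apply/eqP; rewrite l2_zeroE -rnorm_eq0 -sqrf_eq0.
by rewrite eq_le sqr_ge0 andbT -f0; have := l2_partial_le f [fset i]%fset; rewrite big_seq_fset1.
Qed.

Let norm_l2 f : R[i] := (Num.sqrt (l2_dotR f f))%:C.

Let l2_normD f g : norm_l2 (f + g) <= norm_l2 f + norm_l2 g.
Proof.
rewrite /norm_l2 -rmorphD lecR.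
exact: real_dot_triangle l2_dotRC l2_dotRD l2_dotRZ l2_dotR_ge0 _ _.
Qed.

Let l2_normZ (a : R[i]) f : norm_l2 (a *: f) = `|a| * norm_l2 f.
Proof.
rewrite /norm_l2 (real_dot_norm l2_dotRC l2_dotRD l2_dotRZ l2_dotRI).
rewrite sqrtrM ?sqr_ge0// sqrtr_sqr ger0_norm.
  by rewrite [LHS]rmorphM.
exact: (@rnorm_ge0 _ (R[i]^o) a).
Qed.

Let l2_norm0_eq0 f : norm_l2 f = 0 -> f = 0.
Proof.
move=> /(@complexI R) /eqP; rewrite sqrtr_eq0 => f0.
by apply: l2_dotR_eq0; apply/eqP; rewrite eq_le f0 l2_dotR_ge0.
Qed.

HB.instance Definition _ := Lmodule_isNormed.Build R[i] l2 l2_normD l2_normZ l2_norm0_eq0.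

Lemma l2_rnormE f : rnorm f = Num.sqrt (l2_dotR f f).
Proof. by apply: (@complexI R); rewrite rnormE. Qed.

Lemma l2_sqr_rnorm f : rnorm f ^+ 2 = l2_dotR f f.
Proof. by rewrite l2_rnormE sqr_sqrtr// l2_dotR_ge0. Qed.

Lemma l2_rnorm_le f (M : R) : 0 <= M ->
  (forall F : {fset I}, \sum_(i <- F) rnorm (f i) ^+ 2 <= M ^+ 2) -> rnorm f <= M.
Proof.
move=> M0 fM; rewrite -(@ler_pXn2r _ 2%N)// ?nnegrE ?rnorm_ge0// l2_sqr_rnorm.
exact: l2_dotR_le.
Qed.

Lemma l2_coord_le f i : rnorm (f i) <= rnorm f.
Proof.
rewrite -(@ler_pXn2r _ 2%N)// ?nnegrE ?rnorm_ge0// l2_sqr_rnorm.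
by have := l2_partial_le f [fset i]%fset; rewrite big_seq_fset1.
Qed.
End L2.

(** * Completeness of l2 and of the scalars *)

Section L2Hilbert.
Variables (R : realType) (I : choiceType) (V : hilbertType R).
Local Notation l2 := (l2 I V).
Implicit Types f g h : l2.

(** A Cauchy filter converges coordinatewise to some g. The bound on the norm of
    f - f0 near the filter passes to each finite partial sum of g - f0, which
    gives both that g is in l2 and that the filter converges to it. *)
Lemma l2_complete (F : set_system l2) : ProperFilter F -> cauchy F -> cvg F.
Proof.
move=> FF /cauchyP Fc.
have Fc' (e : R) : 0 < e -> exists f0 : l2, F [set f : l2 | rnorm (f0 - f) < e].
  move=> e0; have [|f0 Ff0] := Fc e%:C; first by rewrite ltcR.
  by exists f0; apply: filterS Ff0 => f; rewrite rnorm_ball.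
have /choice[g Fg] : forall i, exists v : V, forall e : R, 0 < e ->
    F [set f : l2 | rnorm (v - f i) < e].
  move=> i.
  have : cauchy ((fun f : l2 => f i) @ F).
    apply: cauchy_exP => _ /complex_pos[e e0 ->].
    have [f0 Ff0] := Fc' e e0; exists (f0 i).
    suff : F [set f : l2 | ball (f0 i) e%:C (f i)] by [].
    apply: filterS Ff0 => f /= h; rewrite rnorm_ball.
    exact: le_lt_trans (l2_coord_le (f0 - f) i) h.
  move=> /cauchy_cvgP /cvg_ex[v Fv]; exists v => e e0.
  have Fb : F [set f : l2 | ball v e%:C (f i)] by apply: Fv; apply: nbhsx_ballx; rewrite ltcR.
  by apply: filterS Fb => f; rewrite /mkset rnorm_ball.
have key (e : R) (f0 : l2) : 0 < e -> F [set f : l2 | rnorm (f0 - f) < e] ->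
    forall J : {fset I}, \sum_(i <- J) rnorm (g i - f0 i) ^+ 2 <= e ^+ 2.
  move=> e0 Ff0 J.
  have c : (fun f : l2 => \sum_(i <- J) rnorm (f i - f0 i) ^+ 2) @ F -->
      \sum_(i <- J) rnorm (g i - f0 i) ^+ 2.
    apply: cvg_sum_seq => i.
    have ci : (fun f : l2 => rnorm (f i - f0 i)) @ F --> rnorm (g i - f0 i).
      apply/cvgrPdist_lt => d d0; apply: filterS (Fg i d d0) => f /=.
      apply: le_lt_trans; apply: (le_trans (ler_rnorm_dist _ _)).
      by rewrite opprB addrA subrK.
    by rewrite expr2; under eq_fun do rewrite expr2; exact: cvgM.
  apply: (cvgr_to_le c); apply: filterS Ff0 => f /= h.
  apply: (@le_trans _ _ (rnorm (f0 - f) ^+ 2)).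
    rewrite l2_sqr_rnorm; apply: (le_trans _ (l2_partial_le _ J)).
    by apply: ler_sum => i _; rewrite rdistC.
  by rewrite lerXn2r// ?nnegrE ?rnorm_ge0 ?ltW.
have [f1 Ff1] := Fc' 1 ltr01.
have gl2 : (fun i => g i - f1 i) \in @l2_pred R I V.
  by apply/asboolP; exists (1 ^+ 2) => J; exact: key.
pose g' : l2 := L2 gl2 + f1.
have g'E i : g' i = g i by rewrite l2_addE /= subrK.
apply/cvg_ex; exists g' => P /nbhs_ballP[_ /complex_pos[e e0 ->] eP].
have e20 : 0 < e / 2 by rewrite divr_gt0.
have [f0 Ff0] := Fc' _ e20.
have g'f0 : rnorm (g' - f0) <= e / 2.
  apply: l2_rnorm_le => [|J]; first exact: ltW.
  apply: le_trans (key _ _ e20 Ff0 J); apply: ler_sum => i _.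
  by rewrite l2_subE g'E.
apply: filterS Ff0 => f /= h; apply: eP; rewrite rnorm_ball.
apply: (le_lt_trans (ler_rdistD f0 _ _)).
by rewrite (splitr e) ler_ltD.
Qed.

HB.instance Definition _ := Uniform_isComplete.Build l2 l2_complete.

Definition l2_dot f g : R[i] := complex_dot (@l2_dotR R I V) f g.

Let l2_dot_bilinear : bilinear_for *%R (Num.conj \; *%R) l2_dot.
Proof.
split=> [g|f].
  exact: (complex_dot_linear (@l2_dotRC R I V) (@l2_dotRD R I V) (@l2_dotRZ R I V) (@l2_dotRI R I V)).
exact: (complex_dot_conj_linear (@l2_dotRC R I V) (@l2_dotRD R I V) (@l2_dotRZ R I V) (@l2_dotRI R I V)).
Qed.

HB.instance Definition _ := @bilinear_isBilinear.Build R[i] l2 l2 R[i] *%R (Num.conj \; *%R)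
  l2_dot l2_dot_bilinear.

Let l2_dot_herm f g : l2_dot f g = (-1) ^+ false * Num.conj (l2_dot g f).
Proof.
by rewrite expr0 mul1r; exact: (complex_dotC (@l2_dotRC R I V) (@l2_dotRZ R I V) (@l2_dotRI R I V)).
Qed.
HB.instance Definition _ := @isHermitianSesquilinear.Build R[i] l2 false Num.conj l2_dot l2_dot_herm.

Lemma l2_dotxx f : l2_dot f f = (l2_dotR f f)%:C.
Proof.
exact: (complex_dotxx (@l2_dotRC R I V) (@l2_dotRZ R I V) (@l2_dotRI R I V)).
Qed.

Let l2_dot_gt0 f : f != 0 -> 0 < l2_dot f f.
Proof.
move=> f0; rewrite l2_dotxx ltcR lt_neqAle l2_dotR_ge0 andbT eq_sym.
by apply: contra_neq f0; exact: l2_dotR_eq0.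
Qed.
HB.instance Definition _ := @isDotProduct.Build R[i] l2 l2_dot l2_dot_gt0.

Let l2_sqr_norm f : `|f| ^+ 2 = l2_dot f f.
Proof. by rewrite l2_dotxx -rnormE -rmorphXn/= l2_sqr_rnorm. Qed.

HB.instance Definition _ := isHilbert.Build R l2 l2_sqr_norm.

Lemma l2_rdotE f g : rdot f g = l2_dotR f g.
Proof. by []. Qed.

End L2Hilbert.

(** A copy of R[i]^o, on which the completeness of C can be declared apart from
    that of the real line as a module over itself. *)
Definition scalar_space (R : realType) : Type := R[i]^o.

Section ComplexHilbert.
Variable R : realType.
Local Notation C := (scalar_space R).
HB.instance Definition _ := NormedModule.copy C (R[i]^o).

Let scalar_complete (F : set_system C) : ProperFilter F -> cauchy F -> cvg F.
Proof.
move=> FF /cauchyP Fc.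
have Fc' (e : R) : 0 < e -> exists z : C, F [set w : C | rnorm (z - w) < e].
  move=> e0; have [|f0 Ff0] := Fc e%:C; first by rewrite ltcR.
  by exists f0; apply: filterS Ff0 => f; rewrite rnorm_ball.
have part (pr : R[i] -> R) : (forall z w, pr (z - w) = pr z - pr w) ->
    (forall z : C, `|pr z| <= rnorm z) -> exists v : R, forall e, 0 < e ->
    F [set w : C | `|v - pr w| < e].
  move=> prB prn; have : cauchy ((fun w : C => pr w : R^o) @ F).
    apply: cauchy_exP => e e0; have [z Fz] := Fc' e e0; exists (pr z).
    suff : F [set w : C | ball (pr z : R^o) e (pr w)] by [].
    apply: filterS Fz => w /= h; rewrite -ball_normE /= -prB.
    exact: le_lt_trans h.
  move=> /cauchy_cvgP /cvg_ex[v Fv]; exists v => e e0.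
  have Fb : F [set w : C | ball v e (pr w : R^o)] by apply: Fv; apply: nbhsx_ballx.
  by apply: filterS Fb => w; rewrite /mkset -ball_normE.
have nE (a b : R) : rnorm (a +i* b : C) = Num.sqrt (a ^+ 2 + b ^+ 2) by [].
have [a ha] : exists v : R, forall e, 0 < e -> F [set w : C | `|v - complex.Re w| < e].
  apply: part => [z w|[x y]]; first by rewrite raddfB.
  by rewrite nE -sqrtr_sqr ler_wsqrtr// lerDl sqr_ge0.
have [b hb] : exists v : R, forall e, 0 < e -> F [set w : C | `|v - complex.Im w| < e].
  apply: part => [z w|[x y]]; first by rewrite raddfB.
  by rewrite nE -sqrtr_sqr ler_wsqrtr// lerDr sqr_ge0.
apply/cvg_ex; exists (a +i* b : C) => P /nbhs_ballP[_ /complex_pos[e e0 ->] eP].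
have e20 : 0 < e / 2 by rewrite divr_gt0.
apply: filterS (filterI (ha _ e20) (hb _ e20)) => -[x y] [/= h1 h2].
apply: eP; rewrite rnorm_ball.
have -> : (a +i* b : C) - (x +i* y : C) = ((a - x) +i* (b - y) : C) by [].
rewrite nE -(ger0_norm (ltW e0)) -sqrtr_sqr ltr_sqrt ?exprn_gt0//.
have h (u : R) : `|u| < e / 2 -> u ^+ 2 <= (e / 2) ^+ 2.
  by move=> /ltW hu; rewrite -(real_normK (num_real u)) lerXn2r// ?nnegrE ?ltW.
have := h _ h1; have := h _ h2; rewrite expr_div_n.
have : 0 < e ^+ 2 by rewrite exprn_gt0.
move: (e ^+ 2) => E; lra.
Qed.
HB.instance Definition _ := Uniform_isComplete.Build C scalar_complete.

Definition scalar_dot (z w : C) : R[i] := (z : R[i]) * Num.conj (w : R[i]).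

Let scalar_dot_bilinear : bilinear_for *%R (Num.conj \; *%R) scalar_dot.
Proof.
have lin (a x y w : R[i]) : (a * x + y) * Num.conj w = a * (x * Num.conj w) + y * Num.conj w.
  by rewrite mulrDl mulrA.
have clin (a x y z : R[i]) : z * Num.conj (a * x + y) = Num.conj a * (z * Num.conj x) + z * Num.conj y.
  by rewrite rmorphD rmorphM mulrDr mulrCA.
by split=> [w a x y|z a x y]; [exact: lin|exact: clin].
Qed.
HB.instance Definition _ := @bilinear_isBilinear.Build R[i] C C R[i] *%R (Num.conj \; *%R)
  scalar_dot scalar_dot_bilinear.
Let scalar_dot_herm z w : scalar_dot z w = (-1) ^+ false * Num.conj (scalar_dot w z).
Proof.
have h (u v : R[i]) : u * Num.conj v = Num.conj (v * Num.conj u).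
  by rewrite rmorphM /= conjCK mulrC.
by rewrite expr0 mul1r; exact: h.
Qed.
HB.instance Definition _ := @isHermitianSesquilinear.Build R[i] C false Num.conj scalar_dot scalar_dot_herm.
Let scalar_dot_gt0 z : z != 0 -> 0 < scalar_dot z z.
Proof.
move=> z0; have h (u : R[i]) : u != 0 -> 0 < u * Num.conj u.
  by move=> u0; rewrite -normCK exprn_gt0// normr_gt0.
exact: h.
Qed.
HB.instance Definition _ := @isDotProduct.Build R[i] C scalar_dot scalar_dot_gt0.
Let scalar_sqr_norm (z : C) : `|z| ^+ 2 = scalar_dot z z.
Proof. exact: normCK. Qed.
HB.instance Definition _ := isHilbert.Build R C scalar_sqr_norm.

End ComplexHilbert.

(** * The tensor product of K with scalar l2 *)

Section Delta.
Variables (R : realType) (I : choiceType) (V : hilbertType R).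
Local Notation l2 := (l2 I V).

Lemma l2_delta_subproof (i : I) (v : V) :
  (fun j => if j == i then v else 0) \in @l2_pred R I V.
Proof.
apply/asboolP; exists (rnorm v ^+ 2) => F.
have [iF|iF] := boolP (i \in F).
  rewrite (big_fsetD1 _ iF)/= eqxx big_seq big1 ?addr0// => j.
  by rewrite !inE => /andP[/negPf -> _]; rewrite rnorm0 expr0n.
rewrite big_seq big1 ?sqr_ge0// => j jF; case: eqP => [e|_]; last by rewrite rnorm0 expr0n.
by rewrite e (negPf iF) in jF.
Qed.
Definition l2_delta (i : I) (v : V) : l2 := L2 (l2_delta_subproof i v).

Lemma l2_deltaE i v j : l2_delta i v j = if j == i then v else 0.
Proof. by []. Qed.

Lemma rdot_delta i v (f : l2) : rdot (l2_delta i v) f = rdot v (f i).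
Proof.
rewrite l2_rdotE; apply: l2_dotRE; apply/cvgrPdist_lt => e e0.
exists [fset i]%fset => //= F iF'; have iF : i \in F by rewrite -fsub1set.
rewrite partial_sumE (big_fsetD1 _ iF)/= eqxx big_seq big1 ?addr0 ?subrr ?normr0//.
by move=> j; rewrite !inE => /andP[/negPf -> _]; rewrite rdot0l.
Qed.

Lemma rnorm_delta i v : rnorm (l2_delta i v) = rnorm v.
Proof.
apply/eqP; rewrite -(@eqrXn2 _ 2%N)// ?rnorm_ge0// -!rdotxx.
by rewrite rdot_delta l2_deltaE eqxx.
Qed.

Lemma l2_sum_coord (J : Type) (r : seq J) (P : pred J) (F : J -> l2) i :
  (\sum_(j <- r | P j) F j) i = \sum_(j <- r | P j) F j i.
Proof. by elim/big_rec2: _ => [|j a b _ <-]; rewrite ?l2_zeroE ?l2_addE. Qed.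

Lemma l2_delta_dense (t : l2) (e : R) : 0 < e ->
  exists F : {fset I}, rnorm (t - \sum_(i <- F) l2_delta i (t i)) <= e.
Proof.
move=> e0; have e2 : 0 < e ^+ 2 by rewrite exprn_gt0.
have /cvgrPdist_lt/(_ _ e2)[F _ hF] := @l2_dotRxx _ _ _ t.
exists F; apply: l2_rnorm_le; first exact: ltW.
move=> G; have := hF (G `|` F)%fset (fsubsetUr _ _).
rewrite ger0_norm; last by rewrite subr_ge0 partial_sumE l2_partial_le.
pose u i := rnorm (t i) ^+ 2.
have tE i : rnorm ((t - \sum_(i <- F) l2_delta i (t i)) i) ^+ 2 =
    if i \in F then 0 else u i.
  rewrite l2_subE l2_sum_coord; under eq_bigr do rewrite l2_deltaE.
  case: ifPn => iF.
    rewrite (big_fsetD1 _ iF)/= eqxx big_seq big1 ?addr0 ?subrr ?rnorm0 ?expr0n//.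
    by move=> j; rewrite !inE eq_sym => /andP[/negPf ->].
  rewrite big_seq big1 ?subr0// => j jF; case: eqP => // e'.
  by rewrite e' jF in iF.
under [leLHS]eq_bigr do rewrite tE.
have h1 := hF F (fsubset_refl _).
rewrite ger0_norm in h1; last by rewrite subr_ge0 partial_sumE l2_partial_le.
move=> _.
have h2 : partial_sum u (G `|` F)%fset <= l2_dotR t t by rewrite partial_sumE l2_partial_le.
apply: (@le_trans _ _ (partial_sum u (G `|` F)%fset - partial_sum u F)); last first.
  by rewrite ltW// (le_lt_trans _ h1)// lerD2r.
rewrite !partial_sumE.
rewrite (big_fsetID _ (mem F) (G `|` F)%fset)/=.
have -> : [fset x in (G `|` F)%fset | x \in F]%fset = F.
  by apply/fsetP => x; rewrite !inE /= andb_orl andbb; case: (x \in F); rewrite ?orbT ?andbF.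
rewrite addrAC subrr add0r.
have -> : \sum_(i <- G) (if i \in F then 0 else u i) = \sum_(i <- G | i \notin F) u i.
  by rewrite [RHS]big_mkcond; apply: eq_bigr => i _; rewrite if_neg.
rewrite -[leLHS]big_filter.
have -> : \sum_(i <- [seq i <- G | i \notin F]) u i =
    \sum_(i <- [fset x in (G `|` F)%fset | x \notin F]%fset) u i.
  apply: perm_big; apply: uniq_perm; rewrite ?filter_uniq ?fset_uniq// => x.
  by rewrite mem_filter !inE /= andb_orl andbN orbF andbC.
by [].
Qed.
End Delta.

Section Tensor.
Variables (R : realType) (I : choiceType) (K : hilbertType R).
Local Notation C := (scalar_space R).
Local Notation H := (l2 I C).
Local Notation T := (l2 I K).

Lemma l2_tensor_subproof (x : K) (f : H) :
  (fun i => (f i : R[i]) *: x) \in @l2_pred R I K.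
Proof.
apply/asboolP; exists (rnorm f ^+ 2 * rnorm x ^+ 2) => F.
rewrite l2_sqr_rnorm; apply: (@le_trans _ _ (\sum_(i <- F) rnorm (f i) ^+ 2 * rnorm x ^+ 2)).
  by apply: ler_sum => i _; rewrite rnormZc exprMn.
by rewrite -mulr_suml ler_wpM2r ?sqr_ge0// l2_partial_le.
Qed.
Definition l2_tensor (x : K) (f : H) : T := L2 (l2_tensor_subproof x f).

Let l2_tensor_bilinear : bilinear_for *:%R *:%R l2_tensor.
Proof.
split=> [f|x] a u v; apply: l2_ext => i; rewrite l2_addE l2_scaleE /=.
  by rewrite scalerDr !scalerA mulrC.
by rewrite scalerDl scalerA.
Qed.
HB.instance Definition _ := @bilinear_isBilinear.Build R[i] K H T *:%R *:%R
  l2_tensor l2_tensor_bilinear.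

(** Both inner products are sums of products of complex numbers; comparing real
    parts is enough. For density, truncate an element of l2(I; K) to finitely many
    coordinates. *)
Lemma l2_tensor_hilbert : is_hilbert_tensor l2_tensor.
Proof.
split.
  have re x x' f f' : rdot (l2_tensor x f) (l2_tensor x' f') =
      rdot f f' * rdot x x' - rdot f ('i%C *: f') * rdot x ('i%C *: x').
    rewrite !(@l2_rdotE R I); apply: l2_dotRE.
    have -> : partial_sum (fun i => rdot (l2_tensor x f i) (l2_tensor x' f' i)) =
      (fun F => partial_sum (fun i => rdot (f i) (f' i)) F * rdot x x' -
                partial_sum (fun i => rdot (f i) (('i%C *: f') i)) F * rdot x ('i%C *: x')).
      apply/funext => F; rewrite !partial_sumE !mulr_suml -sumrB; apply: eq_bigr => i _ /=.
      have e1 : '[f i *: x, f' i *: x'] = (f i : R[i]) * (Num.conj (f' i : R[i]) * '[x, x']).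
        by rewrite linearZl_LR linearZr_LR.
      have e2 : '[x, 'i%C *: x'] = Num.conj 'i%C * '[x, x'] by rewrite linearZr_LR.
      have e3 : '[f i, f' i] = (f i : R[i]) * Num.conj (f' i : R[i]) by [].
      have e4 : '[f i, ('i%C *: f') i] = (f i : R[i]) * Num.conj ('i%C * (f' i : R[i])) by [].
      rewrite /rdot e1 e2 e3 e4.
      move: (f i : R[i]) (f' i : R[i]) ('[x, x']) => [a b] [c d] [u v] /=; simpc.
      by rewrite /=; ring.
    apply: cvgB; apply: cvgMl; exact: l2_dotR_cvg.
  move=> x x' f f'; rewrite hdot_rdot.
  have -> : 'i%C *: l2_tensor x' f' = l2_tensor ('i%C *: x') f'.
    by apply: l2_ext => i; rewrite l2_scaleE /= !scalerA mulrC.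
  rewrite !re scalerA -expr2 sqr_i scaleN1r rdotNr [in RHS](hdot_rdot x) [in RHS](hdot_rdot f).
  move: (rdot f f') (rdot x x') (rdot f _) (rdot x _) => a b c d; simpc.
  by congr (_ +i* _); ring.
apply/seteqP; split=> // t _ P /nbhs_ballP[_ /complex_pos[e e0 ->] eP].
have [|F hF] := @l2_delta_dense _ _ _ t (e / 2); first by rewrite divr_gt0.
exists (\sum_(i <- F) l2_delta i (t i)); split; last first.
  apply: eP; rewrite rnorm_ball (le_lt_trans hF)//.
  by rewrite ltr_pdivrMr// ltr_pMr// ltr1n.
exists (size F), (fun m => t (tnth (in_tuple F) m)),
  (fun m => l2_delta (tnth (in_tuple F) m) ((1 : R[i]) : C)).
rewrite big_tnth; apply: eq_bigr => m _; apply: l2_ext => j.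
by rewrite /=; case: eqP => _; rewrite ?scale1r ?scale0r.
Qed.
End Tensor.

(** * Weighted shifts on multiwords *)

Section Multiwords.
Variables (k : nat) (n : 'I_k -> nat).
HB.instance Definition _ := gen_eqMixin (multiword n).
HB.instance Definition _ := gen_choiceMixin (multiword n).
Implicit Types g h : multiword n.

(** Words are stored in dependent functions; all manipulations of a single
    component go through this update. *)
Definition set_word g (i : 'I_k) (w : seq 'I_(n i)) : multiword n :=
  @dfwith 'I_k (fun i => seq 'I_(n i)) g i w.

Lemma set_word_in g i w : set_word g w i = w. Proof. exact: dfwith_in. Qed.
Lemma set_word_out g i (w : seq 'I_(n i)) j : i != j -> set_word g w j = g j.
Proof. exact: dfwith_out. Qed.
Lemma multiword_ext g h : (forall i, g i = h i) -> g = h.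
Proof. exact: functional_extensionality_dep. Qed.
Lemma set_word_id g i : set_word g (g i) = g.
Proof.
by apply: multiword_ext => j; have [<-|ij] := eqVneq i j; rewrite ?set_word_in ?set_word_out.
Qed.
Lemma set_word_set_word g i (w w' : seq 'I_(n i)) : set_word (set_word g w) w' = set_word g w'.
Proof.
by apply: multiword_ext => j; have [<-|ij] := eqVneq i j; rewrite ?set_word_in ?set_word_out.
Qed.
Lemma set_wordC g i j (w : seq 'I_(n i)) (v : seq 'I_(n j)) : i != j ->
  set_word (set_word g w) v = set_word (set_word g v) w.
Proof.
move=> ij; apply: multiword_ext => l.
have [e|jl] := eqVneq j l.
  by case: l / e; rewrite set_word_in set_word_out// set_word_in.
rewrite (set_word_out _ _ jl); have [e|il] := eqVneq i l.
  by case: l / e jl; rewrite !set_word_in.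
by rewrite !set_word_out.
Qed.

Definition drop_word (i : 'I_k) (m : nat) g := set_word g (drop m (g i)).
Definition prepend_word (i : 'I_k) (al : seq 'I_(n i)) g := set_word g (al ++ g i).

Lemma prepend_wordK i (al : seq 'I_(n i)) g : drop_word i (size al) (prepend_word al g) = g.
Proof.
by rewrite /drop_word /prepend_word set_word_in drop_size_cat// set_word_set_word set_word_id. Qed.
Lemma drop_wordK i (al : seq 'I_(n i)) g : take (size al) (g i) = al ->
  prepend_word al (drop_word i (size al) g) = g.
Proof.
move=> e; rewrite /drop_word /prepend_word set_word_in set_word_set_word.
by rewrite -[X in X ++ _]e cat_take_drop set_word_id. Qed.
Lemma drop_word_drop_word i m m' g : drop_word i m (drop_word i m' g) = drop_word i (m + m') g.
Proof. by rewrite /drop_word set_word_in set_word_set_word drop_drop. Qed.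
End Multiwords.

Section Shifts.
Variables (R : realType) (k : nat) (n : 'I_k -> nat).
Variables (q : forall i : 'I_k, {fsfun seq 'I_(n i) -> R with 0}).
Hypothesis hq : forall i, positive_regular (q i).
Local Notation H := (l2 (multiword n) (scalar_space R)).
Local Notation b i := (bcoef (q i)).

Lemma l2_partial_seq_le (I : choiceType) (V : hilbertType R) (f : l2 I V) (s : seq I) :
  uniq s -> \sum_(i <- s) rnorm (f i) ^+ 2 <= l2_dotR f f.
Proof.
move=> us; apply: le_trans (l2_partial_le f [fset x in s]%fset).
rewrite le_eqVlt; apply/orP; left; apply/eqP; apply: perm_big; apply: uniq_perm => //.
by move=> x; rewrite !inE.
Qed.

(** The weight relating e_g to the basis vector obtained by deleting the first m
    letters of the i-th word of g. *)
Definition shift_coef (i : 'I_k) (m : nat) (g : multiword n) : R :=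
  Num.sqrt (b i (drop m (g i)) / b i (g i)).

Lemma sqr_shift_coef i m g : shift_coef i m g ^+ 2 = b i (drop m (g i)) / b i (g i).
Proof. by rewrite sqr_sqrtr// divr_ge0 ?bcoef_ge0. Qed.

(** The left creation operator by g^i_j, which sends e_h to
    (b_{h_i} / b_{g_j h_i})^(1/2) e_{g_j h}, written by its values at g. *)
Definition weighted_shift_fun (i : 'I_k) (j : 'I_(n i)) (f : multiword n -> scalar_space R)
    (g : multiword n) : scalar_space R :=
  if take 1 (g i) == [:: j] then (shift_coef i 1 g)%:C *: f (drop_word i 1 g) else 0.

Lemma positive_regular_gt0 i (j : 'I_(n i)) : 0 < q i [:: j]. Proof. by case: (hq i). Qed.

(** The weights are bounded since b_{g_j w} >= a_{g_j} b_w, and the prepending of a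
    letter is injective. *)
Lemma weighted_shift_bound i (j : 'I_(n i)) (f : H) (F : {fset multiword n}) :
  \sum_(g <- F) rnorm (weighted_shift_fun j f g) ^+ 2 <= (q i [:: j])^-1 * l2_dotR f f.
Proof.
pose P (g : multiword n) := take 1 (g i) == [:: j].
have -> : \sum_(g <- F) rnorm (weighted_shift_fun j f g) ^+ 2 =
    \sum_(g <- F | P g) shift_coef i 1 g ^+ 2 * rnorm (f (drop_word i 1 g)) ^+ 2.
  rewrite [RHS]big_mkcond; apply: eq_bigr => g _; rewrite /weighted_shift_fun -/(P g).
  case: ifP => _; last by rewrite rnorm0 expr0n.
  by rewrite rnormZ exprMn real_normK ?num_real.
apply: (@le_trans _ _ (\sum_(g <- F | P g) (q i [:: j])^-1 * rnorm (f (drop_word i 1 g)) ^+ 2)).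
  apply: ler_sum => g Pg; rewrite ler_wpM2r ?sqr_ge0// sqr_shift_coef.
  rewrite ler_pdivrMr ?bcoef_gt0// mulrC ler_pdivlMr ?positive_regular_gt0// mulrC.
  move: Pg; rewrite /P; case: (g i) => [|j' w]//=; rewrite take0 drop0 => /eqP[->].
  exact: bcoef_cons.
rewrite -mulr_sumr ler_wpM2l ?invr_ge0 ?(ltW (positive_regular_gt0 _))//.
rewrite -big_filter -(big_map (drop_word i 1) xpredT (fun g => rnorm (f g) ^+ 2)).
apply: l2_partial_seq_le; rewrite map_inj_in_uniq ?filter_uniq ?fset_uniq//.
move=> g h; rewrite !mem_filter => /andP[/eqP Pg _] /andP[/eqP Ph _] gh.
by rewrite -(@drop_wordK _ _ i [:: j] g)// -(@drop_wordK _ _ i [:: j] h)//= gh.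
Qed.

Lemma weighted_shift_subproof i (j : 'I_(n i)) (f : H) :
  weighted_shift_fun j f \in @l2_pred R (multiword n) (scalar_space R).
Proof. by apply/asboolP; exists ((q i [:: j])^-1 * l2_dotR f f) => F; exact: weighted_shift_bound. Qed.
Definition weighted_shift_l2 i (j : 'I_(n i)) (f : H) : H := L2 (weighted_shift_subproof j f).

Lemma weighted_shift_bounded i (j : 'I_(n i)) : weighted_shift_l2 j \in bounded_operator H H.
Proof.
apply: (@bounded_operatorI _ _ _ _ (Num.sqrt (q i [:: j])^-1)) => [a f g|f].
  apply: l2_ext => h; rewrite l2_addE l2_scaleE /= /weighted_shift_fun.
  case: ifP => _; last by rewrite scaler0 addr0.
  by rewrite ?l2_addE ?l2_scaleE scalerDr !scalerA mulrC.
apply: l2_rnorm_le => [|F]; first by rewrite mulr_ge0 ?sqrtr_ge0 ?rnorm_ge0.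
rewrite exprMn sqr_sqrtr ?invr_ge0 ?(ltW (positive_regular_gt0 _))// l2_sqr_rnorm.
exact: weighted_shift_bound.
Qed.

Definition weighted_shift : optuple n H := fun i j => Bop (weighted_shift_bounded j).

Lemma weighted_shiftE i (j : 'I_(n i)) (f : H) g : weighted_shift j f g =
  if take 1 (g i) == [:: j] then (shift_coef i 1 g)%:C *: f (drop_word i 1 g) else 0.
Proof. by []. Qed.

Lemma shift_coefM i m m' g :
  shift_coef i m' g * shift_coef i m (drop_word i m' g) = shift_coef i (m + m') g.
Proof.
rewrite /shift_coef -sqrtrM ?divr_ge0 ?bcoef_ge0//; congr Num.sqrt.
rewrite /drop_word set_word_in drop_drop; field.
by rewrite !gt_eqF ?bcoef_gt0.
Qed.

(** The weights along a word telescope ([shift_coefM]). *)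
Lemma word_shiftE i (al : seq 'I_(n i)) (f : H) g : word_op (@weighted_shift i) al f g =
  if take (size al) (g i) == al then (shift_coef i (size al) g)%:C *: f (drop_word i (size al) g)
  else 0.
Proof.
elim: al g => [|j al IH] g.
  rewrite word_op_nil bop_oneE /= take0 eqxx /shift_coef drop0 divff ?gt_eqF ?bcoef_gt0//.
  by rewrite sqrtr1 scale1r /drop_word drop0 set_word_id.
rewrite word_op_cons bop_mulE weighted_shiftE IH drop_word_drop_word addn1 /=.
have -> : (take (size al).+1 (g i) == j :: al) =
    (take 1 (g i) == [:: j]) && (take (size al) (drop_word i 1 g i) == al).
  rewrite /drop_word set_word_in; case: (g i) => [|j' w] //=.
  by rewrite take0 drop0 !eqseq_cons andbT.
case: ifP => // _; case: ifP => _ /=; last by rewrite scaler0.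
by rewrite scalerA -(addn1 (size al)) -shift_coefM rmorphM.
Qed.

Lemma word_shift_delta i (al : seq 'I_(n i)) g v :
  word_op (@weighted_shift i) al (l2_delta g v) =
  l2_delta (prepend_word al g) ((shift_coef i (size al) (prepend_word al g))%:C *: v).
Proof.
apply: l2_ext => h; rewrite word_shiftE !l2_deltaE.
have [->|hg] := eqVneq h (prepend_word al g).
  by rewrite prepend_wordK eqxx /prepend_word set_word_in take_size_cat// eqxx.
case: eqP => // e; case: eqVneq => [d|]; last by rewrite scaler0.
by rewrite -d drop_wordK// eqxx in hg.
Qed.

(** Pair with the basis vectors, whose images are known. *)
Lemma adjoint_word_shiftE i (al : seq 'I_(n i)) (f : H) g :
  adjoint (word_op (@weighted_shift i) al) f g =
  (shift_coef i (size al) (prepend_word al g))%:C *: f (prepend_word al g).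
Proof.
apply: rdot_inj => v; rewrite -rdot_delta -rdot_adjoint word_shift_delta rdot_delta.
by rewrite rdotZl rdotZr.
Qed.

Lemma weighted_shift_commuting : commuting weighted_shift.
Proof.
move=> s t st j l; apply: bop_ext => f; apply: l2_ext => g; rewrite !bop_mulE !weighted_shiftE.
have ts : t != s by rewrite eq_sym.
have e1 : drop_word s 1 g t = g t by rewrite /drop_word set_word_out.
have e2 : drop_word t 1 g s = g s by rewrite /drop_word set_word_out.
rewrite e1 e2; case: ifP => h1; case: ifP => h2; rewrite ?scaler0//.
rewrite !scalerA; congr (_ *: f _); last first.
  by rewrite /drop_word !set_word_out// set_wordC.
by rewrite /shift_coef e1 e2 mulrC.
Qed.
End Shifts.

Arguments weighted_shift {R k n q} hq i j.

(** * The weighted shifts lie in the closure of the polydomain *)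

Section Diagonal.
Variables (R : realType) (I : choiceType) (V : hilbertType R).
Local Notation H := (l2 I V).
Implicit Types (Y : bop H H) (d : I -> R).

Definition diagonal Y d := forall (f : H) g, Y f g = (d g)%:C *: f g.

Lemma diagonal_positive Y d : diagonal Y d -> (forall g, 0 <= d g) -> positive_op Y.
Proof.
move=> Yd d0; apply/positive_opP; split=> [f|f g].
  rewrite l2_rdotE; apply: (cvgr_to_ge (@l2_dotR_cvg _ _ _ (Y f) f)).
  exists fset0 => // F _; rewrite /= partial_sumE; apply: sumr_ge0 => g _.
  by rewrite Yd rdotZl mulr_ge0// rdotxx sqr_ge0.
rewrite !l2_rdotE; congr (sum _); apply/funext => i.
by rewrite !Yd rdotZl rdotZr.
Qed.

Lemma diagonal_invertible Y d (c : R) : diagonal Y d -> 0 < c -> (forall g, c <= d g) ->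
  invertible_op Y.
Proof.
move=> Yd c0 dc; have d0 g : 0 < d g by exact: lt_le_trans (dc g).
pose e (f : H) g : V := ((d g)^-1)%:C *: f g.
have eb (f : H) (F : {fset I}) : \sum_(g <- F) rnorm (e f g) ^+ 2 <= c^-1 ^+ 2 * l2_dotR f f.
  apply: (@le_trans _ _ (\sum_(g <- F) c^-1 ^+ 2 * rnorm (f g) ^+ 2)).
    apply: ler_sum => g _; rewrite /e rnormZ exprMn ler_wpM2r ?sqr_ge0//.
    rewrite lerXn2r ?nnegrE ?invr_ge0 ?(ltW c0)//.
    by rewrite ger0_norm ?invr_ge0 ?(ltW (d0 g))// lef_pV2 ?posrE// dc.
  by rewrite -mulr_sumr ler_wpM2l ?sqr_ge0// l2_partial_le.
have el2 f : e f \in @l2_pred R I V by apply/asboolP; exists (c^-1 ^+ 2 * l2_dotR f f); exact: eb.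
have bE : (fun f : H => L2 (el2 f)) \in bounded_operator H H.
  apply: (@bounded_operatorI _ _ _ _ c^-1) => [a f g|f].
    apply: l2_ext => h; rewrite l2_addE l2_scaleE /= /e l2_addE l2_scaleE.
    by rewrite scalerDr !scalerA mulrC.
  apply: l2_rnorm_le => [|F]; first by rewrite mulr_ge0 ?rnorm_ge0// invr_ge0 ltW.
  by rewrite exprMn l2_sqr_rnorm; exact: eb.
exists (Bop bE); split; apply: bop_ext => f; apply: l2_ext => g; rewrite bop_mulE bop_oneE /=.
  by rewrite /e Yd scalerA -rmorphM/= mulVf ?scale1r// gt_eqF.
by rewrite Yd /= /e scalerA -rmorphM/= mulfV ?scale1r// gt_eqF.
Qed.
End Diagonal.

Section ShiftDomain.
Variables (R : realType) (k : nat) (n : 'I_k -> nat).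
Variables (q : forall i : 'I_k, {fsfun seq 'I_(n i) -> R with 0}).
Hypothesis hq : forall i, positive_regular (q i).
Local Notation H := (l2 (multiword n) (scalar_space R)).
Local Notation b i := (bcoef (q i)).
Local Notation S := (weighted_shift hq).

Section Dilated.
Variable r : R.
Hypothesis r01 : 0 <= r < 1.
Let r0 : 0 <= r. Proof. by case/andP: r01. Qed.
Let r1 : r < 1. Proof. by case/andP: r01. Qed.
Let dilated_shift : optuple n H := fun i j => r%:C *: S i j.
Arguments dilated_shift : clear implicits.

(** The symbol of Phi_{q_i, rW_i}(I), on the i-th word. *)
Definition shift_symbol (i : 'I_k) (w : seq 'I_(n i)) : R :=
  \sum_(al <- finsupp (q i) | take (size al) w == al)
    q i al * (r ^+ size al) ^+ 2 * (b i (drop (size al) w) / b i w).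

(** For r = 1 this is the renewal equation divided by b_w, so the sum is at most 1;
    every word in the support of q_i has a letter, which yields the factor r^2. *)
Lemma shift_symbol_le i (w : seq 'I_(n i)) : shift_symbol w <= r ^+ 2.
Proof.
have [q0 qnil _] := hq i.
have w0 : 0 < b i w by exact: bcoef_gt0.
have nnil al : al \in finsupp (q i) -> (0 < size al)%N.
  by case: al => //; rewrite mem_finsupp qnil eqxx.
have r2 : 0 <= r ^+ 2 by exact: sqr_ge0.
apply: (@le_trans _ _ (\sum_(al <- finsupp (q i) | take (size al) w == al)
   r ^+ 2 / b i w * (q i al * b i (drop (size al) w)))).
  rewrite /shift_symbol big_seq_cond [leRHS]big_seq_cond; apply: ler_sum => al /andP[/nnil al0 _].
  have -> : q i al * (r ^+ size al) ^+ 2 * (b i (drop (size al) w) / b i w) =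
    (r ^+ size al) ^+ 2 * ((b i w)^-1 * (q i al * b i (drop (size al) w))) by ring.
  rewrite -[leRHS]mulrA; apply: ler_wpM2r.
    by apply: mulr_ge0; [rewrite invr_ge0 ltW|rewrite mulr_ge0 ?bcoef_ge0].
  rewrite lerXn2r ?nnegrE ?exprn_ge0// -(prednK al0) exprS.
  by rewrite ler_piMr// exprn_ile1// ltW.
rewrite -mulr_sumr -mulrA ler_piMr// mulrC ler_pdivrMr// mul1r.
have [w_nil|wn0] := eqVneq w [::].
  rewrite w_nil big_seq_cond big1 ?bcoef_nil ?ler01// => al /andP[/nnil + /eqP].
  by case: al.
rewrite [leRHS]bcoef_rec//.
(* match each prefix of w in the support of q_i with its length *)
pose G al d := if take d w == al then q i al * b i (drop d w) else 0.
have G0 al d : 0 <= G al d by rewrite /G; case: ifP => // _; rewrite mulr_ge0 ?bcoef_ge0.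
apply: (@le_trans _ _ (\sum_(al <- finsupp (q i)) \sum_(1 <= d < (size w).+1) G al d)).
  rewrite big_mkcond big_seq [leRHS]big_seq; apply: ler_sum => al alq.
  case: eqP => [e|_]; last exact: sumr_ge0.
  have sz : (size al <= size w)%N by rewrite -e size_take_min geq_minr.
  rewrite (@big_cat_nat _ _ _ (size al))//=; [|exact: nnil|by rewrite ltnW].
  rewrite (@big_ltn _ _ _ (size al))//= addrCA {1}/G e eqxx lerDl.
  by rewrite addr_ge0// sumr_ge0.
rewrite exchange_big/= !big_nat; apply: ler_sum => d _.
have qb0 : 0 <= q i (take d w) * b i (drop d w) by rewrite mulr_ge0 ?bcoef_ge0.
rewrite /G; have [dq|dq] := boolP (take d w \in finsupp (q i)).
  rewrite (big_fsetD1 _ dq) /= eqxx big_seq big1 ?addr0// => al.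
  by rewrite !inE eq_sym => /andP[/negPf ->].
rewrite big_seq big1// => al alq; case: eqP => // e.
by rewrite e alq in dq.
Qed.

(** A diagonal that does not see the i-th word factors out of Phi_i. *)
Lemma Phi_diagonal (i : 'I_k) (Y : bop H H) d : diagonal Y d ->
  (forall g m, d (drop_word i m g) = d g) ->
  diagonal (Phi (q i) (dilated_shift i) Y) (fun g => shift_symbol (g i) * d g).
Proof.
move=> Yd di f g; rewrite /Phi bop_sumE l2_sum_coord /shift_symbol mulr_suml rmorph_sum scaler_suml.
rewrite [RHS]big_mkcond; apply: eq_bigr => al _.
rewrite bop_scaleE l2_scaleE /dilated_shift word_op_dilate adjointZ.
rewrite !(bop_mulE, bop_scaleE) l2_scaleE word_shiftE.
case: eqP => [e|_]; last by rewrite !scaler0.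
rewrite Yd di l2_scaleE adjoint_word_shiftE drop_wordK// !scalerA; congr (_ *: _).
rewrite -!rmorphM/=; congr (_%:C); rewrite -sqr_shift_coef//; ring.
Qed.

(** Each factor id - Phi_i acts on a diagonal built from the other variables only. *)
Lemma Delta_seq_diagonal (L : seq 'I_k) (p : 'I_k -> bool) : uniq L ->
  diagonal (Delta_seq q dilated_shift L p 1)
    (fun g => \prod_(i <- L) (if p i then 1 - shift_symbol (g i) else 1)).
Proof.
elim: L => [_|i L IH /= /andP[iL uL]].
  by move=> f g; rewrite /Delta_seq !big_nil scale1r.
have {}IH := IH uL; rewrite /Delta_seq big_cons /= -/(Delta_seq _ _ _ _).
have ind (g : multiword n) m : \prod_(j <- L) (if p j then 1 - shift_symbol (drop_word i m g j) else 1) =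
    \prod_(j <- L) (if p j then 1 - shift_symbol (g j) else 1).
  rewrite !big_seq; apply: eq_bigr => j jL; rewrite /drop_word set_word_out//.
  by apply: contraNneq iL => ->.
move=> f g; rewrite big_cons; case: (p i) => /=; last by rewrite mul1r IH.
transitivity (Delta_seq q dilated_shift L p 1 f g -
  Phi (q i) (dilated_shift i) (Delta_seq q dilated_shift L p 1) f g) => //.
rewrite IH (Phi_diagonal IH ind) mulrBl mul1r rmorphB.
exact/esym/scalerBl.
Qed.

Lemma dilated_shift_polydomain : polydomain q H dilated_shift.
Proof.
have r2 : r ^+ 2 < 1 by rewrite expr_lt1.
have D p : diagonal (Delta q dilated_shift p 1)
    (fun g => \prod_(i < k) (if p i then 1 - shift_symbol (g i) else 1)).
  exact: Delta_seq_diagonal (index_enum_uniq _).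
have c0 : 0 < (1 - r ^+ 2) ^+ k by rewrite exprn_gt0// subr_gt0.
have Dge (p : 'I_k -> bool) (g : multiword n) :
    (1 - r ^+ 2) ^+ k <= \prod_(i < k) (if p i then 1 - shift_symbol (g i) else 1).
  rewrite -[k in leLHS]card_ord -prodr_const; apply: ler_prod => i _.
  rewrite subr_ge0 (ltW r2)/=; case: ifP => _; first by rewrite lerD2l lerN2 shift_symbol_le.
  by rewrite lerBlDr lerDl sqr_ge0.
have Dpos p : positive_op (Delta q dilated_shift p 1).
  by apply: diagonal_positive (D p) _ => g; rewrite /=; apply: (le_trans (ltW c0)); exact: Dge.
split; first split; last first.
- split; first exact: Dpos.
  exact: diagonal_invertible (D _) c0 (Dge _).
- exact: Dpos.
move=> s t st j l; rewrite /dilated_shift !(bop_scalerAl, bop_scalerAr) !scalerA mulrC; congr (_ *: _).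
exact: weighted_shift_commuting.
Qed.
End Dilated.

(** W is the norm limit of its dilations rW, r < 1. *)
Lemma weighted_shift_closure : op_closure (polydomain q H) S.
Proof.
move=> e e0.
pose M := \sum_i \sum_j opnorm (S i j).
have M0 : 0 <= M by rewrite sumr_ge0// => i _; rewrite sumr_ge0// => j _; exact: opnorm_ge0.
have SM i j : opnorm (S i j) <= M.
  rewrite /M (bigD1 i)//= (bigD1 j)//= -addrA lerDl addr_ge0// sumr_ge0// => l _.
    exact: opnorm_ge0.
  by rewrite sumr_ge0// => m _; exact: opnorm_ge0.
pose d := Num.min (e / (M + 1)) 1 / 2.
have M1 : 0 < M + 1 by rewrite ltr_wpDl.
have m0 : 0 < Num.min (e / (M + 1)) 1 by rewrite lt_min ltr01 divr_gt0.
have d0 : 0 < d by rewrite divr_gt0.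
have d1 : d <= 1.
  rewrite ler_pdivrMr// mul1r (@le_trans _ _ 1)// ?ler1n// ge_min lexx orbT//.
have de : d < e / (M + 1).
  rewrite (@lt_le_trans _ _ (Num.min (e / (M + 1)) 1))//; last by rewrite ge_min lexx.
  by rewrite ltr_pdivrMr// ltr_pMr// ltr1n.
exists (fun i j => (1 - d)%:C *: S i j).
  by apply: dilated_shift_polydomain; rewrite subr_ge0 d1 ltrBlDr ltrDl.
move=> i j; have -> : S i j - (1 - d)%:C *: S i j = d%:C *: S i j.
  by rewrite -[X in X - _]scale1r -scalerBl -[1]/(1%:C) -rmorphB opprB addrC subrK.
rewrite opnorm_rnorm rnormZ -opnorm_rnorm ger0_norm ?ltW//.
apply: (@le_lt_trans _ _ (d * (M + 1))).
  by rewrite ler_wpM2l ?ltW// (le_lt_trans (SM i j))// ltrDl.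
by rewrite -ltr_pdivlMr.
Qed.
End ShiftDomain.

(** * Divergence at the dilated shifts *)

Section Divergence.
Variables (R : realType) (k : nat) (hk : (0 < k)%N) (n : 'I_k -> nat).
Variables (q : forall i : 'I_k, {fsfun seq 'I_(n i) -> R with 0}).
Hypothesis hq : forall i, positive_regular (q i).
Local Notation C := (scalar_space R).
Local Notation H := (l2 (multiword n) C).
Local Notation b i := (bcoef (q i)).
Local Notation S := (weighted_shift hq).
Local Notation one := ((1 : R[i]) : C).

Lemma l2_deltaZ (I : choiceType) (V : hilbertType R) (i : I) (a : R[i]) (v : V) :
  l2_delta i (a *: v) = a *: l2_delta i v.
Proof.
by apply: l2_ext => j; rewrite l2_scaleE !l2_deltaE; case: eqP => _; rewrite ?scaler0.
Qed.

Definition empty_word : multiword n := fun=> [::].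

(** Words are prepended variable by variable to the empty multiword, each time with
    weight b^(-1/2). *)
Lemma multiword_shift_delta (al : multiword n) (v : C) :
  multiword_op S al (l2_delta empty_word v) =
  l2_delta al ((\prod_(i < k) Num.sqrt (b i (al i))^-1)%:C *: v).
Proof.
pose restr (L : seq 'I_k) : multiword n := fun j => if j \in L then al j else [::].
have {1}-> : al = restr (index_enum 'I_k).
  by apply: multiword_ext => j; rewrite /restr mem_index_enum.
have -> : multiword_op S (restr (index_enum 'I_k)) =
  \prod_(i <- index_enum 'I_k) word_op (S i) (al i).
  by apply: eq_bigr => i _; rewrite /restr mem_index_enum.
suff main L : uniq L -> (\prod_(i <- L) word_op (S i) (al i)) (l2_delta empty_word v) =
    l2_delta (restr L) ((\prod_(i <- L) Num.sqrt (b i (al i))^-1)%:C *: v).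
  rewrite main ?index_enum_uniq//; congr l2_delta.
  by apply: multiword_ext => j; rewrite /restr mem_index_enum.
elim: L => [_|i L IH /= /andP[iL uL]].
  rewrite !big_nil bop_oneE scale1r; congr l2_delta.
rewrite !big_cons bop_mulE IH// word_shift_delta.
have e : prepend_word (al i) (restr L) = restr (i :: L).
  apply: multiword_ext => j; rewrite /prepend_word; have [<-|ij] := eqVneq i j.
    by rewrite set_word_in /restr mem_head (negPf iL) cats0.
  by rewrite set_word_out// /restr inE eq_sym (negPf ij).
rewrite e scalerA -rmorphM/=; congr (l2_delta _ ((_ * _)%:C *: _)).
rewrite /shift_coef /restr mem_head drop_size bcoef_nil div1r //.
Qed.

Variables (K : hilbertType R) (A : multiword n -> bop K K).
Local Notation tau := (@l2_tensor R (multiword n) K : {bilinear K -> H -> l2 (multiword n) K}).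

Lemma rnorm_one : rnorm one = 1.
Proof. by apply: (@complexI R); rewrite rnormE; exact: (@normr1 R[i]). Qed.

(** The vectors W_alpha e for alpha in Lambda_p are orthogonal of norm
    b_alpha^(-1/2). *)
Lemma rnorm_homogeneous_shift (s : R) (p : multidegree k) x :
  rnorm (homogeneous_part A tau (fun i j => s%:C *: S i j) p
    (l2_tensor x (l2_delta empty_word one))) ^+ 2 =
  (s ^+ total_degree p) ^+ 2 *
  sum_Lambda p (fun al => (bcoef_multi q al)^-1 * rnorm (A al x) ^+ 2).
Proof.
pose E : finType := {dffun forall i : 'I_k, (p i).-tuple 'I_(n i)}.
pose w (f : E) : multiword n := fun i => tval (f i).
have w_inj : injective w.
  move=> f f' ff'; apply/ffunP => i; apply: val_inj.
  exact: (congr1 (fun g : multiword n => g i) ff').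
pose c (f : E) : R := s ^+ total_degree p * \prod_(i < k) Num.sqrt (b i (w f i))^-1.
have -> : homogeneous_part A tau (fun i j => s%:C *: S i j) p (l2_tensor x (l2_delta empty_word one)) =
    \sum_(f : E) tau ((c f)%:C *: A (w f) x) (l2_delta (w f) one).
  rewrite /homogeneous_part /sum_Lambda bop_sumE; apply: eq_bigr => f _.
  rewrite (tensor_opE (@l2_tensor_hilbert R _ K)) multiword_op_dilate bop_scaleE.
  rewrite multiword_shift_delta l2_deltaZ scalerA -rmorphM/=.
  by rewrite [LHS]linearZr_LR [RHS]linearZl_LR.
rewrite (rnorm_tau_orthonormalr (@l2_tensor_hilbert R _ K)); last first.
  move=> f f'; case: eqVneq => [->|ff'].
    by rewrite hdotxx rnorm_delta rnorm_one expr1n.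
  have wff : w f == w f' = false by apply/negbTE; apply: contra_neq ff'; exact: w_inj.
  rewrite hdot_rdot !rdot_delta l2_scaleE l2_deltaE wff scaler0 !rdot0r.
  by rewrite mulr0 addr0.
rewrite /sum_Lambda mulr_sumr; apply: eq_bigr => f _.
rewrite rnormZ exprMn real_normK ?num_real// /c exprMn -mulrA; congr (_ * (_ * _)).
rewrite -prodrXl /bcoef_multi -prodfV; apply: eq_bigr => i _.
by rewrite sqr_sqrtr// invr_ge0 bcoef_ge0.
Qed.

(** The norm of a positive operator is controlled by its quadratic form, by
    Cauchy-Schwarz for that form. *)
Lemma column_norm_le (p : multidegree k) (m : R) : 0 <= m ->
  (forall x, sum_Lambda p (fun al => (bcoef_multi q al)^-1 * rnorm (A al x) ^+ 2) <= m * rnorm x ^+ 2) ->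
  column_norm q A p <= m.
Proof.
move=> m0 hm; set T := sum_Lambda p (fun al =>
  ((bcoef_multi q al)^-1)%:C *: (adjoint (A al) * A al)).
have TE x y : rdot (T x) y =
    sum_Lambda p (fun al => (bcoef_multi q al)^-1 * rdot (A al x) (A al y)) by exact: rdot_column.
have TxxE x : rdot (T x) x = sum_Lambda p (fun al => (bcoef_multi q al)^-1 * rnorm (A al x) ^+ 2).
  by rewrite TE; apply: eq_bigr => f _; rewrite rdotxx.
have T0 x : 0 <= rdot (T x) x.
  rewrite TxxE; apply: sumr_ge0 => f _.
  by rewrite mulr_ge0 ?sqr_ge0// invr_ge0 ltW// bcoef_multi_gt0.
apply: opnorm_ler => // x.
have CS : rdot (T x) (T x) <= Num.sqrt (rdot (T x) x) * Num.sqrt (rdot (T (T x)) (T x)).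
  apply: (@real_dot_CS R K (fun x y => rdot (T x) y)) => //.
  - by move=> u v; rewrite !TE; apply: eq_bigr => f _; rewrite rdotC.
  - by move=> u v z; rewrite bopD rdotDl.
  - by move=> a u v; rewrite bopZ rdotZl.
have sq y : Num.sqrt (rdot (T y) y) <= Num.sqrt m * rnorm y.
  rewrite -[rnorm y]ger0_norm ?rnorm_ge0// -sqrtr_sqr -sqrtrM// ler_wsqrtr//.
  by rewrite TxxE; exact: hm.
have [->|Tx0] := eqVneq (T x) 0; first by rewrite rnorm0 mulr_ge0 ?rnorm_ge0.
have pT : 0 < rnorm (T x) by rewrite lt_neqAle rnorm_ge0 eq_sym rnorm_eq0 Tx0.
rewrite -(ler_pM2r pT) -expr2 -rdotxx; apply: (le_trans CS).
apply: le_trans (ler_pM (sqrtr_ge0 _) (sqrtr_ge0 _) (sq x) (sq (T x))) _.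
by rewrite mulrACA -expr2 sqr_sqrtr// mulrA.
Qed.

Lemma column_norm_le_homogeneous (s : R) (p : multidegree k) : 0 < s ->
  (s ^+ total_degree p) ^+ 2 * column_norm q A p <=
  opnorm (homogeneous_part A tau (fun i j => s%:C *: S i j) p) ^+ 2.
Proof.
move=> s0; set L := opnorm _.
have sp : 0 < (s ^+ total_degree p) ^+ 2 by rewrite !exprn_gt0.
rewrite mulrC -ler_pdivlMr//; apply: column_norm_le => [|x].
  by rewrite divr_ge0 ?sqr_ge0// ltW.
rewrite mulrAC ler_pdivlMr// mulrC -rnorm_homogeneous_shift -exprMn.
rewrite lerXn2r ?nnegrE ?rnorm_ge0 ?mulr_ge0 ?rnorm_ge0 ?opnorm_ge0//.
apply: (le_trans (rnorm_bop _ _)); rewrite (rnorm_tau (@l2_tensor_hilbert R _ K)).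
by rewrite rnorm_delta rnorm_one mulr1.
Qed.

(** A single summand is the difference of two partial sums close to the limit. *)
Lemma opnorm_summand_le1 (T : hilbertType R) (u : multidegree k -> bop T T) :
  cvg (partial_sum u @ totally) ->
  exists F0 : {fset multidegree k}, forall p, p \notin F0 -> opnorm (u p) <= 1.
Proof.
move=> /cvg_ex[l] ul.
have half_gt0 : 0 < (2^-1 : R)%:C by rewrite ltcR invr_gt0.
have [F0 _ hF0] := ul _ (nbhsx_ballx l _ half_gt0).
exists F0 => p pF0.
have h0 : ball l (2^-1)%:C (partial_sum u F0) by apply: hF0; exact: fsubset_refl.
have h1 : ball l (2^-1)%:C (partial_sum u (p |` F0)%fset) by apply: hF0; exact: fsubsetUr.
rewrite !rnorm_ball in h0 h1.
have -> : u p = partial_sum u (p |` F0)%fset - partial_sum u F0.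
  by rewrite !partial_sumE big_fsetU1//= addrK.
rewrite opnorm_rnorm; apply: (le_trans (ler_rdistD l _ _)).
rewrite (rdistC _ l); lra.
Qed.

(** Otherwise s^(2|p|) c_p <= 1 for all but finitely many p, whence 1/gamma <= 1/s. *)
Lemma divergence_at_shifts (s : R) : (conv_radius q A < +oo)%E -> (conv_radius q A < s%:E)%E ->
  ~ cvg (partial_sum (homogeneous_part A tau (fun i j => s%:C *: S i j)) @ totally).
Proof.
move=> gfin gs /opnorm_summand_le1[F0 hF0].
have s0 : 0 < s by rewrite -lte_fin (le_lt_trans _ gs)// conv_radius_ge0.
pose N := (\max_(p <- F0) total_degree p).+1.
have small p : (N <= total_degree p)%N ->
    column_norm q A p `^ ((2 * total_degree p)%N%:R^-1) <= s^-1.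
  move=> Np.
  have p0 : p \notin F0.
    apply/negP => pF0; move: Np; rewrite /N ltnNge => /negP; apply.
    exact: leq_bigmax_seq.
  have := le_trans (column_norm_le_homogeneous p s0) (_ : _ <= 1).
  rewrite expr_le1 ?opnorm_ge0// => /(_ (hF0 _ p0)).
  rewrite mulrC -ler_pdivlMr ?exprn_gt0// div1r -exprM -exprVn => h.
  have m0 : (0 < total_degree p * 2)%N by rewrite muln_gt0 (leq_trans _ Np).
  have m0' : ((total_degree p * 2)%N%:R : R) != 0 by rewrite pnatr_eq0 -lt0n.
  have si : 0 <= s^-1 by rewrite invr_ge0 ltW.
  have e : s^-1 = (s^-1 ^+ (total_degree p * 2)) `^ (total_degree p * 2)%N%:R^-1.
    by rewrite -powR_mulrn// -powRrM mulfV// powRr1.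
  rewrite mulnC [leRHS]e; apply: ge0_ler_powR; rewrite ?nnegrE ?exprn_ge0 ?invr_ge0 ?(ltW s0)//.
  exact: column_norm_ge0.
have inv_le : (inv_conv_radius q A <= (s^-1)%:E)%E.
  apply: (@le_trans _ _ (ereal_sup ((fun p : multidegree k =>
    (column_norm q A p `^ ((2 * total_degree p)%N%:R^-1))%:E) @` [set p | (N <= total_degree p)%N]))).
    by apply: ereal_inf_lbound; eexists; [exists N|reflexivity].
  by apply: ub_ereal_sup => _ [d /small h <-]; rewrite lee_fin.
move: gfin gs inv_le (inv_conv_radius_ge0 hk q A); rewrite /conv_radius.
case: (inv_conv_radius q A) => [x||]//=.
rewrite inver; case: eqP => // /eqP x0 _; rewrite !lte_fin !lee_fin => xs sx xge0.
have xp : 0 < x by rewrite lt_neqAle eq_sym x0.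
by move: sx; rewrite leNgt -[x]invrK ltf_pV2 ?posrE ?invr_gt0// xs.
Qed.
End Divergence.

Theorem theorem2p10 (R : realType) (k : nat) (hk : (0 < k)%N)
    (n : 'I_k -> nat) (hn : forall i, (0 < n i)%N)
    (q : forall i : 'I_k, {fsfun seq 'I_(n i) -> R with 0})
    (hq : forall i, positive_regular (q i))
    (K : hilbertType R) (A : multiword n -> bop K K) :
  let gamma := conv_radius q A in
  (forall (H T : hilbertType R) (tau : {bilinear K -> H -> T}),
     is_hilbert_tensor tau ->
     (forall X : optuple n H, edilate gamma (polydomain q H) X ->
        cvg (partial_sum (fun p => opnorm (homogeneous_part A tau X p))
               @ totally)) /\
     (forall r : R, 0 <= r -> (r%:E < gamma)%E ->
        {uniform dilate r (op_closure (polydomain q H)),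
          (fun F (X : optuple n H) =>
             partial_sum (fun p => opnorm (homogeneous_part A tau X p)) F)
            @ totally -->
          (fun X : optuple n H =>
             sum (fun p => opnorm (homogeneous_part A tau X p)))})) /\
  ((gamma < +oo)%E -> forall s : R, (gamma < s%:E)%E ->
     exists (H T : hilbertType R) (tau : {bilinear K -> H -> T}),
       is_hilbert_tensor tau /\
       exists2 Y : optuple n H, dilate s (op_closure (polydomain q H)) Y &
         ~ cvg (partial_sum (homogeneous_part A tau Y) @ totally)).
Proof.
move=> gamma; split=> [H T tau tauP|gfin s gs].
  split=> [X|r]; first exact: convergence_on_polydomain.
  exact: uniform_convergence.
exists (l2 (multiword n) (scalar_space R)), (l2 (multiword n) K),
  (@l2_tensor R (multiword n) K : {bilinear K -> l2 (multiword n) (scalar_space R) -> l2 (multiword n) K}).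
split; first exact: l2_tensor_hilbert.
exists (fun i j => s%:C%C *: weighted_shift hq i j).
  by exists (weighted_shift hq) => //; exact: weighted_shift_closure.
exact: divergence_at_shifts.
Qed.
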